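(* For every integer $n\ge 0$, the law of the number of surviving bullets in each of the four colliding bullets models RU, RR, FF and FAF (defined in the context) with $n$ bullets equals $\mathbf q_n$. Explicitly: 1. (RU) for every probability distribution $\mu$ with support in $[0,\infty)$ and without atoms, $\mathbf P^{RU}_{n,\mu}=\mathbf q_n$; 2. (RR) for every probability distribution $\mu$ with support in $[0,\infty)$ and without atoms and every probability distribution $\nu$ of a positive random variable (no atom at $0$), $\mathbf P^{RR}_{n,\mu,\nu}=\mathbf q_n$; 3. (FF) for every generic pair $(\mathbf V,\boldsymbol\Delta)$ consisting of a vector $\mathbf V=(V_1,\dots,V_n)\in[0,\infty)^n$ of distinct speeds and a vector $\boldsymbol\Delta=(\Delta_1,\dots,\Delta_{n-1})$ of positive delays, $\mathbf P^{FF}_{\mathbf V,\boldsymbol\Delta}=\mathbf q_n$; 4. (FAF) for every continuous strictly increasing function $f:[0,\infty)\to[0,\infty)$ with $f(0)=0$, and every generic pair $(\mathbf I,\boldsymbol\Delta)$ consisting of a vector $\mathbf I=(I_1,\dots,I_n)\in[0,\infty)^n$ of distinct impetuses and a vector $\boldsymbol\Delta=(\Delta_1,\dots,\Delta_{n-1})$ of positive delays, $\mathbf P^{FAF,f}_{\mathbf I,\boldsymbol\Delta}=\mathbf q_n$.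
   Context: **The distributions $\mathbf q_n$.** $\mathbf q_n=(q_n(k))_{0\le k\le n}$, $n\ge0$, are the probability distributions determined by $q_0(0)=1$, $q_1(1)=1$, $q_1(0)=0$ and, for $N\ge2$ and $0\le k\le N$, $$q_N(k)=\tfrac1N\,q_{N-1}(k-1)+\left(1-\tfrac1N\right)q_{N-2}(k),$$ with $q_n(-1)=0$ and $q_n(k)=0$ if $k>n\ge0$. **Colliding dynamics.** Bullets $1,\dots,n$ are shot from the origin of a half-line at times $t_1<\dots<t_n$ with pairwise distinct speeds $v_1,\dots,v_n\in[0,\infty)$. Ignoring collisions, bullet $i$ is at distance $v_i(t-t_i)$ from the origin at time $t\ge t_i$; its virtual trajectory is the half-line $\overline{HL}(v_i,t_i)=\{(t,v_i(t-t_i)):t\ge t_i\}$. For $i\ne j$ put $T(i,j)=\frac{v_it_i-v_jt_j}{v_i-v_j}$, and let the virtual collision time be $CT(i,j)=T(i,j)$ if $T(i,j)\ge\max\{t_i,t_j\}$, and $CT(i,j)=+\infty$ otherwise. Assume no three virtual trajectories have a common point. Whenever two bullets that have not been destroyed are at the same place at the same time, both are destroyed, and other bullets are unaffected. Formally, start with $\mathcal S=\{1,\dots,n\}$; as long as $T^+=\min\{CT(i,j):i\neq j\in\mathcal S\}$ is finite, remove from $\mathcal S$ all the (necessarily disjoint) pairs $\{i,j\}\subset \mathcal S$ with $CT(i,j)=T^+$, and repeat. The final set $\mathcal S$ is the set of surviving bullets. (A bullet with speed $0$ stays at the origin and is hit by the next bullet at the instant that bullet is shot.) **Generic pair.** $\mathfrak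 S_m$ denotes the symmetric group on $\{1,\dots,m\}$. Given $\mathbf V$ and $\boldsymbol\Delta$ and $(\sigma,\tau)\in\mathfrak S_n\times\mathfrak S_{n-1}$, let $V_i^\sigma=V_{\sigma_i}$ and $T_i^\tau=\Delta_{\tau_1}+\dots+\Delta_{\tau_{i-1}}$ for $1\le i\le n$ (so $T_1^\tau=0$). The pair $(\mathbf V,\boldsymbol\Delta)$ is generic if for every $(\sigma,\tau)$ and all $1\le i<j<k\le n$, $\overline{HL}(V_i^\sigma,T_i^\tau)\cap\overline{HL}(V_j^\sigma,T_j^\tau)\cap\overline{HL}(V_k^\sigma,T_k^\tau)=\varnothing$. **Model RU.** Bullets are fired at times $1,2,\dots,n$ with i.i.d. speeds of law $\mu$; $\mathbf P^{RU}_{n,\mu}$ is the law of the number of surviving bullets. **Model RR.** The speeds are i.i.d. of law $\mu$; bullet $j$ is shot at time $T_j=\sum_{k=1}^{j-1}\Delta_k$, where $\Delta_1,\dots,\Delta_{n-1}$ are i.i.d. of law $\nu$, independent of the speeds; $\mathbf P^{RR}_{n,\mu,\nu}$ is the law of the number of surviving bullets. (In RU and RR almost surely no three virtual trajectories meet, so the number of survivors is almost surely well defined.) **Model FF.** $(\mathbf V,\boldsymbol\Delta)$ is fixed and generic; $\sigma$ and $\tau$ are independent uniform random permutations in $\mathfrak S_n$ and $\mathfrak S_{n-1}$; bullet $i$ has speed $V_{\sigma_i}$ and is shot at time $T_i^\tau$; $\mathbf P^{FF}_{\mathbf V,\boldsymbol\Delta}$ is the law of the number of surviving bullets. **Model FAF.**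 $(\mathbf I,\boldsymbol\Delta)$ is fixed and generic (in the sense that, for every $(\sigma,\tau)$, ignoring collisions, no three bullets are ever at the same place at the same time; since $f$ is strictly increasing, this is the genericity above applied with $\mathbf V=\mathbf I$). With $\sigma,\tau$ independent uniform as in FF, bullet $i$ is shot at time $T_i^\tau$ and, as long as it is alive, its distance to the origin at time $t\ge T_i^\tau$ is $f\big(I_{\sigma_i}(t-T_i^\tau)\big)$. Two living bullets annihilate when they are at the same place at the same time after both have been shot. $\mathbf P^{FAF,f}_{\mathbf I,\boldsymbol\Delta}$ is the law of the number of surviving bullets. For $n=0$ there are no bullets (the number of survivors is $0$); for $n=1$ the vector of delays is empty. *)

(* Defs.v *)
(* Indices are shifted by one: bullet number i+1 is i : 'I_n, and the n-1 delays
   are indexed by 'I_n.-1, which is empty for n = 0 and n = 1. *)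
From HB Require Import structures.
From mathcomp Require Import all_boot all_order all_algebra perm.
From mathcomp Require Import all_classical all_reals all_analysis.

Set Implicit Arguments.
Unset Strict Implicit.
Unset Printing Implicit Defensive.

Import Order.TTheory GRing.Theory Num.Theory.
Import numFieldNormedType.Exports.

Local Open Scope classical_set_scope.
Local Open Scope ring_scope.

(* q R n is extended by 0 outside 0 <= k <= n, see q_gt. *)
Fixpoint q (R : realType) (n k : nat) {struct n} : R :=
  match n with
  | 0 => (k == 0%N)%:R
  | m.+1 =>
    match m with
    | 0 => (k == 1%N)%:R
    | l.+1 => n%:R^-1 * (if k is j.+1 then q R m j else 0)
              + (1 - n%:R^-1) * q R l k
    end
  end.

Lemma q_gt (R : realType) (n k : nat) : (n < k)%N -> q R n k = 0.
Proof.
suff H m : (forall k, (m < k)%N -> q R m k = 0) /\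
           (forall k, (m.+1 < k)%N -> q R m.+1 k = 0) by case: (H n) => + _; apply.
elim: m => [|m [IH0 IH1]]; first by split=> -[|[|j]].
split=> // -[//|j] ltj.
change (q R m.+2 j.+1) with
  (m.+2%:R^-1 * q R m.+1 j + (1 - m.+2%:R^-1) * q R m j.+1 : R).
rewrite IH1 // IH0 ?mulr0 ?addr0 //.
by apply: leq_trans ltj; rewrite ltnS (leq_trans (leqnSn m)).
Qed.

Section Dynamics.
Variables (R : realType) (n : nat).
Implicit Types (CT : 'I_n -> 'I_n -> \bar R) (S : {set 'I_n}).

Definition first_collision CT S : \bar R :=
  \big[Order.min/+oo%E]_(i in S) \big[Order.min/+oo%E]_(j in S | i != j) CT i j.

Definition collision_step CT S : {set 'I_n} :=
  if first_collision CT S \is a fin_num then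
    (S :\: [set i in S | [exists j in S,
              (i != j) && (CT i j == first_collision CT S)]])%SET
  else S.

(* A step with a finite first collision time removes at least one bullet, and
   other steps change nothing: n steps reach the final set. *)
Definition survivors CT : {set 'I_n} := iter n (collision_step CT) [set: 'I_n]%SET.

Definition nb_survivors CT : nat := #|survivors CT|.

Definition crossing_time (v t : 'I_n -> R) (i j : 'I_n) : R :=
  (v i * t i - v j * t j) / (v i - v j).

Definition virtual_CT (v t : 'I_n -> R) (i j : 'I_n) : \bar R :=
  if Num.max (t i) (t j) <= crossing_time v t i j
  then (crossing_time v t i j)%:E else +oo%E.

(* First instant, if any, at which i and j, both shot, are at the same place
   when bullet i is at distance f (v i * (s - t i)) at time s. *)
Definition virtual_CT_along (f : R -> R) (v t : 'I_n -> R) (i j : 'I_n) : \bar R :=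
  ereal_inf [set s%:E | s in [set s : R | [/\ t i <= s, t j <= s &
                               f (v i * (s - t i)) = f (v j * (s - t j))]]].

Definition shooting_time (D : 'I_n.-1 -> R) (i : 'I_n) : R :=
  \sum_(k < n.-1 | (k < i)%N) D k.

Definition generic (traj : R -> R -> set (R * R))
    (V : 'I_n -> R) (D : 'I_n.-1 -> R) : Prop :=
  forall (s : 'S_n) (u : 'S_n.-1) (i j k : 'I_n), (i < j)%N -> (j < k)%N ->
    traj (V (s i)) (shooting_time (D \o u) i) `&`
    traj (V (s j)) (shooting_time (D \o u) j) `&`
    traj (V (s k)) (shooting_time (D \o u) k) = set0.

End Dynamics.

Definition half_line (R : realType) (v t : R) : set (R * R) :=
  [set p | t <= p.1 /\ p.2 = v * (p.1 - t)].

Definition curve_along (R : realType) (f : R -> R) (v t : R) : set (R * R) :=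
  [set p | t <= p.1 /\ p.2 = f (v * (p.1 - t))].

Definition FF_survivors (R : realType) (n : nat) (V : 'I_n -> R)
    (D : 'I_n.-1 -> R) (st : 'S_n * 'S_n.-1) : nat :=
  nb_survivors (virtual_CT (V \o st.1) (shooting_time (D \o st.2))).

Definition FAF_survivors (R : realType) (n : nat) (f : R -> R) (V : 'I_n -> R)
    (D : 'I_n.-1 -> R) (st : 'S_n * 'S_n.-1) : nat :=
  nb_survivors (virtual_CT_along f (V \o st.1) (shooting_time (D \o st.2))).

(* On W = 'S_n * 'S_n.-1, a uniform element is a pair of independent uniform
   permutations. *)
Definition uniform_law (R : realType) (W : finType) (N : W -> nat) (k : nat) : R :=
  #|[pred w | N w == k]|%:R / #|W|%:R.

Section RandomModels.
Context d (T : measurableType d) (R : realType) (P : probability T R).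

Definition mutually_independent (I : finType) (X : I -> {RV P >-> R}) : Prop :=
  forall (J : {set I}) (B : I -> set R), (forall i, measurable (B i)) ->
    P (\bigcap_(i in [set` J]) (X i @^-1` B i)) =
    (\prod_(i in J) P (X i @^-1` B i))%E.

Definition has_law (X : {RV P >-> R}) (mu : probability (measurableTypeR R) R) : Prop :=
  forall A, measurable A -> distribution P X A = mu A.

Definition nat_has_law (N : T -> nat) (p : nat -> R) : Prop :=
  forall k, measurable (N @^-1` [set k]) /\ P (N @^-1` [set k]) = (p k)%:E.

(* The speeds are almost surely distinct; on the remaining null event,
   virtual_CT takes arbitrary (but measurable) values. *)
Definition RU_survivors (n : nat) (V : 'I_n -> {RV P >-> R}) (w : T) : nat :=
  nb_survivors (virtual_CT (fun i => V i w) (fun i => i.+1%:R)).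

Definition RR_survivors (n : nat) (V : 'I_n -> {RV P >-> R})
    (D : 'I_n.-1 -> {RV P >-> R}) (w : T) : nat :=
  nb_survivors (virtual_CT (fun i => V i w) (shooting_time (fun k => D k w))).

Definition join_families (I J : finType) (X : I -> {RV P >-> R})
    (Y : J -> {RV P >-> R}) (x : I + J) : {RV P >-> R} :=
  match x with inl i => X i | inr j => Y j end.

End RandomModels.

Definition speed_law (R : realType) (mu : probability (measurableTypeR R) R) : Prop :=
  mu `[0, +oo[%classic = 1%E /\ forall x : R, mu [set x] = 0%E.

Definition delay_law (R : realType) (nu : probability (measurableTypeR R) R) : Prop :=
  nu `]0, +oo[%classic = 1%E.

(* Main.v *)
(** Collisions may be rescheduled: removing two bullets each of which is the first
    to be met by the other does not change the set of survivors. Hence collisions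
    may be treated by increasing distance to the origin, which turns the dynamics
    into a fixed program: a list of instructions, each of which makes one particle,
    identified by its speed, annihilate with its right neighbour if the gap between
    them has a prescribed value.

    More generally, consider a program in which particles only hit particles of
    smaller rank, and which leaves only words sorted by rank. Whatever the program,
    the number of survivors of a uniform arrangement of n particles and n-1 gaps has
    law q_n. The proof is by induction on n. Add an instruction that makes the
    particle m of maximal rank hit whatever follows it. This instruction may be moved
    to the front of the program: two orders of consecutive instructions only differ
    on arrangements in which some block of particles acts as a single particle, and
    these cancel by the induction hypothesis. Once the instruction comes first, m is
    last with probability 1/n and then survives without influence on the others;
    otherwise it disappears at once with its right neighbour, and the three gaps
    around them merge. This is the recursion that defines q_n.

    Independent speeds and delays are exchangeable and almost surely generic, and one
    averages the law for fixed speeds and delays over all permutations. *)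
Require Import Defs.
From HB Require Import structures.
From mathcomp Require Import all_boot all_order all_algebra perm.
From mathcomp Require Import all_classical all_reals all_analysis measurable_realfun.
From mathcomp Require Import zify ring lra.

Set Implicit Arguments.
Unset Strict Implicit.
Unset Printing Implicit Defensive.

Import Order.TTheory GRing.Theory Num.Theory.
Import numFieldNormedType.Exports.

Local Open Scope ring_scope.

(** * Words of particles *)

(** The induction closes only because programs are so general. A particle that replaces a block no
    longer sees the true lengths of the gaps next to it, and it may have to be given another rank:
    the smaller system is not a system of bullets. Hence gaps lie in an arbitrary commutative
    monoid, and [hits] and [fuse] are arbitrary functions, constrained by the comparison of ranks
    alone. Universality then compares two programs that need share nothing but their particles and
    gaps, not even the ranks; this is what makes the contributions of the two orders cancel. The
    added instruction costs nothing at the end of a program, since a sorted word leaves it nothing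
    to hit. A second copy of the program is put behind it: whatever follows the instruction during
    its move then sorts every word, as the induction hypothesis requires. Its way of fusing gaps
    changes while it moves; this is harmless, since in the end it only enters the length of one
    merged gap. *)

(* A word lists the particles from left to right, each with the gap on its left;
   the gap of the first particle plays no role. An instruction makes the particle
   [who] look at its right neighbour [x] through the gap [g] between them: if
   [hits x g], both vanish, and [fuse x g] replaces [g] in the gap they leave. *)
Record instr (P G : Type) := Instr {
  who : P;
  hits : P -> G -> bool;
  fuse : P -> G -> G }.

Section Words.
Variables (P : eqType) (G : nmodType).
Implicit Types (i : instr P G) (L : seq (instr P G)) (w : seq (G * P)).

Definition addhead (h : G) w :=
  if w is c :: w1 then (h + c.1, c.2) :: w1 else [::].

Fixpoint step i w : seq (G * P) :=
  if w is a :: w1 then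
    if w1 is b :: w2 then
      if a.2 == who i then
        if hits i b.2 b.1 then addhead (a.1 + fuse i b.2 b.1) w2 else w
      else a :: step i w1
    else w
  else w.

Definition run L w := foldl (fun w i => step i w) w L.

Lemma run_cat L1 L2 w : run (L1 ++ L2) w = run L2 (run L1 w).
Proof. exact: foldl_cat. Qed.

Lemma lab_cat (u v : seq (G * P)) : unzip2 (u ++ v) = unzip2 u ++ unzip2 v.
Proof. exact: map_cat. Qed.

Lemma step_neq i a w : a.2 != who i -> step i (a :: w) = a :: step i w.
Proof. by case: w => [|b w] //= /negPf ->. Qed.

Lemma step1 i a : step i [:: a] = [:: a]. Proof. by []. Qed.

Lemma step_eq i a b w : a.2 = who i ->
  step i (a :: b :: w) =
  if hits i b.2 b.1 then addhead (a.1 + fuse i b.2 b.1) w else a :: b :: w.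
Proof. by move=> /= ->; rewrite eqxx. Qed.

Lemma addheadD h k w : addhead h (addhead k w) = addhead (h + k) w.
Proof. by case: w => //= c w; rewrite addrA. Qed.

Lemma lab_addhead h w : unzip2 (addhead h w) = unzip2 w.
Proof. by case: w. Qed.

Lemma size_addhead h w : size (addhead h w) = size w.
Proof. by case: w. Qed.

Lemma step_notin i w : who i \notin unzip2 w -> step i w = w.
Proof.
elim: w => // a w IH; rewrite inE negb_or eq_sym => /andP[na nw].
by rewrite step_neq // IH.
Qed.

Arguments step : simpl never.

Lemma step_subseq i w : subseq (unzip2 (step i w)) (unzip2 w).
Proof.
elim: w => // a [|b w] IH; first exact: subseq_refl.
case: (eqVneq a.2 (who i)) => [e|ne]; last first.
  by rewrite step_neq //= eqxx.
rewrite step_eq //; case: ifP => _; last exact: subseq_refl.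
rewrite lab_addhead.
by apply: (@subseq_trans _ (b.2 :: unzip2 w)); apply: subseq_cons.
Qed.

Lemma step_addhead i h w : step i (addhead h w) = addhead h (step i w).
Proof.
case: w => // a [|b w] //=; case: (eqVneq a.2 (who i)) => [e|ne]; last first.
  by rewrite (@step_neq i (h + a.1, a.2)) // (@step_neq i a).
by rewrite !step_eq //=; case: ifP => // _; rewrite addheadD addrA.
Qed.

Lemma run_addhead L h w : run L (addhead h w) = addhead h (run L w).
Proof. by elim: L w => //= i L IH w; rewrite step_addhead IH. Qed.

Lemma run_subseq L w : subseq (unzip2 (run L w)) (unzip2 w).
Proof.
elim: L w => [|i L IH] w; first exact: subseq_refl.
exact: subseq_trans (IH _) (step_subseq _ _).
Qed.

Lemma run_uniq L w : uniq (unzip2 w) -> uniq (unzip2 (run L w)).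
Proof. exact/subseq_uniq/run_subseq. Qed.

Lemma step_uniq i w : uniq (unzip2 w) -> uniq (unzip2 (step i w)).
Proof. exact/subseq_uniq/step_subseq. Qed.

Lemma run_mem L w x : x \in unzip2 (run L w) -> x \in unzip2 w.
Proof. exact/mem_subseq/run_subseq. Qed.

Lemma step_mem i w x : x \in unzip2 (step i w) -> x \in unzip2 w.
Proof. exact/mem_subseq/step_subseq. Qed.

(** A particle [x] that is still present acts as a wall. The left part needs it only as a possible
    target, the right part only as a first particle whose own gap is never read, whence the
    quantifier on [d]; so both parts evolve separately. *)
Lemma step_wall i l g x r : uniq (unzip2 (l ++ (g, x) :: r)) ->
  x \in unzip2 (step i (l ++ (g, x) :: r)) ->
  exists l' g' r', [/\ step i (l ++ [:: (g, x)]) = l' ++ [:: (g', x)],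
    forall d, step i ((d, x) :: r) = (d, x) :: r' &
    step i (l ++ (g, x) :: r) = l' ++ (g', x) :: r'].
Proof.
elim: l => [|a l IH] U.
  case: (eqVneq x (who i)) => [e|ne]; last first.
    by move=> _; exists [::], g, (step i r); split=> // [d|]; rewrite /= step_neq.
  case: r U => [|b r] U; first by move=> _; exists [::], g, [::].
  have rE d := @step_eq i (d, x) b r e.
  rewrite /= rE; case: ifP => h xin; last first.
    by exists [::], g, (b :: r); split=> // d; rewrite rE h.
  exfalso; case/andP: U => /negP[].
  by rewrite lab_addhead in xin; rewrite inE xin orbT.
case: (eqVneq a.2 (who i)) => [e|ne]; last first.
  rewrite cat_cons step_neq //= inE => /orP[/eqP xa|xin].
    by move: U; rewrite /= -xa lab_cat mem_cat inE eqxx orbT.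
  case/andP: U => _ U; have [l' [g' [r' [e1 e2 e3]]]] := IH U xin.
  by exists (a :: l'), g', r'; split=> //; rewrite ?step_neq // ?e1 ?e3.
have rE d : step i ((d, x) :: r) = (d, x) :: r.
  apply: step_notin; rewrite -e; move: U; rewrite /= lab_cat mem_cat => /andP[].
  by rewrite negb_or => /andP[].
case: l {IH} U => [|b l] U.
  rewrite /= !step_eq //; case: ifP => h xin; last by exists [:: a], g, r.
  exfalso; move: U xin; rewrite /= => /and3P[_ + _].
  by rewrite lab_addhead => /negPf ->.
move=> _; rewrite /= !step_eq //.
case: ifP => h; last by exists (a :: b :: l), g, r.
case: l {U} => [|c l]; first by exists [::], (a.1 + fuse i b.2 b.1 + g), r.
by exists ((a.1 + fuse i b.2 b.1 + c.1, c.2) :: l), g, r.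
Qed.

(** Converse of [step_wall]: [x] can only vanish by being hit from the left or by hitting to the
    right, and either event is already visible in one of the two parts. *)
Lemma step_glue i l g x r l' g' d r' : uniq (unzip2 (l ++ (g, x) :: r)) ->
  step i (l ++ [:: (g, x)]) = l' ++ [:: (g', x)] ->
  step i ((d, x) :: r) = (d, x) :: r' ->
  step i (l ++ (g, x) :: r) = l' ++ (g', x) :: r'.
Proof.
move=> U e1 e2; have catI u v (h k : G) y (z : P) : u ++ [:: (h, y)] = v ++ [:: (k, z)] ->
    u = v /\ h = k by rewrite !cats1 => /rcons_inj[-> ->].
have [|l1 [g1 [r1 [f1 f2 ->]]]] := step_wall (i := i) U; last first.
  by move: e1 e2; rewrite f1 f2 => /catI[-> ->] [->].
elim: l l' U e1 => [|a l IH] l' U.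
  move=> _.
  case: (eqVneq x (who i)) => [e|ne]; last first.
    by rewrite /= step_neq //= inE eqxx.
  case: r U e2 => [_ _|b r U]; first by rewrite /= inE eqxx.
  rewrite /= !step_eq //; case: ifP => // _; last by rewrite /= inE eqxx.
  case: r U => // c r U [e1 e2 e3]; move: U.
  by rewrite /= !inE -e2 eqxx !orbT.
have U1 : uniq (unzip2 (l ++ (g, x) :: r)) by case/andP: U.
case: (eqVneq a.2 (who i)) => [e|ne]; last first.
  rewrite !cat_cons !step_neq //; case: l' => [|a' l'].
    case=> ea; move: U; rewrite ea /= lab_cat mem_cat /= inE eqxx orbT //.
  by move=> [-> e1]; rewrite /= inE (IH _ U1 e1) orbT.
case: l {IH} U U1 => [|b l] U U1.
  rewrite /= !step_eq //; case: ifP => h; first by case: l'.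
  by rewrite /= !inE eqxx !orbT.
rewrite /= !step_eq //; case: ifP => h; last first.
  by rewrite /= lab_cat !inE mem_cat inE eqxx !orbT.
case: l {U U1} => [|c l] _; rewrite /= inE ?eqxx //.
by rewrite lab_cat mem_cat inE eqxx !orbT.
Qed.

Lemma run_wall L l g x r : uniq (unzip2 (l ++ (g, x) :: r)) ->
  x \in unzip2 (run L (l ++ (g, x) :: r)) ->
  exists l' g' r', [/\ run L (l ++ [:: (g, x)]) = l' ++ [:: (g', x)],
    forall d, run L ((d, x) :: r) = (d, x) :: r' &
    run L (l ++ (g, x) :: r) = l' ++ (g', x) :: r'].
Proof.
elim: L l g r => [|i L IH] l g r U; first by move=> _; exists l, g, r.
move=> /= xin; have [l1 [g1 [r1 [e1 e2 e3]]]] := step_wall U (run_mem xin).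
move: xin; rewrite e3 => xin.
have U1 := step_uniq i U; rewrite e3 in U1.
have [l2 [g2 [r2 [f1 f2 f3]]]] := IH _ _ _ U1 xin.
by exists l2, g2, r2; split=> [|d|]; rewrite ?e1 ?e2 ?f1.
Qed.

Lemma run_glue L l g x r l' g' d r' : uniq (unzip2 (l ++ (g, x) :: r)) ->
  run L (l ++ [:: (g, x)]) = l' ++ [:: (g', x)] ->
  run L ((d, x) :: r) = (d, x) :: r' ->
  run L (l ++ (g, x) :: r) = l' ++ (g', x) :: r'.
Proof.
elim: L l g r => [|i L IH] l g r U /=.
  rewrite !cats1 => /eqP; rewrite eqseq_rcons => /andP[/eqP -> /eqP[->]].
  by move=> [->].
move=> h1 h2.
have Ul : uniq (unzip2 (l ++ [:: (g, x)])).
  apply: subseq_uniq U; rewrite !lab_cat cat_subseq //= eqxx.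
  exact: sub0seq.
have [|l1 [g1 [r1 [e1 _ _]]]] := step_wall (i := i) Ul.
  apply: (@run_mem L); rewrite -/(run L _) in h1; rewrite h1.
  by rewrite lab_cat mem_cat inE eqxx orbT.
have Ur : uniq (unzip2 ([::] ++ (d, x) :: r)).
  by move: U; rewrite lab_cat cat_uniq => /and3P[].
have [|l2 [g2 [r2 [e2 e3 _]]]] := step_wall (i := i) Ur.
  by apply: (@run_mem L); rewrite -/(run L _) in h2; rewrite h2 inE eqxx.
have e4 := step_glue U e1 (e3 d).
have U1 := step_uniq i U; rewrite e4 in U1.
rewrite e4; apply: (IH l1 g1 r2) => //; first by rewrite -e1.
by rewrite -e3.
Qed.

(** Two walls cut the word into three parts with separate evolutions. The middle part alone
    determines what stands between [x] and [z], which allows one block to be replaced by another. *)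
Lemma run_block L l g x b h z r :
  uniq (unzip2 (l ++ (g, x) :: b ++ (h, z) :: r)) ->
  x \in unzip2 (run L (l ++ (g, x) :: b ++ (h, z) :: r)) ->
  z \in unzip2 (run L (l ++ (g, x) :: b ++ (h, z) :: r)) ->
  exists l' g' r' c h', [/\ run L (l ++ [:: (g, x)]) = l' ++ [:: (g', x)],
    forall d, run L ((d, z) :: r) = (d, z) :: r',
    forall d, run L ((d, x) :: b ++ [:: (h, z)]) = (d, x) :: c ++ [:: (h', z)] &
    run L (l ++ (g, x) :: b ++ (h, z) :: r) = l' ++ (g', x) :: c ++ (h', z) :: r'].
Proof.
move=> U xin zin; have [l' [g' [r1 [e1 e2 e3]]]] := run_wall U xin.
have U1 : uniq (unzip2 (((g, x) :: b) ++ (h, z) :: r)).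
  by move: U; rewrite lab_cat cat_uniq => /and3P[].
have zin1 : z \in unzip2 (run L (((g, x) :: b) ++ (h, z) :: r)).
  rewrite cat_cons e2; move: zin; rewrite e3 lab_cat mem_cat => /orP[zl|//].
  exfalso; have := @run_mem L (l ++ [:: (g, x)]) z; rewrite e1 !lab_cat mem_cat zl.
  move=> /(_ isT); rewrite mem_cat inE => {zl} zl; move: U.
  rewrite -cat_rcons lab_cat cat_uniq => /and3P[_ /hasPn/(_ z)+ _].
  rewrite lab_cat mem_cat inE eqxx orbT => /(_ isT) /negP; apply.
  by rewrite -cats1 lab_cat mem_cat inE.
have [l2 [h' [r' [f1 f2 f3]]]] := run_wall U1 zin1.
have zx : z != x.
  apply: contraTneq U1 => ->; rewrite lab_cat cat_uniq /= inE eqxx /=.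
  by rewrite !andbF.
move: f3; rewrite cat_cons e2; case: l2 f1 => [|[d y] c] f1.
  by case=> _ ezx; rewrite ezx eqxx in zx.
case=> eg ey er; rewrite -{}eg -{}ey in f1.
exists l', g', r', c, h'; split=> //; last by rewrite e3 er.
have U2 : uniq (unzip2 ([::] ++ (g, x) :: b ++ [:: (h, z)])).
  apply: subseq_uniq U1; rewrite cat0s -[_ :: b ++ _]/(((g, x) :: b) ++ _).
  rewrite !lab_cat; apply: cat_subseq; first exact: subseq_refl.
  by rewrite /= eqxx; apply: sub0seq.
have [|l3 [g3 [r3 [k1 k2 k3]]]] := @run_wall L _ _ _ _ U2.
  by move: f1; rewrite /= => ->; rewrite inE eqxx.
by move=> d1; rewrite k2; move: f1; rewrite /= k2 => -[->].
Qed.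

Lemma run_block_glue L l g x b h z r l' g' d d' c h' r' :
  uniq (unzip2 (l ++ (g, x) :: b ++ (h, z) :: r)) ->
  run L (l ++ [:: (g, x)]) = l' ++ [:: (g', x)] ->
  run L ((d, z) :: r) = (d, z) :: r' ->
  run L ((d', x) :: b ++ [:: (h, z)]) = (d', x) :: c ++ [:: (h', z)] ->
  run L (l ++ (g, x) :: b ++ (h, z) :: r) = l' ++ (g', x) :: c ++ (h', z) :: r'.
Proof.
move=> U e1 e2 e3.
have U1 : uniq (unzip2 (((d', x) :: b) ++ (h, z) :: r)).
  by move: U; rewrite lab_cat cat_uniq => /and3P[].
apply: (run_glue U e1 (d := d')).
exact: (run_glue U1 (e3 : run L (((d', x) :: b) ++ [:: (h, z)]) =
  ((d', x) :: c) ++ [:: (h', z)]) e2).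
Qed.

Lemma step_inert i w : {in unzip2 w, forall x, forall g, hits i x g = false} ->
  step i w = w.
Proof.
elim: w => // a [|b w] IH H //; have [e|ne] := eqVneq a.2 (who i).
  by rewrite step_eq // H // !inE eqxx orbT.
by rewrite step_neq // IH // => x xin; apply: H; rewrite inE xin orbT.
Qed.

(* Two instructions fail to commute only if they compete for a particle, or if
   the first one brings together the pair hit by the second one. *)
Lemma step_swap e f w : uniq (unzip2 w) ->
  (forall x g, x \in unzip2 w -> x != who e -> hits e x g) ->
  who f != who e -> (forall g, hits f (who e) g = false) ->
  [\/ step f (step e w) = step e (step f w),
   exists l g g1 g2 a r, w = l ++ [:: (g, who e), (g1, who f), (g2, a) & r] /\
     hits f a g2 |
   exists l g0 g g1 x g2 y r,
     w = l ++ [:: (g0, who f), (g, who e), (g1, x), (g2, y) & r] /\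
     hits f y (g + fuse e x g1 + g2)].
Proof.
move=> + + ne hf; elim: w => [|a [|b w] IH] U he0; [by constructor 1..|].
have he g : b.2 != who e -> hits e b.2 g by apply: he0; rewrite !inE eqxx orbT.
have [ea|nea] := eqVneq a.2 (who e).
  have nfa : a.2 != who f by rewrite ea eq_sym.
  have nb : b.2 != who e.
    by apply: contraTneq U => nb; rewrite /= inE ea nb eqxx.
  rewrite (step_eq _ _ ea) he // (step_neq _ nfa).
  have [fb|nfb] := eqVneq b.2 (who f); last first.
    by constructor 1; rewrite (step_neq _ nfb) (step_eq _ _ ea) he // step_addhead.
  case: w U {IH he0} => [|c w] U.
    by constructor 1; rewrite step1 (step_eq _ _ ea) he.
  rewrite (step_eq _ _ fb); case: ifP => h.
    constructor 2; exists [::], a.1, b.1, c.1, c.2, w.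
    by rewrite -ea -fb -!surjective_pairing.
  constructor 1; rewrite (step_eq _ _ ea) he // step_notin // lab_addhead.
  by move: U; rewrite /= fb => /and3P[].
rewrite (step_neq _ nea); have [fa|nfa] := eqVneq a.2 (who f); last first.
  have [|||[l [g [g1 [g2 [a1 [r [-> h]]]]]]]|] := IH.
  - by case/andP: U.
  - by move=> x g xw; apply: he0; rewrite inE xw orbT.
  - by move=> E; constructor 1; rewrite !(step_neq _ nfa) E (step_neq _ nea).
  - by constructor 2; exists (a :: l), g, g1, g2, a1, r.
  move=> [l [h0 [g [g1 [x [g2 [y [r [-> h]]]]]]]]].
  by constructor 3; exists (a :: l), h0, g, g1, x, g2, y, r.
have [eb|neb] := eqVneq b.2 (who e).
  have -> : step f (a :: b :: w) = a :: b :: w by rewrite step_eq // eb hf.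
  rewrite (step_neq _ nea).
  have hc : forall c w1 g, w = c :: w1 -> hits e c.2 g.
    move=> c w1 g ew; apply: he0; first by rewrite ew !inE eqxx !orbT.
    by apply: contraTneq U => cm; rewrite ew /= !inE eb cm eqxx /= !andbF.
  case: w hc U {IH he he0} => [|c [|d w]] hc U.
  - by constructor 1; rewrite step1 step_eq // eb hf.
  - by constructor 1; rewrite (step_eq _ _ eb) (hc c [::]).
  rewrite (step_eq _ _ eb) (hc c (d :: w)) //= (step_eq _ _ fa) /=; case: ifP => h.
    constructor 3; exists [::], a.1, b.1, c.1, c.2, d.1, d.2, w.
    by rewrite -fa -eb -!surjective_pairing.
  by constructor 1.
constructor 1; rewrite (step_neq _ neb) !(step_eq _ _ fa); case: ifP => _.
  by rewrite step_addhead.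
by rewrite (step_neq _ nea) (step_neq _ neb).
Qed.

End Words.

#[global] Arguments step : simpl never.

(** * Arrangements of particles and gaps, and sums over them *)

Lemma perm_mid (T : eqType) (l b r : seq T) x :
  perm_eq (l ++ x :: b ++ r) (b ++ l ++ x :: r).
Proof. by apply/seq.permP => a; rewrite !count_cat /= !count_cat; lia. Qed.

Section Arrangements.
Variables (P : eqType) (G : nmodType).
Implicit Types (w b : seq (G * P)) (ps : seq P) (gs : seq G).

(** [permutations] lists each rearrangement once even if some gaps coincide, so this list has no
    repetition and sums over it can be reindexed by bijections. *)
Definition arr ps gs : seq (seq (G * P)) :=
  [seq zip (0 :: t) s | s <- permutations ps, t <- permutations gs].

Lemma mem_arr ps gs w : size ps = (size gs).+1 ->
  (w \in arr ps gs) = [&& perm_eq (unzip2 w) ps, perm_eq (unzip1 w) (0 :: gs)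
                        & head 0 (unzip1 w) == 0].
Proof.
move=> sz; apply/allpairsP/and3P => [[[s t] /= [+ + ->]]|[pw gw hw]].
  rewrite !mem_permutations => ps_ gs_.
  have szE : size s = size (0 :: t) by rewrite (perm_size ps_) sz /= (perm_size gs_).
  rewrite unzip1_zip ?szE // unzip2_zip ?szE // ps_ /= perm_cons gs_ eqxx //.
exists (unzip2 w, behead (unzip1 w)); split; rewrite /= ?mem_permutations //.
  move: gw hw; case: (unzip1 w) => [|g t] /=.
    by move=> /perm_size.
  by move=> + /eqP e; rewrite e perm_cons.
have -> : 0 :: behead (unzip1 w) = unzip1 w.
  by move: gw hw; case: (unzip1 w) => [/perm_size|g t _ /= /eqP ->].
by rewrite zip_unzip.
Qed.

Lemma arr_uniq ps gs : size ps = (size gs).+1 -> uniq (arr ps gs).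
Proof.
move=> sz; apply: allpairs_uniq; rewrite ?permutations_uniq //.
move=> [s t] [s' t'] /allpairsP[[a b] /= [+ + [-> ->]]].
rewrite !mem_permutations => pa pb /allpairsP[[c d] /= [+ + [-> ->]]].
rewrite !mem_permutations => pc pd e.
have z1 : size (0 :: b) = size a by rewrite (perm_size pa) sz /= (perm_size pb).
have z2 : size (0 :: d) = size c by rewrite (perm_size pc) sz /= (perm_size pd).
have := congr1 unzip1 e; rewrite !unzip1_zip ?z1 ?z2 // => -[->].
by have := congr1 unzip2 e; rewrite !unzip2_zip ?z1 ?z2 // => ->.
Qed.

Fixpoint ins (x : P) b w :=
  if w is a :: w1 then if a.2 == x then a :: b ++ w1 else a :: ins x b w1 else [::].

Fixpoint follows (x : P) b w :=
  if w is a :: w1 then if a.2 == x then prefix b w1 else follows x b w1 else false.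

Lemma insE x b l g r : x \notin unzip2 l ->
  ins x b (l ++ (g, x) :: r) = l ++ (g, x) :: b ++ r.
Proof.
elim: l => [|a l IH] /=; first by rewrite eqxx.
by rewrite inE negb_or eq_sym => /andP[/negPf -> /IH ->].
Qed.

Lemma followsP x b w : reflect (exists l g r, [/\ w = l ++ (g, x) :: b ++ r &
   x \notin unzip2 l]) (follows x b w).
Proof.
apply: (iffP idP) => [|[l [g [r [-> xl]]]]].
  elim: w => //= -[g y] w IH /=; case: eqP => [-> /prefixP[r ->]|/eqP ne /IH].
    by exists [::], g, r.
  move=> [l [g' [r [-> xl]]]]; exists ((g, y) :: l), g', r; split=> //=.
  by rewrite inE negb_or eq_sym ne.
elim: l xl => [_|a l IH] /=; first by rewrite eqxx prefix_prefix.
by rewrite inE negb_or eq_sym => /andP[/negPf -> /IH].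
Qed.

Lemma mem_split (x : P) w : x \in unzip2 w ->
  exists l g r, [/\ w = l ++ (g, x) :: r & x \notin unzip2 l].
Proof.
elim: w => //= -[g y] w IH; rewrite inE /=; case: eqP => [-> _|/eqP ne /= /IH].
  by exists [::], g, w.
move=> [l [g' [r [-> xl]]]]; exists ((g, y) :: l), g', r; split=> //=.
by rewrite inE negb_or ne.
Qed.

(** Deleting the block [b] after [x], together with its gaps, is inverse to [ins x b]: labels being
    distinct, the place of [x] determines where the block goes. *)
Lemma perm_arr_ins ps gs os og x b : uniq ps ->
  perm_eq ps (x :: unzip2 b ++ os) -> perm_eq gs (unzip1 b ++ og) ->
  size os = size og ->
  perm_eq [seq w <- arr ps gs | follows x b w]
          [seq ins x b w | w <- arr (x :: os) og].
Proof.
move=> U pps pgs sz.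
have sz1 : size ps = (size gs).+1.
  by rewrite (perm_size pps) (perm_size pgs) /= !size_cat !size_map sz.
have sz2 : size (x :: os) = (size og).+1 by rewrite /= sz.
have Ux : uniq (x :: os).
  move: U; rewrite (perm_uniq pps) /= cat_uniq mem_cat negb_or.
  by case/andP=> /andP[_ ->] /and3P[_ _ ->].
have splitw w : w \in arr (x :: os) og -> exists l g r,
    [/\ w = l ++ (g, x) :: r & x \notin unzip2 l].
  rewrite mem_arr // => /and3P[pw _ _]; apply: mem_split.
  by rewrite (perm_mem pw) inE eqxx.
apply: uniq_perm; first by rewrite filter_uniq // arr_uniq.
  rewrite map_inj_in_uniq ?arr_uniq // => w w' /splitw[l [g [r [-> xl]]]].
  move=> /splitw[l' [g' [r' [-> xl']]]]; rewrite !insE //.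
  elim: l l' xl xl' => [|a l IH] [|a' l'] /=.
  - by move=> _ _ [->] /eqP; rewrite eqseq_cat // eqxx /= => /eqP ->.
  - by move=> _ + [e]; rewrite -e inE eqxx.
  - by move=> + _ [e]; rewrite e inE eqxx.
  by rewrite !inE !negb_or => /andP[_ xl] /andP[_ xl'] [-> /IH ->].
move=> w; rewrite mem_filter; apply/andP/mapP => [[]|[w' w'in ->]].
  move=> /followsP[l [g [r [-> xl]]]]; rewrite mem_arr // => /and3P[pw gw hw].
  exists (l ++ (g, x) :: r); last by rewrite insE.
  rewrite mem_arr //; apply/and3P; split.
  - rewrite lab_cat /= -(perm_cat2l (unzip2 b)) -(permPl (perm_mid _ _ _ _)).
    move: pw; rewrite lab_cat /= lab_cat => /permPl ->.
    by rewrite (permPl pps) (permPl (perm_mid [::] _ _ _)).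
  - rewrite /unzip1 map_cat /= -(perm_cat2l (unzip1 b)) -(permPl (perm_mid _ _ _ _)).
    move: gw; rewrite /unzip1 map_cat /= map_cat => /permPl ->.
    by rewrite -(permPr (perm_mid [::] _ _ _)) perm_cons (permPl pgs).
  by move: hw; case: (l).
have [l [g [r [e xl]]]] := splitw _ w'in; move: w'in; rewrite e insE //.
rewrite mem_arr // => /and3P[pw gw hw]; split; first by apply/followsP; exists l, g, r.
rewrite mem_arr //; apply/and3P; split.
- rewrite lab_cat /= lab_cat (permPl (perm_mid _ _ _ _)) (permPr pps).
  by rewrite (permPr (perm_mid [::] _ _ _)) perm_cat2l; move: pw; rewrite lab_cat.
- rewrite /unzip1 map_cat /= map_cat (permPl (perm_mid _ _ _ _)).
  apply: (@perm_trans _ (0 :: (unzip1 b ++ og))); last by rewrite perm_cons perm_sym.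
  by rewrite (permPr (perm_mid [::] _ _ _)) perm_cat2l; move: gw; rewrite /unzip1 map_cat.
by move: hw; case: (l).
Qed.

Lemma sum_arr_ins (R : zmodType) (F : seq (G * P) -> R) ps gs os og x b : uniq ps ->
  perm_eq ps (x :: unzip2 b ++ os) -> perm_eq gs (unzip1 b ++ og) ->
  size os = size og ->
  \sum_(w <- arr ps gs | follows x b w) F w =
  \sum_(w <- arr (x :: os) og) F (ins x b w).
Proof.
move=> U pps pgs sz.
by rewrite -big_filter (perm_big _ (perm_arr_ins U pps pgs sz)) big_map.
Qed.

End Arrangements.

Section Segments.
Variables (P : eqType) (G : nmodType).
Implicit Types (w b : seq (G * P)) (ps : seq P) (gs : seq G).

Definition segment (x z : P) w :=
  let w1 := drop (index x (unzip2 w)).+1 w in take (index z (unzip2 w1)).+1 w1.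

Lemma segmentE x z l g b h r : uniq (unzip2 (l ++ (g, x) :: b ++ (h, z) :: r)) ->
  segment x z (l ++ (g, x) :: b ++ (h, z) :: r) = b ++ [:: (h, z)].
Proof.
move=> U; have xl : x \notin unzip2 l.
  move: U; rewrite lab_cat cat_uniq => /and3P[_ /hasPn/(_ x)+ _].
  by rewrite inE eqxx => /(_ isT).
have zb : z \notin unzip2 b.
  move: U; rewrite -cat_rcons !lab_cat !cat_uniq => /and3P[_ _].
  move=> /and3P[_ /hasPn/(_ z)+ _].
  by rewrite inE eqxx => /(_ isT).
rewrite /segment lab_cat index_cat (negPf xl) /= eqxx addn0.
rewrite -cat_rcons drop_cat size_rcons size_map ltnn subnn drop0.
rewrite lab_cat index_cat (negPf zb) /= eqxx addn0 -cat_rcons take_cat.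
by rewrite size_rcons size_map ltnn subnn take0 cats0 cats1.
Qed.

Lemma arr_labels ps gs w : size ps = (size gs).+1 -> w \in arr ps gs ->
  perm_eq (unzip2 w) ps.
Proof. by move=> sz; rewrite mem_arr // => /and3P[]. Qed.

Lemma follows_rest ps gs x b w : size ps = (size gs).+1 -> uniq ps ->
  w \in arr ps gs -> follows x b w ->
  exists os og, [/\ perm_eq ps (x :: unzip2 b ++ os),
    perm_eq gs (unzip1 b ++ og) & size os = size og].
Proof.
move=> sz U win /followsP[l [g [r [e xl]]]]; move: win; rewrite mem_arr // e.
move=> /and3P[pw gw hw].
exists (unzip2 l ++ unzip2 r), (behead (unzip1 (l ++ (g, x) :: r))); split.
- move: pw; rewrite perm_sym lab_cat /= lab_cat => /permPl ->.
  rewrite (permPl (perm_mid _ _ _ _)) (permPr (perm_mid [::] _ _ _)) perm_cat2l /=.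
  by rewrite -cat1s perm_catCA.
- rewrite -(perm_cons 0) perm_sym -(permPr gw) (permPl (perm_mid [::] _ _ _)) /=.
  rewrite /unzip1 !map_cat /= map_cat (permPr (perm_mid _ _ _ _)) perm_cat2l.
  by move: hw; case: (l) => [|[? ?] ?] /= /eqP ->.
by rewrite size_behead !size_map !size_cat !size_map /= addnS.
Qed.

(* To show that a sum over the arrangements vanishes, fix the block [seg w] of
   particles and gaps that follows [x], and let the rest of the word vary. *)
Lemma sum_by_segment (R : zmodType) (D : seq (G * P) -> R) seg ps gs x :
  uniq ps -> size ps = (size gs).+1 ->
  (forall w, w \in arr ps gs -> D w != 0 -> follows x (seg w) w) ->
  (forall b os og, perm_eq ps (x :: unzip2 b ++ os) ->
     perm_eq gs (unzip1 b ++ og) -> size os = size og ->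
     \sum_(w <- arr (x :: os) og)
        (if seg (ins x b w) == b then D (ins x b w) else 0) = 0) ->
  \sum_(w <- arr ps gs) D w = 0.
Proof.
move=> U sz H1 H2.
pose D' b w := if seg w == b then D w else 0.
have -> : \sum_(w <- arr ps gs) D w =
    \sum_(w <- arr ps gs) \sum_(b <- undup (map seg (arr ps gs))) D' b w.
  apply: eq_big_seq => w win; rewrite (bigD1_seq (seg w)) ?undup_uniq //=; last first.
    by rewrite mem_undup map_f.
  rewrite /D' eqxx big1 ?addr0 // => b; rewrite eq_sym => /negPf -> //.
rewrite exchange_big big1_seq //= => b _.
have D0 w : w \in arr ps gs -> ~~ follows x b w -> D' b w = 0.
  move=> win; rewrite /D'; case: eqP => // <- nf; apply: contraNeq nf.
  exact: H1.
have [/hasP[w win fw]|/hasPn nf] := boolP (has (follows x b) (arr ps gs)); last first.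
  by rewrite big1_seq // => w /andP[_ win]; apply: D0 => //; apply: nf.
have [os [og [pps pgs so]]] := follows_rest sz U win fw.
rewrite (bigID (follows x b)) /= [X in _ + X]big1_seq ?addr0; last first.
  by move=> w' /andP[nf w'in]; exact: D0.
by rewrite (sum_arr_ins _ U pps pgs so); exact: H2.
Qed.

End Segments.

(** * Ranks, sorting programs and the universal law *)

Section Law.
Variables (P : eqType) (G : nmodType) (R : realFieldType).
Implicit Types (w b : seq (G * P)) (ps : seq P) (gs : seq G) (rank : P -> R).
Implicit Types (L : seq (instr P G)) (i : instr P G).

Fixpoint Forall_instr (C : instr P G -> Prop) L : Prop :=
  if L is i :: L1 then C i /\ Forall_instr C L1 else True.

Lemma Forall_cat C L1 L2 :
  Forall_instr C (L1 ++ L2) <-> Forall_instr C L1 /\ Forall_instr C L2.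
Proof. by elim: L1 => /= [|i L1 ->]; [split=> [|[]]|rewrite and_assoc]. Qed.

Lemma Forall_map (C C' : instr P G -> Prop) f L : (forall i, C i -> C' (f i)) ->
  Forall_instr C L -> Forall_instr C' (map f L).
Proof. by move=> H; elim: L => //= i L IH [/H ? /IH]. Qed.

(* For the bullets, [rank] is the opposite of the speed: a bullet is only hit from
   behind by a faster one, and the survivors are shot by decreasing speed. *)
Definition sound rank := Forall_instr (fun i =>
  forall x g, hits i x g -> rank x < rank (who i)).

Definition settled rank w := sorted (fun x y => rank x <= rank y) (unzip2 w).

(** Required of every word over [ps], whatever its gaps and even if particles are missing: the
    property then passes to smaller sets of particles and holds after any prefix of instructions. *)
Definition settling rank ps L := forall w, uniq (unzip2 w) ->
  {subset unzip2 w <= ps} -> settled rank (run L w).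

Lemma settling_cat rank ps L1 L2 : settling rank ps L2 -> settling rank ps (L1 ++ L2).
Proof.
move=> H w U sub; rewrite run_cat; apply: H; first exact: run_uniq.
by move=> x /run_mem/sub.
Qed.

Lemma settling_cons rank ps i L : settling rank ps L -> settling rank ps (i :: L).
Proof. exact: (@settling_cat _ _ [:: i]). Qed.

Lemma settling_sub rank ps ps' L : {subset ps' <= ps} ->
  settling rank ps L -> settling rank ps' L.
Proof. by move=> s H w U sub; apply: H => // x /sub/s. Qed.

Definition chi (k : nat) w : R := (size w == k)%:R.

Variable q : nat -> nat -> R.

(** The law is written as a vanishing sum, so that the number of arrangements, which depends on
    coincidences among the gaps, never has to be computed. *)
Definition universal n := forall rank ps gs L k,
  uniq ps -> {in ps &, injective rank} -> size ps = n -> size gs = n.-1 ->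
  sound rank L -> settling rank ps L ->
  \sum_(w <- arr ps gs) (chi k (run L w) - q n k) = 0.

Lemma universal_diff n rank rank' ps gs L L' k : universal n ->
  uniq ps -> {in ps &, injective rank} -> {in ps &, injective rank'} ->
  size ps = n -> size gs = n.-1 ->
  sound rank L -> settling rank ps L -> sound rank' L' -> settling rank' ps L' ->
  \sum_(w <- arr ps gs) (chi k (run L w) - chi k (run L' w)) = 0.
Proof.
move=> Un U i1 i2 s1 s2 S1 T1 S2 T2.
have := Un rank ps gs L k U i1 s1 s2 S1 T1.
have := Un rank' ps gs L' k U i2 s1 s2 S2 T2.
rewrite !sumrB => /eqP + /eqP; rewrite !subr_eq0 => /eqP -> /eqP ->.
by rewrite subrr.
Qed.

Definition spares u v := Forall_instr (fun i =>
  who i = u -> forall g, hits i v g = false).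

Lemma run_spares u v L g h : u != v -> spares u v L ->
  run L [:: (g, u); (h, v)] = [:: (g, u); (h, v)].
Proof.
move=> uv; elim: L => [//|i L IH] /= [Hi /IH IH'].
have -> // : step i [:: (g, u); (h, v)] = [:: (g, u); (h, v)].
have [e|ne] := eqVneq u (who i); first by rewrite step_eq //= Hi.
by rewrite step_neq.
Qed.

Lemma split_uniq x l l' (g g' : G) (r r' : seq (G * P)) : uniq (unzip2 (l ++ (g, x) :: r)) ->
  l ++ (g, x) :: r = l' ++ (g', x) :: r' -> [/\ l = l', g = g' & r = r'].
Proof.
elim: l l' => [|a l IH] [|a' l'] U /=; first by case=> -> ->.
- by case=> _ e; move: U; rewrite e /= lab_cat mem_cat inE eqxx orbT.
- by case=> e _; move: U; rewrite e /= lab_cat mem_cat inE eqxx orbT.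
by case=> -> /IH[|-> -> ->] //; case/andP: U.
Qed.

Lemma step_changed i w : step i w != w ->
  exists l g h y r, w = l ++ [:: (g, who i), (h, y) & r] /\ hits i y h.
Proof.
elim: w => [|a [|b w] IH]; try by move/eqP.
have [e|ne] := eqVneq a.2 (who i).
  rewrite (step_eq _ _ e); case: ifP => [h _|_ /eqP//].
  by exists [::], a.1, b.1, b.2, w; rewrite -e -!surjective_pairing.
rewrite step_neq // eqseq_cons eqxx /= => /IH[l [g [h [y [r [-> hh]]]]]].
by exists (a :: l), g, h, y, r.
Qed.

(* In a smaller system the pair may be separated by the gap [c] right from the
   start; there universality applies with and without the extra instruction, and
   the arrangements in which [u] and [v] are initially further apart cancel by
   induction. *)
Lemma pair_removal n rank A Z k u v c m :
  (forall n', (n' < n)%N -> universal n') ->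
  u != v -> rank v < rank u -> spares u v A -> sound rank A -> sound rank Z ->
  let f := Instr u (fun x g => (x == v) && (g == c)) m in
  let D w := chi k (run Z (step f (run A w))) - chi k (run Z (run A w)) in
  forall os og, uniq [:: u, v & os] -> {in [:: u, v & os] &, injective rank} ->
  size os = size og -> ((size os).+2 < n)%N -> settling rank [:: u, v & os] Z ->
  \sum_(w <- arr (u :: os) og) D (ins u [:: (c, v)] w) = 0.
Proof.
move=> Un uv ruv spA sA sZ f D os; have [N] := ubnP (size os).
elim: N os => // N IH os; rewrite ltnS => osN og U inj so lt tZ.
set ps := [:: u, v & os]; set gs := c :: og.
have szp : size ps = (size gs).+1 by rewrite /= so.
have sf : sound rank [:: f] by split=> // x g /= /andP[/eqP -> _].
(* Here [c] is one of the gaps to be arranged, and the system is smaller than [n]: the programs with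
   and without [f] give the same sum. The arrangements where [v] follows [u] through [c] form the
   wanted part of it, and the others must be shown to cancel. *)
have tot : \sum_(w <- arr ps gs) D w = 0.
  have := @universal_diff _ rank rank ps gs (A ++ f :: Z) (A ++ Z) k (Un _ lt) U inj inj.
  rewrite {1}/ps /gs /= so => /(_ erefl erefl).
  move=> H; rewrite -[RHS]H; first by apply: eq_bigr => w _; rewrite !run_cat.
  - by apply/Forall_cat; split=> //; case: sf.
  - exact/settling_cat/settling_cons.
  - exact/Forall_cat.
  exact: settling_cat.
have key w : uniq (unzip2 w) -> D w != 0 -> exists l g b h r l' g' r',
    w = l ++ (g, u) :: b ++ (h, v) :: r /\
    run A w = l' ++ [:: (g', u), (c, v) & r'].
  move=> Uw Dw; have : step f (run A w) != run A w.
    by apply: contraNneq Dw => e; rewrite /D e subrr.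
  move=> /step_changed[l' [g' [h' [y [r' [e /andP[/eqP yv /eqP hc]]]]]]].
  rewrite {y}yv {h'}hc /= in e.
  have uin : u \in unzip2 (run A w) by rewrite e lab_cat mem_cat inE eqxx orbT.
  have [l [g [r0 [ew _]]]] := mem_split (run_mem uin).
  rewrite ew in uin Uw e; have [l1 [g1 [r1 [e1 e2 e3]]]] := run_wall Uw uin.
  have Ur := run_uniq A Uw; rewrite e in Ur.
  have [_ _ er1] := split_uniq Ur (etrans (esym e) e3).
  have : v \in unzip2 (run A ((g, u) :: r0)).
    by rewrite e2 -er1 !inE eqxx orbT.
  move=> /run_mem; rewrite inE /= eq_sym (negPf uv) /=.
  move=> /mem_split[b [h [r [er0 _]]]].
  by exists l, g, b, h, r, l', g', r'; rewrite ew er0 -er0.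
rewrite (bigID (follows u [:: (c, v)])) /= in tot.
have pps : perm_eq ps (u :: unzip2 [:: (c, v)] ++ os) by [].
have pgs : perm_eq gs (unzip1 [:: (c, v)] ++ og) by [].
rewrite (sum_arr_ins _ U pps pgs so) in tot.
rewrite -[RHS]tot -[LHS]addr0; congr (_ + _); apply/esym.
pose D1 w := if follows u [:: (c, v)] w then 0 else D w.
rewrite big_mkcond (eq_bigr D1) => [|w _]; last by rewrite /D1; case: follows.
apply: (@sum_by_segment _ _ _ _ (segment u v) _ _ u) => // [w win|b os' og' pps' pgs' so'].
  have Uw : uniq (unzip2 w) by rewrite (perm_uniq (arr_labels szp win)).
  rewrite /D1; case: follows; first by rewrite eqxx.
  move=> /(key _ Uw)[l [g [b [h [r [l' [g' [r' [ew _]]]]]]]]].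
  rewrite ew in Uw *; rewrite segmentE //; apply/followsP.
  exists l, g, r; rewrite -catA; split=> //.
  move: Uw; rewrite lab_cat cat_uniq => /and3P[_ /hasPn/(_ u)+ _].
  by rewrite inE eqxx => /(_ isT).
(* The blocks from [u] to [v] that [A] reduces to the gap [c], other than the bare pair. Such a
   block behaves like the bare pair, so its contribution is again a sum of the kind considered, with
   fewer other particles. *)
pose good := [&& b != [:: (c, v)], last u (unzip2 b) == v &
              run A ((0, u) :: b) == [:: (0, u); (c, v)]].
have sz' : size (u :: os') = (size og').+1 by rewrite /= so'.
transitivity (\sum_(w <- arr (u :: os') og')
    if good then D (ins u [:: (c, v)] w) else 0); last first.
  have [/and3P[bt lb rb]|_] := boolP good; last by rewrite big1.
  have [b1 [h eb]] : exists b1 h, b = b1 ++ [:: (h, v)].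
    case/lastP: b lb {pps' pgs' good bt rb} => [/=|b1 [h z]]; first by rewrite (negPf uv).
    by rewrite /unzip2 map_rcons last_rcons => /eqP /= ->; exists b1, h; rewrite cats1.
  have pos : perm_eq os (unzip2 b1 ++ os').
    move: pps'; rewrite eb lab_cat /ps perm_cons -catA perm_sym perm_catCA.
    by rewrite /= perm_cons perm_sym.
  (* Since [A] spares the pair, a block without intermediate particles that is reduced to the gap
     [c] would be the bare pair itself. *)
  have sb1 : (size os' < size os)%N.
    rewrite (perm_size pos) size_cat size_map; case: b1 eb {pos} => [|? ?] eb //=; last first.
      by rewrite addSn ltnS leq_addl.
    move: rb bt; rewrite eb run_spares // => /eqP[->]; by rewrite eqxx.
  have sub : {subset [:: u, v & os'] <= ps}.
    move=> x; rewrite /ps !inE (perm_mem pos) mem_cat.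
    by case/or3P=> ->; rewrite ?orbT.
  apply: IH => //; first exact: leq_trans osN.
  - move: U; rewrite /ps /= !inE !negb_or (perm_uniq pos) !(perm_mem pos) !mem_cat !negb_or.
    by rewrite cat_uniq => /and3P[/and3P[-> _ ->] /andP[_ ->] /and3P[_ _ ->]].
  - by move=> x y /sub xs /sub ys; exact: inj.
  - by apply: leq_ltn_trans lt; rewrite !ltnS; exact: ltnW.
  exact: settling_sub tZ.
apply: eq_big_seq => w' w'in.
have [l [g [r [ew' ul]]]] : exists l g r, w' = l ++ (g, u) :: r /\ u \notin unzip2 l.
  have [|l [g [r [-> xl]]]] := @mem_split _ _ u w'; last by exists l, g, r.
  by rewrite (perm_mem (arr_labels sz' w'in)) inE eqxx.
have : ins u b w' \in arr ps gs.
  have := map_f (ins u b) w'in; rewrite -(perm_mem (perm_arr_ins U pps' pgs' so')).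
  by rewrite mem_filter => /andP[].
rewrite {}ew' !insE // => /(arr_labels szp)/perm_uniq; rewrite U => U1.
have inert w : ~~ ((u \in unzip2 w) && (v \in unzip2 w)) -> step f w = w.
  apply: contraNeq => /step_changed[l1 [g1 [h [y [r1 [-> /andP[/eqP -> _]]]]]]].
  by rewrite lab_cat !mem_cat !inE !eqxx !orbT.
have [/and3P[bt lb rb]|/negP ng] := boolP good.
  have [b1 [h eb]] : exists b1 h, b = b1 ++ [:: (h, v)].
    case/lastP: b lb {pps' pgs' good bt rb U1} => [/=|b1 [h z]]; first by rewrite (negPf uv).
    by rewrite /unzip2 map_rcons last_rcons => /eqP /= ->; exists b1, h; rewrite cats1.
  have eb1 : b ++ r = b1 ++ (h, v) :: r by rewrite eb -catA.
  rewrite eb1 in U1 *; rewrite segmentE // -eb eqxx /D1.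
  have U2 : uniq (unzip2 (l ++ (g, u) :: [::] ++ (c, v) :: r)).
    apply: subseq_uniq U1; rewrite !lab_cat /= lab_cat /=.
    apply: cat_subseq; first exact: subseq_refl.
    by rewrite /= eqxx -[X in subseq X]cat0s; apply: cat_subseq; rewrite ?sub0seq ?subseq_refl.
  have -> : follows u [:: (c, v)] (l ++ (g, u) :: b1 ++ (h, v) :: r) = false.
    apply/negP => /followsP[l2 [g2 [r2 [e _]]]]; have [_ _ e1] := split_uniq U1 e.
    have Ub : uniq (unzip2 (b1 ++ (h, v) :: r)).
      by move: U1; rewrite lab_cat cat_uniq => /and3P[_ _ /andP[]].
    have [e2 e3 _] := split_uniq (l' := [::]) Ub e1.
    by move: bt; rewrite eb e2 e3 eqxx.
  have rb1 : run A ((0, u) :: b1 ++ [:: (h, v)]) = (0, u) :: [::] ++ [:: (c, v)].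
    by rewrite -eb; apply/eqP.
  have rt : run A ((0, u) :: [::] ++ [:: (c, v)]) = (0, u) :: [::] ++ [:: (c, v)].
    exact: run_spares.
  have same l' g' r' : run A (l ++ [:: (g, u)]) = l' ++ [:: (g', u)] ->
      (forall d, run A ((d, v) :: r) = (d, v) :: r') ->
      run A (l ++ (g, u) :: b1 ++ (h, v) :: r) =
      run A (l ++ (g, u) :: [::] ++ (c, v) :: r).
    move=> e1 e2; rewrite (run_block_glue U1 e1 (e2 0) rb1).
    by rewrite (run_block_glue U2 e1 (e2 0) rt).
  rewrite -[[:: (c, v)] ++ r]/([::] ++ (c, v) :: r).
  have [/andP[u1 v1]|n1] := boolP ((u \in unzip2 (run A (l ++ (g, u) :: b1 ++ (h, v) :: r)))
       && (v \in unzip2 (run A (l ++ (g, u) :: b1 ++ (h, v) :: r)))).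
    have [l' [g' [r' [_ [_ [e1 e2 _ _]]]]]] := run_block U1 u1 v1.
    by rewrite /D (same _ _ _ e1 e2).
  have [/andP[u1 v1]|n2] := boolP ((u \in unzip2 (run A (l ++ (g, u) :: [::] ++ (c, v) :: r)))
       && (v \in unzip2 (run A (l ++ (g, u) :: [::] ++ (c, v) :: r)))).
    have [l' [g' [r' [_ [_ [e1 e2 _ _]]]]]] := run_block U2 u1 v1.
    by rewrite /D (same _ _ _ e1 e2).
  by rewrite /D !inert // !subrr.
case: eqP => // eb; rewrite /D1; case: ifP => // /negP nf.
apply/eqP; apply/negPn/negP => Dw; apply: ng.
have [l1 [g1 [b1 [h [r1 [l' [g' [r' [ew er]]]]]]]]] := key _ U1 Dw.
have [el eg ebr] := split_uniq U1 ew; rewrite -{}el -{}eg in ew.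
rewrite ebr in U1 eb er Dw nf; rewrite segmentE // in eb.
have u1 : u \in unzip2 (run A (l ++ (g, u) :: b1 ++ (h, v) :: r1)).
  by rewrite er lab_cat mem_cat inE eqxx orbT.
have v1 : v \in unzip2 (run A (l ++ (g, u) :: b1 ++ (h, v) :: r1)).
  by rewrite er lab_cat mem_cat !inE eqxx !orbT.
have [l2 [g2 [r2 [c' [h' [e1 e2 e3 e4]]]]]] := run_block U1 u1 v1.
have Ur := run_uniq A U1; rewrite er in Ur.
have [_ _ ec] := split_uniq Ur (etrans (esym er) e4).
have Ur1 : uniq (unzip2 ([::] ++ (c, v) :: r')).
  by move: Ur; rewrite lab_cat cat_uniq => /and3P[_ _ /andP[]].
have [ec1 ec2 _] := split_uniq Ur1 ec.
rewrite /good -eb e3 -ec1 -ec2 eqxx lab_cat last_cat eqxx !andbT /=.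
apply: contra_notN nf => /eqP ebc; apply/followsP; exists l, g, r; split=> //.
by rewrite -ebr -ebc eb.
Qed.

End Law.

(** * Blocks that act as a single particle *)

Section Fat.
Variables (P : eqType) (G : nmodType).
Implicit Types (w b : seq (G * P)) (L : seq (instr P G)) (i : instr P G).

Lemma block_inv L w l' (g' : G) x c (h' : G) z r' : uniq (unzip2 w) ->
  run L w = l' ++ (g', x) :: c ++ (h', z) :: r' ->
  exists l g b h r, [/\ w = l ++ (g, x) :: b ++ (h, z) :: r,
    run L (l ++ [:: (g, x)]) = l' ++ [:: (g', x)],
    forall d, run L ((d, z) :: r) = (d, z) :: r' &
    forall d, run L ((d, x) :: b ++ [:: (h, z)]) = (d, x) :: c ++ [:: (h', z)]].
Proof.
move=> Uw e; have Ur := run_uniq L Uw; rewrite e in Ur.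
have xin : x \in unzip2 (run L w) by rewrite e lab_cat mem_cat inE eqxx orbT.
have zx : z != x.
  apply: contraTneq Ur => ->.
  by rewrite lab_cat cat_uniq /= lab_cat mem_cat inE eqxx orbT !andbF.
have [l [g [r0 [ew _]]]] := mem_split (run_mem xin).
rewrite ew in xin Uw e; have [l1 [g1 [r1 [_ e2 e3]]]] := run_wall Uw xin.
have [_ _ er1] := split_uniq Ur (etrans (esym e) e3).
have : z \in unzip2 (run L ((g, x) :: r0)).
  by rewrite e2 -er1 -cat_cons lab_cat mem_cat !inE eqxx !orbT.
move=> /run_mem; rewrite inE /= (negPf zx) /= => /mem_split[b [h [r [er0 _]]]].
rewrite ew; move: xin; rewrite er0 in Uw e * => xin; have zin : z \in
    unzip2 (run L (l ++ (g, x) :: b ++ (h, z) :: r)).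
  by rewrite e -cat_cons catA lab_cat mem_cat !inE eqxx !orbT.
have [l2 [g2 [r2 [c2 [h2 [f1 f2 f3 f4]]]]]] := run_block Uw xin zin.
have [el eg ec] := split_uniq Ur (etrans (esym e) f4).
have Ur1 : uniq (unzip2 (c ++ (h', z) :: r')).
  by move: Ur; rewrite lab_cat cat_uniq => /and3P[_ _ /andP[]].
have [ec1 ec2 ec3] := split_uniq Ur1 ec.
by exists l, g, b, h, r; split; rewrite ?el ?eg ?ec1 ?ec2 ?ec3.
Qed.

Lemma step_cat i l w : who i \notin unzip2 l -> step i (l ++ w) = l ++ step i w.
Proof.
elim: l => //= a l IH; rewrite inE negb_or eq_sym => /andP[na nl].
by rewrite step_neq // IH.
Qed.

Lemma step_ext i j w : who i = who j ->
  {in unzip2 w, forall x g, hits i x g = hits j x g /\ fuse i x g = fuse j x g} ->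
  step i w = step j w.
Proof.
move=> wij; elim: w => [//|a [//|b w] IH] H.
have [e|ne] := eqVneq a.2 (who i); last first.
  rewrite (step_neq _ ne) (@step_neq _ _ j) -?wij //; congr (_ :: _); apply: IH => x xin.
  by apply: H; rewrite inE xin orbT.
have [|h1 h2] := H b.2 _ b.1; first by rewrite !inE eqxx orbT.
by rewrite !step_eq -?wij // h1 h2.
Qed.

Definition mute (x : P) : instr P G := Instr x (fun _ _ => false) (fun _ g => g).

Lemma step_mute x w : step (mute x) w = w.
Proof. exact: step_inert. Qed.

Variables (m a : P).

(* The instructions acting on a compound particle [m], which shows [m] to the
   particles on its left and [a] to those on its right. *)
Definition wall_instr i : instr P G :=
  if who i == m then mute m else
  if who i == a then Instr m (hits i) (fuse i) else i.

(* [m] has already absorbed an additional length [h] on its right. *)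
Definition lagr_instr (h : G) i : instr P G :=
  if who i == m then
    Instr m (fun y g => hits i y (h + g)) (fun y g => fuse i y (h + g))
  else Instr (who i) (hits i)
    (fun x g => if x == m then fuse i x g + h else fuse i x g).

(* [m] now stands for [a], with an additional length [h] on its left. *)
Definition lagl_instr (h : G) i : instr P G :=
  if who i == m then mute m else
  if who i == a then Instr m (hits i) (fun y g => h + fuse i y g) else
  Instr (who i) (fun x g => if x == m then hits i a (g + h) else hits i x g)
    (fun x g => if x == m then fuse i a (g + h) else fuse i x g).

Fixpoint lagr h w :=
  if w is c :: w1 then
    if c.2 == m then c :: addhead h w1 else c :: lagr h w1
  else [::].

Definition lagl h w := [seq if c.2 == m then (c.1 + h, a) else c | c <- w].

Lemma lagr_id h w : m \notin unzip2 w -> lagr h w = w.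
Proof.
by elim: w => //= c w IH; rewrite inE negb_or eq_sym => /andP[/negPf -> /IH ->].
Qed.

Lemma size_lagr h w : size (lagr h w) = size w.
Proof. by elim: w => //= c w IH; case: ifP => _ /=; rewrite ?size_addhead ?IH. Qed.

Lemma lab_lagr h w : unzip2 (lagr h w) = unzip2 w.
Proof. by elim: w => //= c w IH; case: ifP => _ /=; rewrite ?lab_addhead ?IH. Qed.

Lemma lagr_addhead h k w : lagr h (addhead k w) = addhead k (lagr h w).
Proof. by case: w => //= c w; case: ifP. Qed.

Lemma lagl_addhead h k w : lagl h (addhead k w) = addhead k (lagl h w).
Proof. by case: w => //= c w; case: ifP => _ //=; rewrite addrA. Qed.

(** [lagr h] turns the word with the compound particle into the true word and intertwines the two
    programs. When the compound is itself hit, its hidden length must join the merged gap, hence the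
    term [+ h] in [lagr_instr]. *)
Lemma step_lagr h i w : uniq (unzip2 w) ->
  lagr h (step (lagr_instr h i) w) = step i (lagr h w).
Proof.
have lagrW v : m \notin unzip2 v -> who i != m -> step (lagr_instr h i) v = step i v.
  move=> mv nm; rewrite /lagr_instr (negPf nm); apply: step_ext => //= x xv g.
  by case: eqP => // xm; rewrite -xm xv in mv.
elim: w => [//|c [_ _|b w IH U]]; first by rewrite step1 /=; case: ifP.
have Uw : uniq (unzip2 (b :: w)) by case/andP: U.
have [cm|ncm] := eqVneq c.2 m.
  have mw : m \notin unzip2 (b :: w) by rewrite -cm; case/andP: U.
  have -> : lagr h [:: c, b & w] = [:: c, (h + b.1, b.2) & w] by rewrite /= cm eqxx.
  have [wm|nwm] := eqVneq (who i) m.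
    have cw : c.2 = who (lagr_instr h i) by rewrite /lagr_instr wm eqxx.
    rewrite (step_eq _ _ cw) step_eq ?wm // {1 2}/lagr_instr wm eqxx /=.
    case: ifP => _; last by rewrite /= cm eqxx.
    rewrite lagr_addhead lagr_id //.
    by move: mw; rewrite inE negb_or => /andP[].
  have nc : c.2 != who i by rewrite cm eq_sym.
  rewrite step_neq; last by rewrite /lagr_instr (negPf nwm).
  have eb : [:: (h + b.1, b.2) & w] = addhead h (b :: w) by [].
  rewrite lagrW // [RHS]step_neq // eb step_addhead.
  by rewrite [LHS]/= cm eqxx.
have -> : lagr h [:: c, b & w] = c :: lagr h (b :: w) by rewrite [LHS]/= (negPf ncm).
have [wc|nwc] := eqVneq c.2 (who i); last first.
  have nw : c.2 != who (lagr_instr h i) by rewrite /lagr_instr; case: ifP.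
  by rewrite (step_neq _ nw) (step_neq _ nwc) [LHS]/= (negPf ncm) IH.
have nwm : who i != m by rewrite -wc.
have wc' : c.2 = who (lagr_instr h i) by rewrite /lagr_instr (negPf nwm).
rewrite (step_eq _ _ wc') /lagr_instr (negPf nwm) /=.
case: (eqVneq b.2 m) => [bm|nbm].
  have mw : m \notin unzip2 w by rewrite -bm; case/andP: Uw.
  case: w IH U Uw mw => [|d w] IH U Uw mw; rewrite step_eq //=.
    by case: ifP => //= _; rewrite bm eqxx (negPf ncm).
  case: ifP => _ /=; last by rewrite (negPf ncm) bm eqxx.
  move: mw; rewrite inE negb_or eq_sym => /andP[/negPf -> mw].
  by rewrite lagr_id // !addrA.
rewrite step_eq //; case: ifP => _; first exact: lagr_addhead.
by rewrite /= (negPf ncm) (negPf nbm).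
Qed.

Lemma run_lagr h L w : uniq (unzip2 w) ->
  lagr h (run (map (lagr_instr h) L) w) = run L (lagr h w).
Proof.
elim: L w => //= i L IH w U; rewrite IH ?step_lagr //; exact: step_uniq.
Qed.

Lemma step_lagl h i w : m != a -> uniq (unzip2 w) -> a \notin unzip2 w ->
  lagl h (step (lagl_instr h i) w) = step i (lagl h w).
Proof.
move=> ma; case: (eqVneq (who i) m) => [wm|nwm].
  move=> _ aw; rewrite /lagl_instr wm eqxx step_mute step_notin // wm.
  apply/negP => /mapP[_ /mapP[c _ ->]]; case: ifP => [_ e|/eqP ne e].
    by rewrite e eqxx in ma.
  exact/ne/esym.
set j := lagl_instr h i; have jE : j = if who i == a then
    Instr m (hits i) (fun y g => h + fuse i y g) else
  Instr (who i) (fun x g => if x == m then hits i a (g + h) else hits i x g)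
    (fun x g => if x == m then fuse i a (g + h) else fuse i x g).
  by rewrite /j /lagl_instr (negPf nwm).
elim: w => [//|c [_ _ //|b w] IH U aw].
have Uw : uniq (unzip2 (b :: w)) by case/andP: U.
have [ca abw] : c.2 != a /\ a \notin unzip2 (b :: w).
  by move: aw; rewrite inE negb_or eq_sym => /andP[].
have ba : b.2 != a by move: abw; rewrite inE negb_or eq_sym => /andP[].
have lE v : lagl h (c :: v) = (if c.2 == m then (c.1 + h, a) else c) :: lagl h v by [].
have lbE : lagl h (b :: w) = (if b.2 == m then (b.1 + h, a) else b) :: lagl h w by [].
have [cm|ncm] := eqVneq c.2 m.
  have bm : (b.2 == m) = false.
    by apply: contraTF U => /eqP bm; rewrite /= inE cm -bm eqxx.
  have [wa|nwa] := eqVneq (who i) a.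
    have cj : c.2 = who j by rewrite jE wa eqxx.
    rewrite (step_eq _ _ cj) lE lbE cm eqxx bm step_eq ?wa //.
    rewrite jE wa eqxx /=; case: ifP => _; first by rewrite lagl_addhead !addrA.
    by rewrite lE cm eqxx lbE bm.
  have cj : c.2 != who j by rewrite jE (negPf nwa) /= cm eq_sym.
  rewrite step_neq // !lE IH // cm eqxx (@step_neq _ _ i (c.1 + h, a)) //=.
  by rewrite eq_sym.
have [wc|nwc] := eqVneq c.2 (who i); last first.
  rewrite !lE step_neq; last by rewrite jE; case: ifP; rewrite //= eq_sym.
  by rewrite lE (negPf ncm) (step_neq _ nwc) IH.
have nwa : who i != a by rewrite -wc.
have cj : c.2 = who j by rewrite jE (negPf nwa).
rewrite (step_eq _ _ cj) lE (negPf ncm) lbE step_eq // jE (negPf nwa) /=.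
case: eqP => bm /=; case: ifP => _; rewrite ?lagl_addhead //=.
  by rewrite (negPf ncm) bm eqxx.
by rewrite (negPf ncm); case: eqP.
Qed.

Lemma run_lagl h L w : m != a -> uniq (unzip2 w) -> a \notin unzip2 w ->
  lagl h (run (map (lagl_instr h) L) w) = run L (lagl h w).
Proof.
move=> ma; elim: L w => //= i L IH w U aw; rewrite IH ?step_lagl //.
  exact: step_uniq.
by apply: contra aw; exact: step_mem.
Qed.

(** Once the compound particle is destroyed, nothing distinguishes the two forms it could have
    taken. *)
Lemma run_lag_out h k L w : m \notin unzip2 w -> a \notin unzip2 w ->
  run (map (lagl_instr h) L) w = run (map (lagr_instr k) L) w.
Proof.
elim: L w => //= i L IH w mw aw.
have eL : step (lagl_instr h i) w = step i w.
  rewrite /lagl_instr; case: eqP => [wm|_]; first by rewrite step_mute step_notin ?wm.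
  case: eqP => [wa|_]; first by rewrite !step_notin ?wa.
  apply: step_ext => //= x xw g; case: eqP => // xm.
  by rewrite -xm xw in mw.
have eR : step (lagr_instr k i) w = step i w.
  rewrite /lagr_instr; case: eqP => [wm|_]; first by rewrite !step_notin ?wm.
  apply: step_ext => //= x xw g; case: eqP => // xm.
  by rewrite -xm xw in mw.
by rewrite eL eR IH //; [apply: contra mw|apply: contra aw]; exact: step_mem.
Qed.

Definition shuns (u : P) := Forall_instr (fun i : instr P G => forall g, hits i u g = false).

Lemma step_last i l g x : (forall g, hits i x g = false) ->
  exists l' g', step i (l ++ [:: (g, x)]) = l' ++ [:: (g', x)].
Proof.
move=> hx; elim: l => [|c l [l' [g' IH]]]; first by exists [::], g.
have [e|ne] := eqVneq c.2 (who i); last first.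
  by exists (c :: l'), g'; rewrite cat_cons step_neq // IH.
case: l {IH} => [|b l]; first by exists [:: c], g; rewrite /= step_eq // hx.
rewrite /= step_eq //; case: ifP => _; last by exists [:: c, b & l], g.
case: l => [|d l]; first by exists [::], (c.1 + fuse i b.2 b.1 + g).
by exists ((c.1 + fuse i b.2 b.1 + d.1, d.2) :: l), g.
Qed.

(** Seen from the left, the compound is [m] in last position: it has no right neighbour, so the
    instructions that [wall_instr] changes are idle in both programs. *)
Lemma run_wall_left L l g : shuns m L -> uniq (unzip2 (l ++ [:: (g, m)])) ->
  a \notin unzip2 (l ++ [:: (g, m)]) ->
  run (map wall_instr L) (l ++ [:: (g, m)]) = run L (l ++ [:: (g, m)]).
Proof.
elim: L l g => //= i L IH l g [Hi HL] U aw.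
have ml : m \notin unzip2 l.
  by move: U; rewrite lab_cat cats1 rcons_uniq => /andP[].
have nm j : who j = m -> step j (l ++ [:: (g, m)]) = l ++ [:: (g, m)].
  by move=> wj; rewrite step_cat ?wj.
have -> : step (wall_instr i) (l ++ [:: (g, m)]) = step i (l ++ [:: (g, m)]).
  rewrite /wall_instr; case: eqP => [wm|_]; first by rewrite step_mute nm.
  by case: eqP => [wa|//]; rewrite nm // step_notin // wa.
have [l' [g' e]] := step_last l g Hi.
rewrite e; apply: IH => //; rewrite -e ?step_uniq //.
by apply: contra aw; exact: step_mem.
Qed.

(** Seen from the right, the compound acts as [a]: [wall_instr] silences [m] and hands it the
    instructions of [a]. The two runs agree until the front particle hits something, and then it
    vanishes in both. *)
Lemma run_wall_right L d r : m != a -> m \notin unzip2 r -> a \notin unzip2 r ->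
  (exists r', forall k, run (map wall_instr L) ((k, m) :: r) = (k, m) :: r' /\
              run L ((k, a) :: r) = (k, a) :: r') \/
  (m \notin unzip2 (run (map wall_instr L) ((d, m) :: r)) /\
   a \notin unzip2 (run L ((d, a) :: r))).
Proof.
move=> ma; elim: L r => [|i L IH] r mr ar /=; first by left; exists r.
have [wm|nwm] := eqVneq (who i) m.
  have eA k : step (wall_instr i) ((k, m) :: r) = (k, m) :: r.
    by rewrite /wall_instr wm eqxx step_mute.
  have ea k : step i ((k, a) :: r) = (k, a) :: r.
    by rewrite step_notin // wm inE negb_or ma.
  rewrite eA ea; have [[r' H]|H] := IH r mr ar; last by right.
  by left; exists r' => k; rewrite eA ea.
have [wa|nwa] := eqVneq (who i) a.
  have wE : wall_instr i = Instr m (hits i) (fuse i).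
    by rewrite /wall_instr (negPf nwm) wa eqxx.
  case: r mr ar => [|b r] mr ar.
    have [[r' H]|H] := IH [::] mr ar; last by right; rewrite !step1.
    by left; exists r' => k; rewrite !step1.
  have [hb|hb] := boolP (hits i b.2 b.1); last first.
    have eA k : step (wall_instr i) [:: (k, m), b & r] = [:: (k, m), b & r].
      by rewrite wE step_eq //= (negPf hb).
    have ea k : step i [:: (k, a), b & r] = [:: (k, a), b & r].
      by rewrite step_eq //= (negPf hb).
    rewrite eA ea; have [[r' H]|H] := IH _ mr ar; last by right.
    by left; exists r' => k; rewrite eA ea.
  right; rewrite wE !step_eq //= hb.
  by split; apply/negP => /run_mem; rewrite lab_addhead => xr;
    [move: mr|move: ar]; rewrite inE xr orbT.
have wE : wall_instr i = i by rewrite /wall_instr (negPf nwm) (negPf nwa).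
have eA k : step i ((k, m) :: r) = (k, m) :: step i r by rewrite step_neq // eq_sym.
have ea k : step i ((k, a) :: r) = (k, a) :: step i r by rewrite step_neq // eq_sym.
have [||[r' H]|H] := IH (step i r).
- by apply: contra mr; exact: step_mem.
- by apply: contra ar; exact: step_mem.
- by left; exists r' => k; rewrite wE eA ea.
by right; rewrite wE eA ea.
Qed.

End Fat.

Section FatLaw.
Variables (P : eqType) (G : nmodType) (R : realFieldType).
Implicit Types (w : seq (G * P)) (L : seq (instr P G)) (i : instr P G).
Variables (rank : P -> R) (m a : P).
Hypothesis ma : m != a.
Hypothesis ram : rank a < rank m.

Definition rerank x := if x == m then rank a else rank x.

Lemma Forall_and (C1 C2 : instr P G -> Prop) L : Forall_instr C1 L ->
  Forall_instr C2 L -> Forall_instr (fun i => C1 i /\ C2 i) L.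
Proof. by elim: L => //= i L IH [h1 /IH H1] [h2 /H1]. Qed.

(** The same prefix is used with both ranks of the compound particle. Nothing hits it, and what it
    hits has rank below that of [a], the smaller of the two. *)
Lemma sound_wall L : shuns m L -> sound rank L ->
  sound rank (map (wall_instr m a) L) /\ sound rerank (map (wall_instr m a) L).
Proof.
move=> hm hs; have H := Forall_and hm hs; split; apply: Forall_map H => i [hmi hsi].
  rewrite /wall_instr; case: eqP => // _ x g; case: eqP => [wa|_ /hsi //] /= /hsi.
  by rewrite wa => /lt_trans; apply.
rewrite /wall_instr /rerank; case: eqP => // wm x g.
case: (eqVneq x m) => [->|xm]; first by case: eqP => _ /=; rewrite hmi.
by case: eqP => [wa|_] /= /hsi; rewrite ?eqxx ?wa //; case: eqP.
Qed.

Lemma sound_lagr h L : sound rank L -> sound rank (map (lagr_instr m h) L).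
Proof.
apply: Forall_map => i hi x g; rewrite /lagr_instr.
by case: eqP => [wm|_] /= /hi; rewrite ?wm.
Qed.

Lemma sound_lagl h L : sound rank L -> sound rerank (map (lagl_instr m a h) L).
Proof.
apply: Forall_map => i hi x g; rewrite /lagl_instr; case: eqP => // wm.
case: eqP => [wa|wa] /=; rewrite /rerank ?eqxx.
  move=> /hi; rewrite wa; case: eqP => // -> /lt_trans/(_ ram).
  by rewrite ltxx.
by have /eqP/negPf -> := wm; case: (x == m) => /hi.
Qed.

Lemma settling_lagr h ps L : settling rank ps L ->
  settling rank ps (map (lagr_instr m h) L).
Proof.
move=> tL w U sub; rewrite /settled -(lab_lagr m h) run_lagr //.
by apply: tL; rewrite lab_lagr.
Qed.

Lemma lab_lagl h w : unzip2 (lagl m a h w) =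
  [seq if x == m then a else x | x <- unzip2 w].
Proof. by rewrite /unzip2 /lagl -!map_comp; apply: eq_map => c /=; case: ifP. Qed.

Lemma settling_lagl h ps os L : a \in ps -> a \notin os -> {subset os <= ps} ->
  settling rank ps L -> settling rerank (m :: os) (map (lagl_instr m a h) L).
Proof.
move=> aps aos sub tL w U subw.
have aw : a \notin unzip2 w.
  by apply/negP => /subw; rewrite inE eq_sym (negPf ma) (negPf aos).
have := tL (lagl m a h w); rewrite -run_lagl // /settled !lab_lagl sorted_map.
have eR : relpre (fun x => if x == m then a else x) (fun x y => rank x <= rank y) =2
    (fun x y => rerank x <= rerank y).
  by move=> x y; rewrite /= /rerank; do 2 case: eqP => _.
rewrite (eq_sorted eR); apply.
  rewrite map_inj_in_uniq // => x y xw yw; case: eqP => [->|_]; case: eqP => [->|_] //.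
    by move=> ay; rewrite ay yw in aw.
  by move=> xa; rewrite -xa xw in aw.
move=> x /mapP[y /subw yw ->]; case: eqP => // /eqP ym.
by apply: sub; move: yw; rewrite inE (negPf ym).
Qed.

Lemma lagl_id h w : m \notin unzip2 w -> lagl m a h w = w.
Proof.
by elim: w => //= c w IH; rewrite inE negb_or eq_sym => /andP[/negPf -> /IH ->].
Qed.

Lemma lagl_cat h l (g : G) r : m \notin unzip2 l -> m \notin unzip2 r ->
  lagl m a h (l ++ (g, m) :: r) = l ++ (g + h, a) :: r.
Proof.
by move=> ml mr; rewrite /lagl map_cat -/(lagl _ _ _ l) /= eqxx -/(lagl _ _ _ r) !lagl_id.
Qed.

Lemma lagr_cat h l (g : G) r : m \notin unzip2 l ->
  lagr m h (l ++ (g, m) :: r) = l ++ (g, m) :: addhead h r.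
Proof.
elim: l => [|c l IH] /=; first by rewrite eqxx.
by rewrite inE negb_or eq_sym => /andP[/negPf -> /IH ->].
Qed.

Lemma size_lagl h w : size (lagl m a h w) = size w.
Proof. exact: size_map. Qed.

End FatLaw.

Section Spare.
Variables (P : eqType) (G : nmodType) (R : realFieldType) (rank : P -> R).
Variables (u y : P).
Implicit Types (w : seq (G * P)) (L : seq (instr P G)) (i : instr P G).

(** [pair_removal] needs a program that leaves the adjacent pair [u], [y] alone. This change
    achieves it and cannot be noticed on words that lack one of the two particles. *)
Definition spare_instr i : instr P G :=
  if who i == u then Instr u (fun x g => hits i x g && (x != y)) (fuse i) else i.

Lemma spares_spare L : spares u y (map spare_instr L).
Proof.
elim: L => //= i L IH; split=> // + g; rewrite /spare_instr; case: eqP => //= _ _.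
by rewrite eqxx andbF.
Qed.

Lemma sound_spare L : sound rank L -> sound rank (map spare_instr L).
Proof.
apply: Forall_map => i hi x g; rewrite /spare_instr; case: eqP => [<-|_] //=.
  by case/andP => /hi.
exact: hi.
Qed.

Lemma run_spare L w : ~~ ((u \in unzip2 w) && (y \in unzip2 w)) ->
  run (map spare_instr L) w = run L w.
Proof.
elim: L w => //= i L IH w nw; have -> : step (spare_instr i) w = step i w.
  rewrite /spare_instr; case: eqP => // wu; have [uw|uw] := boolP (u \in unzip2 w).
    apply: step_ext => //= x xw g; split=> //; case: eqP => [xy|_]; rewrite ?andbT //.
    by move: nw; rewrite uw -xy xw.
  by rewrite !step_notin ?wu.
by apply: IH; apply: contra nw => /andP[/step_mem -> /step_mem].
Qed.

End Spare.

(** * Exchanging two consecutive instructions *)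

Section Swap.
Variables (P : eqType) (G : nmodType) (R : realFieldType) (q : nat -> nat -> R).
Variables (n : nat) (rank : P -> R) (ps : seq P) (gs : seq G).
Variables (A Z : seq (instr P G)) (k : nat) (e f : instr P G).
Notation m := (who e).
Hypothesis Un : forall n', (n' < n)%N -> universal P G q n'.
Hypothesis Ups : uniq ps.
Hypothesis inj : {in ps &, injective rank}.
Hypothesis szps : size ps = n.
Hypothesis szgs : size gs = n.-1.
Hypothesis mps : m \in ps.
Hypothesis mmax : {in ps, forall x, x != m -> rank x < rank m}.
Hypothesis he : forall x g, hits e x g = (rank x < rank m).
Hypothesis nfm : who f != m.
Hypothesis sA : sound rank A.
Hypothesis sZ : sound rank Z.
Hypothesis sf : forall x g, hits f x g -> rank x < rank (who f).
Hypothesis hAm : shuns m A.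
Hypothesis hfm : forall g, hits f m g = false.
Hypothesis tZ : settling rank ps Z.
Implicit Types (w v b : seq (G * P)).

Let D w := chi R k (run Z (step f (step e (run A w)))) -
           chi R k (run Z (step e (step f (run A w)))).

Let rest (x : P) v := drop (index x (unzip2 v)).+1 v.

(* [who f] stands between [m], which hits it if [e] comes first, and a particle
   that it hits if [f] comes first. *)
Let conf v := if rest m v is [:: b1, b2 & _] then (b1.2 == who f) && hits f b2.2 b2.1
              else false.

Lemma rest_cat x (l r : seq (G * P)) (g : G) : x \notin unzip2 l -> rest x (l ++ (g, x) :: r) = r.
Proof.
move=> xl; rewrite /rest lab_cat index_cat (negPf xl) /= eqxx addn0.
by rewrite -cat_rcons drop_cat size_rcons size_map ltnn subnn drop0.
Qed.

Lemma uniq_notin x (l r : seq (G * P)) (g : G) : uniq (unzip2 (l ++ (g, x) :: r)) ->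
  x \notin unzip2 l /\ x \notin unzip2 r.
Proof.
rewrite lab_cat cat_uniq => /and3P[_ /hasPn/(_ x)+ /andP[-> _]].
by rewrite inE eqxx => /(_ isT).
Qed.

Lemma confP v : conf v -> exists l g g1 g2 a r,
  [/\ v = l ++ [:: (g, m), (g1, who f), (g2, a) & r], m \notin unzip2 l & hits f a g2].
Proof.
rewrite /conf; have [|] := boolP (m \in unzip2 v).
  move=> /mem_split[l [g [r [-> ml]]]]; rewrite rest_cat //.
  case: r => [|[g1 x] [|[g2 a] r]] //= /andP[/eqP -> h].
  by exists l, g, g1, g2, a, r.
by move=> mv; rewrite /rest memNindex // size_map drop_oversize.
Qed.

Let third v := (nth (0, m) (rest m v) 1).2.

Lemma size_ps : size ps = (size gs).+1.
Proof. by rewrite szgs -szps; case: (ps) mps. Qed.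

Lemma uniq_labels w : w \in arr ps gs -> uniq (unzip2 w).
Proof.
by move=> win; rewrite (perm_uniq (arr_labels size_ps win)).
Qed.

(* The block from [m] to the third particle [a] acts as a single particle, which is
   left with the rank of [a] in one order and with that of [m] in the other: both
   sums are governed by universality for smaller systems. *)
Lemma triple_cancel : \sum_(w <- arr ps gs) (if conf (run A w) then D w else 0) = 0.
Proof.
have szp := size_ps.
pose D3 w := if conf (run A w) then D w else 0.
have inv w : uniq (unzip2 w) -> conf (run A w) ->
    exists l g b h r g1 g2 l' g' r' a, third (run A w) = a /\
    [/\ w = l ++ (g, m) :: b ++ (h, a) :: r,
     run A (l ++ [:: (g, m)]) = l' ++ [:: (g', m)],
     forall d, run A ((d, a) :: r) = (d, a) :: r',
     forall d, run A ((d, m) :: b ++ [:: (h, a)]) = [:: (d, m); (g1, who f); (g2, a)] &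
     hits f a g2].
  move=> Uw /confP[l' [g' [g1 [g2 [a [r' [er ml' ha]]]]]]].
  have ea : third (run A w) = a by rewrite er /third rest_cat.
  have [l [g [b [h [r [ew e1 e2 e3]]]]]] :=
    @block_inv _ _ A w l' g' m [:: (g1, who f)] g2 a r' Uw er.
  by exists l, g, b, h, r, g1, g2, l', g', r', a.
apply: (@sum_by_segment _ _ _ D3 (fun w => segment m (third (run A w)) w) _ _ m) => //.
  move=> w win; rewrite /D3; case: ifP => [cf _|_ /eqP//].
  have Uw := uniq_labels win.
  have [l [g [b [h [r [g1 [g2 [l' [g' [r' [a [-> [ew _ _ _ _]]]]]]]]]]]]] := inv w Uw cf.
  rewrite [X in follows _ (segment _ _ X)]ew [X in follows _ _ X]ew.
  rewrite ew in Uw; rewrite segmentE //; apply/followsP.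
  exists l, g, r; rewrite -catA; split=> //.
  by have [] := uniq_notin Uw.
move=> b os og pps pgs so.
have sz' : size (m :: os) = (size og).+1 by rewrite /= so.
pose term w' := if segment m (third (run A (ins m b w'))) (ins m b w') == b
                then D3 (ins m b w') else 0.
rewrite -/(\sum_(w' <- _) term w').
have [/hasP[w0 w0in t0]|/hasPn allz] :=
    boolP (has (fun w' => term w' != 0) (arr (m :: os) og)); last first.
  by rewrite big1_seq // => w' /andP[_ /allz]; rewrite negbK => /eqP.
have insP w' : w' \in arr (m :: os) og -> exists l g r,
    [/\ w' = l ++ (g, m) :: r, ins m b w' = l ++ (g, m) :: b ++ r &
        uniq (unzip2 (l ++ (g, m) :: b ++ r))].
  move=> w'in; have [|l [g [r [ew' ml]]]] := @mem_split _ _ m w'.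
    by rewrite (perm_mem (arr_labels sz' w'in)) inE eqxx.
  exists l, g, r; split=> //; first by rewrite ew' insE.
  rewrite -insE // -ew' uniq_labels //.
  have := map_f (ins m b) w'in; rewrite -(perm_mem (perm_arr_ins Ups pps pgs so)).
  by rewrite mem_filter => /andP[].
have : exists b1 h a g1 g2, [/\ b = b1 ++ [:: (h, a)],
    forall d, run A ((d, m) :: b1 ++ [:: (h, a)]) = [:: (d, m); (g1, who f); (g2, a)] &
    hits f a g2].
  have [l [g [r [_ ew0 U0]]]] := insP _ w0in.
  move: t0; rewrite /term /D3 ew0; case: ifP => [/eqP sb|_]; last by rewrite eqxx.
  case: ifP => [cf _|_]; last by rewrite eqxx.
  have [l1 [g1 [b1 [h [r1 [h1 [h2 [l' [g' [r' [a [ea [ew _ _ e3 ha]]]]]]]]]]]]] := inv _ U0 cf.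
  exists b1, h, a, h1, h2; split=> //; apply: etrans (esym sb) _.
  by rewrite ea [X in segment _ _ X]ew segmentE // -ew.
move=> [b1 [h [a [g1 [g2 [eb rb ha]]]]]].
(* If [f] comes first, [who f] and [a] vanish and [m] absorbs [hR] on its right; if [e] comes first,
   [m] and [who f] vanish and [a] absorbs [hL] on its left. In the first case [e] is still to be
   executed, so it belongs to [ZR]. *)
pose hR := g1 + fuse f a g2; pose hL := fuse e (who f) g1 + g2.
pose A' := map (wall_instr m a) A.
pose ZL := map (lagl_instr m a hL) Z.
pose ZR := map (lagr_instr m hR) (e :: Z).
have aps : a \in ps.
  by rewrite (perm_mem pps) eb inE mem_cat lab_cat mem_cat inE eqxx !orbT.
have Ups' : uniq (m :: unzip2 b ++ os) by rewrite -(perm_uniq pps).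
have ma : m != a.
  apply: contraTneq Ups' => ->; rewrite eb /= lab_cat !mem_cat inE eqxx.
  by rewrite !orbT.
have aos : a \notin os.
  apply/negP => aos; move: Ups'; rewrite /= cat_uniq => /and3P[_ _ /andP[/hasPn/(_ a aos)]].
  by rewrite eb lab_cat mem_cat inE eqxx orbT.
have ram : rank a < rank m by apply: mmax => //; rewrite eq_sym.
have ospsS : {subset os <= ps}.
  by move=> x xo; rewrite (perm_mem pps) inE mem_cat xo !orbT.
have mpsS : {subset m :: os <= ps}.
  by move=> x; rewrite inE => /orP[/eqP -> //|/ospsS].
have Uos : uniq (m :: os).
  by apply: subseq_uniq Ups'; rewrite /= eqxx suffix_subseq.
transitivity (\sum_(w' <- arr (m :: os) og)
    (chi R k (run (A' ++ ZL) w') - chi R k (run (A' ++ ZR) w'))); last first.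
  have lt : (size (m :: os) < n)%N.
    rewrite -szps (perm_size pps) /= size_cat ltnS -{1}(add0n (size os)) ltn_add2r.
    by rewrite size_map eb size_cat addn1.
  have [sA1 sA2] := sound_wall ram hAm sA.
  apply: (@universal_diff P G R q (size (m :: os)) (rerank rank m a) rank) => //.
  - exact: Un.
  - move=> x y; rewrite !inE /rerank.
    case: (eqVneq x m) => [->|xm]; case: (eqVneq y m) => [->|ym] //= xo yo exy.
    + by move: (yo); rewrite -(inj aps (ospsS _ yo) exy) (negPf aos).
    + by move: (xo); rewrite (inj (ospsS _ xo) aps exy) (negPf aos).
    + by apply: inj => //; exact: ospsS.
  - by move=> x y /mpsS xs /mpsS ys; exact: inj.
  - by apply/Forall_cat; split=> //; exact: sound_lagl.
  - by apply: settling_cat; exact: settling_lagl ospsS tZ.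
  - apply/Forall_cat; split; first exact: sA1.
    have seZ : sound rank (e :: Z) by split=> // x g; rewrite he.
    exact: sound_lagr seZ.
  apply: settling_cat; apply: settling_lagr; apply: settling_cons.
  exact: settling_sub tZ.
apply: eq_big_seq => w' w'in.
have [l [g [r [ew' ew U1]]]] := insP _ w'in.
have U' : uniq (unzip2 (l ++ (g, m) :: r)).
  by rewrite -ew' (perm_uniq (arr_labels sz' w'in)).
have aw' : a \notin unzip2 w'.
  by rewrite (perm_mem (arr_labels sz' w'in)) inE eq_sym (negPf ma).
have [ml mr] := uniq_notin U'.
have al : a \notin unzip2 l.
  by apply: contra aw'; rewrite ew' lab_cat mem_cat => ->.
have ar : a \notin unzip2 r.
  by apply: contra aw'; rewrite ew' lab_cat mem_cat inE => ->; rewrite !orbT.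
have ebr : b ++ r = b1 ++ (h, a) :: r by rewrite eb -catA.
rewrite !run_cat /term ew ebr; rewrite ebr in U1.
have left' l' g' : run A (l ++ [:: (g, m)]) = l' ++ [:: (g', m)] <->
    run A' (l ++ [:: (g, m)]) = l' ++ [:: (g', m)].
  rewrite run_wall_left //.
    rewrite lab_cat cats1 rcons_uniq ml; move: U'.
    by rewrite lab_cat cat_uniq => /andP[].
  by rewrite lab_cat mem_cat !inE negb_or al eq_sym (negPf ma).
(* If [A'] destroys the compound particle, both sides vanish: the two tails agree on what is left,
   and in the original word [A] does not produce the conflict on this block. *)
have [mA'|nmA'] := boolP (m \in unzip2 (run A' w')); last first.
  have -> : run ZL (run A' w') = run ZR (run A' w').
    rewrite /ZR /=; set v := run A' w' in nmA' *.
    have nav : a \notin unzip2 v by apply: contra aw' => /run_mem.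
    have -> : step (lagr_instr m hR e) v = v.
      by rewrite step_notin // /lagr_instr eqxx.
    exact: run_lag_out.
  rewrite subrr; case: eqP => // sb; rewrite /D3; case: ifP => // cf; exfalso.
  have [l1 [k1 [b2 [h2 [r1 [h3 [h4 [l' [k' [r' [a1 [ea [ew1 f1 f2 _ _]]]]]]]]]]]]] :=
    inv _ U1 cf.
  have [el eg ebb] := split_uniq U1 ew1.
  have {}ea : a1 = a.
    move: sb; rewrite ea [X in segment _ _ X]ew1 segmentE -?ew1 // eb !cats1.
    by move=> /rcons_inj[].
  rewrite ea -?el -?eg in ew1 ebb f1 f2.
  have Ub : uniq (unzip2 (b1 ++ (h, a) :: r)).
    by move: U1; rewrite lab_cat cat_uniq => /and3P[_ _ /andP[]].
  have [_ _ er] := split_uniq Ub ebb; rewrite -er in f2.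
  case: (run_wall_right A g ma mr ar) => [[r2 H]|[_ ]]; last by rewrite f2 inE eqxx.
  have [H1 H2] := H g; case/negP: nmA'; rewrite ew'.
  rewrite (run_glue U' (iffLR (left' _ _) f1) H1).
  by rewrite lab_cat mem_cat inE eqxx orbT.
rewrite ew' in mA' *.
have [l' [g' [r' [f1 f2 f3]]]] := run_wall U' mA'.
case: (run_wall_right A g ma mr ar) => [[r2 H]|[]]; last by rewrite f2 inE eqxx.
have e2 d : run A ((d, a) :: r) = (d, a) :: r'.
  by have [H1 H2] := H d; rewrite H2; move: H1; rewrite f2 => -[->].
have e1 := iffRL (left' _ _) f1.
have eA : run A (l ++ (g, m) :: b1 ++ (h, a) :: r) =
    l' ++ [:: (g', m), (g1, who f), (g2, a) & r'].
  exact: (run_block_glue (c := [:: (g1, who f)]) U1 e1 (e2 0) (rb 0)).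
have UA := run_uniq A U1; rewrite eA in UA.
have [ml' _] := uniq_notin UA.
have eT : third (run A (l ++ (g, m) :: b1 ++ (h, a) :: r)) = a.
  by rewrite eA /third rest_cat.
rewrite eT segmentE // -eb eqxx /D3 eA /conf rest_cat //= eqxx ha /D eA.
have U'A := run_uniq A' U'; rewrite f3 in U'A.
have [_ mr'] := uniq_notin U'A.
have a'A : a \notin unzip2 (l' ++ (g', m) :: r').
  by rewrite -f3; apply: contra aw' => /run_mem; rewrite ew'.
have wfps : who f \in ps.
  rewrite (perm_mem pps) -cat_cons mem_cat eb lab_cat /=; apply/orP; left.
  have : who f \in unzip2 (run A ((0, m) :: b1 ++ [:: (h, a)])).
    by rewrite rb !inE eqxx orbT.
  by move=> /run_mem; rewrite /= lab_cat.
rewrite f3; congr (_ - _); rewrite /chi; congr ((_ == _)%:R).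
  rewrite step_cat // step_eq //= he mmax // step_notin; last first.
    apply/negP => wf; move: UA; rewrite -cat_rcons lab_cat cat_uniq => /and3P[_ hn].
    move=> /andP[wfr _]; move: wf; rewrite lab_cat mem_cat => /orP[wf|wf].
      case/negP: hn; apply/hasP; exists (who f); first by rewrite inE eqxx.
      by rewrite /unzip2 map_rcons mem_rcons inE -/(unzip2 _) wf orbT.
    by case/negP: wfr.
  rewrite -[RHS](size_lagl m a hL) run_lagl // lagl_cat //.
  by rewrite /hL addrA.
have wfl : who f \notin unzip2 (l' ++ [:: (g', m)]).
  have U2 : uniq (unzip2 ((l' ++ [:: (g', m)]) ++ [:: (g1, who f), (g2, a) & r'])).
    by rewrite -catA.
  by have [] := uniq_notin U2.
have eL x : l' ++ (g', m) :: x = (l' ++ [:: (g', m)]) ++ x by rewrite -catA.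
rewrite eL step_cat // step_eq //= ha -eL.
rewrite -/hR -lagr_cat // -[LHS]/(size (run (e :: Z) _)) -run_lagr //.
by rewrite size_lagr.
Qed.

Let fourth v := (nth (0, m) (rest (who f) v) 2).2.

Notation u := (who f).

(* Here [m] hits the particle on its right, which brings [who f] next to a particle
   that it hits: if [f] comes first, it does nothing. *)
Lemma nested_cancel : \sum_(w <- arr ps gs) (if conf (run A w) then 0 else D w) = 0.
Proof.
have szp := size_ps.
pose D4 w := if conf (run A w) then 0 else D w.
have inv w : w \in arr ps gs -> D4 w != 0 ->
    exists l g b h r g0 g1 x g2 l' g' r' y, fourth (run A w) = y /\
    [/\ w = l ++ (g, u) :: b ++ (h, y) :: r,
     run A (l ++ [:: (g, u)]) = l' ++ [:: (g', u)],
     forall d, run A ((d, y) :: r) = (d, y) :: r',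
     forall d, run A ((d, u) :: b ++ [:: (h, y)]) =
       [:: (d, u); (g0, m); (g1, x); (g2, y)] &
     hits f y (g0 + fuse e x g1 + g2)].
  move=> win; rewrite /D4; case: ifP => [_|ncf Dw]; first by rewrite eqxx.
  have Uw := uniq_labels win; have Ur := run_uniq A Uw.
  have [|E|[l [g [g1 [g2 [a [r [er ha]]]]]]]|] := @step_swap _ _ e f (run A w) Ur _ nfm hfm.
  - move=> x g /run_mem xw xm; rewrite he mmax //.
    by rewrite -(perm_mem (arr_labels szp win)).
  - by move: Dw; rewrite /D E subrr eqxx.
  - case/negP: ncf; rewrite er in Ur *; have [ml _] := uniq_notin Ur.
    by rewrite /conf rest_cat //= eqxx.
  move=> [l' [g' [g0 [g1 [x [g2 [y [r' [er hy]]]]]]]]].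
  have Ur' := Ur; rewrite er in Ur'; have [ul _] := uniq_notin Ur'.
  have ey : fourth (run A w) = y by rewrite er /fourth rest_cat.
  have [l [g [b [h [r [ew e1 e2 e3]]]]]] :=
    @block_inv _ _ A w l' g' u [:: (g0, m); (g1, x)] g2 y r' Uw er.
  by exists l, g, b, h, r, g0, g1, x, g2, l', g', r', y.
apply: (@sum_by_segment _ _ _ D4 (fun w => segment u (fourth (run A w)) w) _ _ u) => //.
  move=> w win Dw; have Uw := uniq_labels win.
  have [l [g [b [h [r [g0 [g1 [x [g2 [l' [g' [r' [y [-> [ew _ _ _ _]]]]]]]]]]]]]]] :=
    inv w win Dw.
  rewrite [X in follows _ (segment _ _ X)]ew [X in follows _ _ X]ew.
  rewrite ew in Uw; rewrite segmentE //; apply/followsP.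
  exists l, g, r; rewrite -catA; split=> //.
  by have [] := uniq_notin Uw.
move=> b os og pps pgs so.
have sz' : size (u :: os) = (size og).+1 by rewrite /= so.
pose term w' := if segment u (fourth (run A (ins u b w'))) (ins u b w') == b
                then D4 (ins u b w') else 0.
rewrite -/(\sum_(w' <- _) term w').
have [/hasP[w0 w0in t0]|/hasPn allz] :=
    boolP (has (fun w' => term w' != 0) (arr (u :: os) og)); last first.
  by rewrite big1_seq // => w' /andP[_ /allz]; rewrite negbK => /eqP.
have insP w' : w' \in arr (u :: os) og -> ins u b w' \in arr ps gs /\ exists l g r,
    [/\ w' = l ++ (g, u) :: r, u \notin unzip2 l, ins u b w' = l ++ (g, u) :: b ++ r &
        uniq (unzip2 (l ++ (g, u) :: b ++ r))].
  move=> w'in; have [|l [g [r [ew' ml]]]] := @mem_split _ _ u w'.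
    by rewrite (perm_mem (arr_labels sz' w'in)) inE eqxx.
  have iin : ins u b w' \in arr ps gs.
    have := map_f (ins u b) w'in; rewrite -(perm_mem (perm_arr_ins Ups pps pgs so)).
    by rewrite mem_filter => /andP[].
  split=> //; exists l, g, r; split=> //; first by rewrite ew' insE.
  by rewrite -insE // -ew' uniq_labels.
have : exists b1 h y g0 g1 x g2, [/\ b = b1 ++ [:: (h, y)],
    forall d, run A ((d, u) :: b1 ++ [:: (h, y)]) =
      [:: (d, u); (g0, m); (g1, x); (g2, y)] &
    hits f y (g0 + fuse e x g1 + g2)].
  have [iin [l [g [r [_ _ ew0 U0]]]]] := insP _ w0in.
  move: t0; rewrite /term; case: ifP => [/eqP sb Dw|_]; last by rewrite eqxx.
  have := inv _ iin Dw.
  move=> [l1 [k1 [b1 [h [r1 [h1 [h2 [x [h3 [l' [k' [r' [y [ey [ew _ _ e3 hy]]]]]]]]]]]]]]].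
  exists b1, h, y, h1, h2, x, h3; split=> //; apply: etrans (esym sb) _.
  by rewrite ey ew segmentE // -ew ew0.
move=> [b1 [h [y [g0 [g1 [x [g2 [eb rb hy]]]]]]]].
(* The gap through which [u] sees [y] once [m] has hit [x]. If [f] comes first, [u] faces [m], which
   it cannot hit, and the pair stays: the two orders differ by removing or keeping a pair separated
   by [c]. *)
set c := g0 + fuse e x g1 + g2 in hy.
pose A' := map (spare_instr u y) A.
have Ups' : uniq (u :: unzip2 b ++ os) by rewrite -(perm_uniq pps).
have yb : y \in unzip2 b by rewrite eb lab_cat mem_cat inE eqxx orbT.
have uy : u != y.
  by apply: contraTneq Ups' => ->; rewrite /= mem_cat yb.
have yos : y \notin os.
  by move: Ups'; rewrite /= cat_uniq => /and3P[_ _ /andP[/hasPn h0 _]];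
    apply/negP => /h0/negP; apply.
have sub : {subset [:: u, y & os] <= ps}.
  move=> z; rewrite !inE (perm_mem pps) inE mem_cat => /or3P[->|/eqP ->|->] //.
    by rewrite yb orbT.
  by rewrite !orbT.
(* The block is replaced by the bare pair, which [A] itself might hit too early, hence [A']. *)
have := @pair_removal P G R q n rank A' Z k u y c (fuse f) Un uy (sf hy)
  (spares_spare _ _ _) (sound_spare _ _ sA) sZ os og.
set fe := Instr u _ _; cbv zeta.
pose D2 w := chi R k (run Z (step fe (run A' w))) - chi R k (run Z (run A' w)).
rewrite -/(\sum_(w <- _) D2 (ins u [:: (c, y)] w)) => key.
rewrite -[RHS]key //; last first.
- exact: settling_sub tZ.
- have := size_subseq (run_subseq A ((0, u) :: b1 ++ [:: (h, y)])).
  rewrite rb -eb /= size_map => sb.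
  by rewrite -szps (perm_size pps) /= size_cat size_map ltnS -[(size os).+2]add2n leq_add2r ltnW.
- by move=> z1 z2 /sub z1s /sub z2s; exact: inj.
- move: Ups'; rewrite /= !inE !negb_or uy yos mem_cat negb_or cat_uniq.
  by move=> /andP[/andP[_ ->] /and3P[_ _ ->]].
apply: eq_big_seq => w' w'in.
have [win [l [g [r [ew' ul ew U1]]]]] := insP _ w'in.
have ebr : b ++ r = b1 ++ (h, y) :: r by rewrite eb -catA.
rewrite /term ew ebr ew' insE //; rewrite ebr in ew U1; rewrite ew in win.
have yl : y \notin unzip2 l /\ y \notin unzip2 r.
  move: U1; rewrite -[_ :: b1 ++ _]/(((g, u) :: b1) ++ _) catA.
  move=> /uniq_notin[]; rewrite lab_cat mem_cat negb_or => /andP[-> _] ->.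
  by [].
have [{}yl yr] := yl; have [_ ur] := uniq_notin U1.
have {}ur : u \notin unzip2 r.
  by move: ur; rewrite lab_cat mem_cat inE !negb_or => /and3P[].
have U2 : uniq (unzip2 (l ++ (g, u) :: [::] ++ (c, y) :: r)).
  apply: subseq_uniq U1; rewrite !lab_cat /= lab_cat /=.
  apply: cat_subseq; first exact: subseq_refl.
  by rewrite /= eqxx -[X in subseq X]cat0s; apply: cat_subseq; rewrite ?sub0seq ?subseq_refl.
have eAl : run A' (l ++ [:: (g, u)]) = run A (l ++ [:: (g, u)]).
  apply: run_spare; rewrite !lab_cat !mem_cat !inE (negPf yl) /= eq_sym (negPf uy).
  by rewrite andbF.
have eAr d : run A' ((d, y) :: r) = run A ((d, y) :: r).
  by apply: run_spare; rewrite !inE /= (negPf ur) (negPf uy).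
have rt : run A' ((0, u) :: [::] ++ [:: (c, y)]) = (0, u) :: [::] ++ [:: (c, y)].
  by apply: run_spares => //; exact: spares_spare.
rewrite -[[:: (c, y)] ++ r]/([::] ++ (c, y) :: r).
have inert v : ~~ ((u \in unzip2 v) && (y \in unzip2 v)) -> step fe v = v.
  apply: contraNeq => /step_changed[l1 [h1 [h2 [z [r1 [-> /andP[/eqP -> _]]]]]]].
  by rewrite lab_cat !mem_cat !inE !eqxx !orbT.
have [/andP[u1 y1]|nuy] := boolP ((u \in unzip2 (run A' (l ++ (g, u) :: [::] ++ (c, y) :: r)))
     && (y \in unzip2 (run A' (l ++ (g, u) :: [::] ++ (c, y) :: r)))); last first.
  rewrite /D2 inert // subrr; case: eqP => // sb; apply/eqP; apply: contraNT nuy => Dw.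
  have := inv _ win Dw.
  move=> [l1 [k1 [b2 [h2 [r1 [h3 [h4 [x1 [h5 [l' [k' [r' [y1 [ey [ew1 f1 f2 _ _]]]]]]]]]]]]]]].
  have [el eg ebb] := split_uniq U1 ew1.
  have {}ey : y1 = y.
    move: sb; rewrite ey [X in segment _ _ X]ew1 segmentE -?ew1 // eb !cats1.
    by move=> /rcons_inj[].
  rewrite ey -?el -?eg in ew1 ebb f1 f2.
  have Ub : uniq (unzip2 (b1 ++ (h, y) :: r)).
    by move: U1; rewrite lab_cat cat_uniq => /and3P[_ _ /andP[]].
  have [_ _ er] := split_uniq Ub ebb; rewrite -er in f2.
  rewrite (run_block_glue U2 (etrans eAl f1) (etrans (eAr 0) (f2 0)) rt).
  by rewrite !lab_cat !mem_cat !inE !eqxx !orbT.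
have [l' [g' [r' [cc [h' [f1 f2 f3 f4]]]]]] := run_block U2 u1 y1.
have [ecc eh'] : cc = [::] /\ h' = c.
  have := f3 0; rewrite rt => -[]; by case: (cc) => [[->] //|? [|? ?]].
rewrite {}ecc {}eh' in f4.
have eA : run A (l ++ (g, u) :: b1 ++ (h, y) :: r) =
    l' ++ [:: (g', u), (g0, m), (g1, x), (g2, y) & r'].
  apply: (run_block_glue (c := [:: (g0, m); (g1, x)]) (d := 0) U1 _ _ (rb 0)).
    by rewrite -eAl.
  by rewrite -(eAr 0).
have Ur := run_uniq A U1; rewrite eA in Ur.
have [ul' ur'] := uniq_notin Ur.
have ml' : m \notin unzip2 (l' ++ [:: (g', u)]).
  have Ur2 : uniq (unzip2 ((l' ++ [:: (g', u)]) ++ [:: (g0, m), (g1, x), (g2, y) & r'])).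
    by rewrite -catA.
  by have [] := uniq_notin Ur2.
have eL v : l' ++ (g', u) :: v = (l' ++ [:: (g', u)]) ++ v by rewrite -catA.
have ey : fourth (run A (l ++ (g, u) :: b1 ++ (h, y) :: r)) = y.
  by rewrite eA /fourth rest_cat.
have xu : x != u.
  by move: ur'; rewrite /= !inE !negb_or [x == _]eq_sym => /and4P[].
have xm : x != m.
  have Ur2 : uniq (unzip2 ((l' ++ [:: (g', u)]) ++ [:: (g0, m), (g1, x), (g2, y) & r'])).
    by rewrite -catA.
  by have [_] := uniq_notin Ur2; rewrite /= !inE !negb_or [x == _]eq_sym => /and3P[].
have xps : x \in ps.
  have : x \in unzip2 (run A (l ++ (g, u) :: b1 ++ (h, y) :: r)).
    by rewrite eA lab_cat mem_cat !inE eqxx !orbT.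
  by move=> /run_mem; rewrite (perm_mem (arr_labels szp win)).
rewrite ey segmentE // -eb eqxx /D4 eA /conf eL rest_cat //= (negPf xu) /=.
rewrite /D /D2 eA f4 eL; congr (_ - _); rewrite /chi; congr (((size (run Z _)) == _)%:R).
  rewrite step_cat // step_eq //= he mmax // -catA /= !step_cat // !step_eq //=.
  by rewrite -/c hy eqxx eqxx.
have -> : step f ((l' ++ [:: (g', u)]) ++ [:: (g0, m), (g1, x), (g2, y) & r']) =
    (l' ++ [:: (g', u)]) ++ [:: (g0, m), (g1, x), (g2, y) & r'].
  by rewrite -catA /= step_cat // step_eq //= hfm.
by rewrite step_cat // step_eq //= he mmax // -catA.
Qed.

Lemma swap_law : \sum_(w <- arr ps gs) D w = 0.
Proof.
transitivity (\sum_(w <- arr ps gs) (if conf (run A w) then D w else 0) +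
              \sum_(w <- arr ps gs) (if conf (run A w) then 0 else D w)).
  by rewrite -big_split; apply: eq_bigr => w _ /=; case: ifP; rewrite ?addr0 ?add0r.
by rewrite triple_cancel nested_cancel addr0.
Qed.

End Swap.

(** * Universality *)

Section PermutationSums.
Variables (T : eqType) (R : zmodType).
Implicit Types (s t : seq T) (F : seq T -> R).

Definition insert_at j (x : T) s := take j s ++ x :: drop j s.

Lemma perm_insert_at j x s : perm_eq (insert_at j x s) (x :: s).
Proof.
apply/seq.permP => a; rewrite -{2}(cat_take_drop j s) /insert_at /= !count_cat /=.
by rewrite addnCA.
Qed.

Lemma size_insert_at j x s : size (insert_at j x s) = (size s).+1.
Proof. exact: perm_size (perm_insert_at j x s). Qed.

Lemma sum_perm_rot j s F :
  \sum_(t <- permutations s) F (rot j t) = \sum_(t <- permutations s) F t.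
Proof.
rewrite -(big_map (rot j) xpredT F); apply: perm_big; apply: uniq_perm.
- by rewrite map_inj_uniq ?permutations_uniq //; exact: rot_inj.
- exact: permutations_uniq.
move=> t; apply/mapP/idP => [[u + ->]|tin].
  by rewrite !mem_permutations perm_rot.
exists (rotr j t); last by rewrite rotrK.
by move: tin; rewrite !mem_permutations perm_rotr.
Qed.

Lemma sum_perm_rotr j s F :
  \sum_(t <- permutations s) F (rotr j t) = \sum_(t <- permutations s) F t.
Proof. by rewrite -(sum_perm_rot j); apply: eq_bigr => t _; rewrite rotK. Qed.

Lemma sum_perm_at j s F : (j < size s)%N ->
  \sum_(t <- permutations s) F t =
  \sum_(a <- undup s) \sum_(t <- permutations (rem a s)) F (insert_at j a t).
Proof.
move=> js; rewrite -(sum_perm_rotr j).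
rewrite (perm_big _ (permutationsE (leq_ltn_trans (leq0n _) js))) big_allpairs_dep /=.
apply: eq_big_seq => a; rewrite mem_undup => ain.
rewrite -(sum_perm_rot j); apply: eq_big_seq => t.
rewrite mem_permutations => /perm_size; rewrite size_rem // => st.
have jt : (j <= size t)%N by rewrite st; case: (size s) js.
rewrite /insert_at; have -> : a :: rot j t = (a :: drop j t) ++ take j t by [].
have {1}<- : size (take j t) = j by rewrite size_take_min; apply/minn_idPl.
by rewrite rotr_size_cat.
Qed.

Lemma take_insert j x s : (j <= size s)%N -> take j (insert_at j x s) = take j s.
Proof.
move=> js; rewrite /insert_at take_cat size_take_min (minn_idPl js) ltnn subnn.
by rewrite take0 cats0.
Qed.

Lemma drop_insert j x s : (j <= size s)%N -> drop j (insert_at j x s) = x :: drop j s.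
Proof.
move=> js; rewrite /insert_at drop_cat size_take_min (minn_idPl js) ltnn subnn.
by rewrite drop0.
Qed.

(** A permutation of [x :: s] is produced once for each position at which it holds [x]; there may be
    several, since [x] may also occur in [s]. *)
Lemma sum_perm_insert x s F :
  \sum_(t <- permutations s) \sum_(j <- iota 0 (size s).+1) F (insert_at j x t) =
  (\sum_(t <- permutations (x :: s)) F t) *+ count_mem x (x :: s).
Proof.
rewrite exchange_big -sumrMnl.
transitivity (\sum_(t <- permutations (x :: s)) \sum_(j <- iota 0 (size s).+1)
    if nth x t j == x then F t else 0); last first.
  apply: eq_big_seq => t; rewrite mem_permutations => pt.
  rewrite -big_mkcond big_const_seq /= iter_addr_0; congr (_ *+ _).
  rewrite -[RHS]/(count_mem x (x :: s)) -(seq.permP pt) -[in RHS](mkseq_nth x t).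
  by rewrite /mkseq count_map (perm_size pt).
rewrite [RHS]exchange_big; apply: eq_big_seq => j; rewrite mem_iota add0n => /andP[_ js].
rewrite -big_mkcond -[RHS]big_filter -[LHS](big_map (insert_at j x) xpredT F).
have nth_insert t : size t = size s -> nth x (insert_at j x t) j = x.
  move=> st; rewrite /insert_at nth_cat size_take_min (minn_idPl _) ?st //.
  by rewrite ltnn subnn.
apply: perm_big; apply: uniq_perm.
- rewrite map_inj_in_uniq ?permutations_uniq // => t t'.
  rewrite !mem_permutations => /perm_size st /perm_size st' e.
  rewrite -(cat_take_drop j t) -(cat_take_drop j t').
  have jt : (j <= size t)%N by rewrite st.
  have jt' : (j <= size t')%N by rewrite st'.
  have := congr1 (drop j) e; rewrite !drop_insert // => -[->].
  by rewrite -(take_insert x jt) e take_insert.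
- by rewrite filter_uniq // permutations_uniq.
move=> t; rewrite mem_filter mem_permutations; apply/mapP/andP => [[u + ->]|[/eqP nt pt]].
  rewrite mem_permutations => pu; rewrite nth_insert ?eqxx ?(perm_size pu) //.
  by rewrite (permPl (perm_insert_at _ _ _)) perm_cons.
have jt : (j < size t)%N by rewrite (perm_size pt).
have et : t = insert_at j x (take j t ++ drop j.+1 t).
  rewrite /insert_at take_cat drop_cat size_take jt ltnn subnn take0 drop0 cats0.
  by rewrite -[X in X :: drop _ _]nt -drop_nth // cat_take_drop.
exists (take j t ++ drop j.+1 t) => //.
rewrite mem_permutations -(perm_cons x) -(permPr pt) [X in perm_eq _ X]et.
by rewrite perm_sym perm_insert_at.
Qed.

End PermutationSums.

Section Universality.
Variables (P : eqType) (G : nmodType) (R : realFieldType) (q : nat -> nat -> R).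
Hypothesis q0 : forall k, q 0 k = (k == 0)%:R.
Hypothesis q1 : forall k, q 1 k = (k == 1)%:R.
Hypothesis qS : forall n k, q n.+2 k =
  n.+2%:R^-1 * (if k is j.+1 then q n.+1 j else 0) + (1 - n.+2%:R^-1) * q n k.
Implicit Types (w b : seq (G * P)) (ps : seq P) (gs : seq G) (rank : P -> R).
Implicit Types (L : seq (instr P G)) (i : instr P G).

Lemma sum_arr (F : seq (G * P) -> R) ps gs :
  \sum_(w <- arr ps gs) F w =
  \sum_(s <- permutations ps) \sum_(t <- permutations gs) F (zip (0 :: t) s).
Proof. by rewrite big_allpairs_dep. Qed.

(** [mu] is left arbitrary because it changes each time the killer absorbs another instruction of
    the same particle. *)
Definition killer rank (m : P) (mu : P -> G -> G) : instr P G :=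
  Instr m (fun x _ => rank x < rank m) mu.

(** If [f] hits, its particle is gone and the killer finds nobody; if not, the killer acts alone. By
    soundness of [f], the combined killer hits every neighbour that [f] hits. *)
Lemma step_absorb rank f mu w : uniq (unzip2 w) ->
  (forall x g, hits f x g -> rank x < rank (who f)) ->
  step (killer rank (who f) mu) (step f w) =
  step (killer rank (who f) (fun x g => if hits f x g then fuse f x g else mu x g)) w.
Proof.
move=> U sf; elim: w U => [//|a [//|b w] IH] U.
have [e|ne] := eqVneq a.2 (who f); last first.
  have ne' mu' : a.2 != who (killer rank (who f) mu') by [].
  rewrite (step_neq _ ne) !(step_neq _ (ne' _)) IH //.
  by case/andP: U.
rewrite (step_eq _ _ e) (@step_eq _ _ (killer _ _ _)) //=.
have [h|h] := boolP (hits f b.2 b.1); last by rewrite step_eq //= (negPf h).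
rewrite (sf _ _ h) step_notin // lab_addhead; apply/negP => /= w2.
by move: U; rewrite /= e inE negb_or w2 andbF.
Qed.

Lemma run_settled rank L w : settled rank w -> sound rank L -> run L w = w.
Proof.
move=> st; elim: L => //= i L IH [si /IH IH'].
suff -> : step i w = w by [].
apply/eqP/negPn/negP => /step_changed[l [g [h [y [r [ew hy]]]]]].
move: st; rewrite /settled ew lab_cat /= => /cat_sorted2[_ /= /andP[+ _]].
by rewrite leNgt (si _ _ hy).
Qed.

Lemma run_last L l (g : G) x : shuns x L -> x \notin unzip2 l ->
  exists g', run L (l ++ [:: (g, x)]) = run L l ++ [:: (g', x)].
Proof.
elim: L l g => [|i L IH] l g /=; first by exists g.
move=> [hx sL] xl; suff [g1 e1] : exists g1, step i (l ++ [:: (g, x)]) = step i l ++ [:: (g1, x)].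
  by rewrite e1; apply: IH => //; apply: contra xl; exact: step_mem.
elim: l xl {IH} => [|c [|b l] IH] xl; first by exists g.
  have [e|ne] := eqVneq c.2 (who i); last by exists g; rewrite cat_cons step_neq.
  by exists g; rewrite /= step_eq // hx.
have [e|ne] := eqVneq c.2 (who i); last first.
  have [|g1 e1] := IH; first by move: xl; rewrite inE negb_or => /andP[].
  by exists g1; rewrite cat_cons !(step_neq _ ne) e1.
rewrite /= !step_eq //; case: ifP => _; last by exists g.
case: l {IH xl} => [|d l]; first by exists (c.1 + fuse i b.2 b.1 + g).
by exists g.
Qed.

Section MaxParticle.
Variables (n : nat) (rank : P -> R) (ps : seq P) (gs : seq G) (k : nat) (m : P).
Hypothesis Un : forall n', (n' < n)%N -> universal P G q n'.
Hypothesis Ups : uniq ps.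
Hypothesis inj : {in ps &, injective rank}.
Hypothesis szps : size ps = n.
Hypothesis szgs : size gs = n.-1.
Hypothesis mps : m \in ps.
Hypothesis mmax : {in ps, forall x, x != m -> rank x < rank m}.

(* An instruction of [m] preceding the killer is absorbed by it, and any other one
   may be exchanged with it. *)
Lemma advance_killer A mu Z : sound rank A -> sound rank Z -> shuns m A -> shuns m Z ->
  settling rank ps Z ->
  exists mu' Y, [/\ sound rank Y, shuns m Y, settling rank ps Y &
    \sum_(w <- arr ps gs) chi R k (run (A ++ killer rank m mu :: Z) w) =
    \sum_(w <- arr ps gs) chi R k (run (killer rank m mu' :: Y) w)].
Proof.
have szp : size ps = (size gs).+1 by rewrite szgs -szps; case: (ps) mps.
elim/last_ind: A mu Z => [|A f IH] mu Z; first by exists mu, Z.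
rewrite -cats1 => /Forall_cat[sA [sf _]] sZ /Forall_cat[mA [mf _]] mZ tZ.
rewrite -catA /=; have [wf|nwf] := eqVneq (who f) m.
  have [mu' [Y [sY mY tY E]]] :=
    IH (fun x g => if hits f x g then fuse f x g else mu x g) Z sA sZ mA mZ tZ.
  exists mu', Y; split=> //; apply: etrans E.
  apply: eq_big_seq => w win; rewrite !run_cat /=.
  have UA : uniq (unzip2 (run A w)).
    by apply: run_uniq; rewrite (perm_uniq (arr_labels szp win)).
  by have := step_absorb mu UA sf; rewrite wf => ->.
have [//|//|//|//||mu' [Y [sY mY tY E]]] := IH mu (f :: Z); first exact: settling_cons.
exists mu', Y; split=> //; apply: etrans E; apply/esym/eqP.
rewrite -subr_eq0 -sumrB; apply/eqP.
have := @swap_law P G R q n rank ps gs A Z k (killer rank m mu) f.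
by move=> SW; rewrite -[RHS]SW //; apply: eq_bigr => w _; rewrite !run_cat.
Qed.

Lemma size_run_head L (g : G) t s : size s = (size t).+1 ->
  size (run L (zip (g :: t) s)) = size (run L (zip (0 :: t) s)).
Proof.
case: s => // x s _; have -> : zip (g :: t) (x :: s) = addhead g (zip (0 :: t) (x :: s)).
  by rewrite /= addr0.
by rewrite run_addhead size_addhead.
Qed.

End MaxParticle.

Lemma head_step_killer rank m mu (g h : G) r w : rank r < rank m ->
  step (killer rank m mu) [:: (g, m), (h, r) & w] = addhead (g + mu r h) w.
Proof. by move=> rm; rewrite step_eq //= rm. Qed.

(* The word left by an arrangement of [s], [m], [r] in which [m] sits at position
   [i], just before [r]. *)
Definition contract (c : G -> G) (pos : nat) (t : seq G) :=
  if pos is j.+1 then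
    if drop j t is [:: a, b, d & u] then take j t ++ a + c b + d :: u else take j t
  else drop 2 t.

Lemma size_step_killer rank m mu r (i : nat) s t Y :
  m \notin s -> rank r < rank m -> (i <= size s)%N -> size t = (size s).+1 ->
  size (run Y (step (killer rank m mu) (zip (0 :: t) (take i s ++ [:: m, r & drop i s])))) =
  size (run Y (zip (0 :: contract (mu r) i t) s)).
Proof.
move=> ms rm; case: i => [|j] /=.
  rewrite take0 drop0 => _; case: t => // b t /= [st].
  rewrite head_step_killer // run_addhead size_addhead.
  case: t st => [|d t] st; first by case: s st {ms}.
  by rewrite /= drop0 size_run_head // -st.
move=> js st; have jt : (j < size t)%N by rewrite st ltnW.
have -> : zip (0 :: t) (take j.+1 s ++ [:: m, r & drop j.+1 s]) =
    zip (0 :: take j t) (take j.+1 s) ++ zip (drop j t) [:: m, r & drop j.+1 s].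
  rewrite -{1}(cat_take_drop j t) -cat_cons zip_cat //=.
  by rewrite !size_takel // ltnW.
rewrite step_cat; last first.
  rewrite unzip2_zip; last by rewrite /= !size_takel // ltnW.
  by apply: contra ms => /mem_take.
have szd : size (drop j t) = (size (drop j.+1 s)).+2.
  by rewrite !size_drop st -subSn // subSS subSn // ltnW.
case: (drop j t) szd => [|a [|b u]] //= [szu].
rewrite head_step_killer //; congr (size (run Y _)).
rewrite -[in RHS](cat_take_drop j.+1 s).
case: u szu => [|d u] szu; case eds : (drop j.+1 s) szu => [|y v] //= szu.
  by rewrite !cats0.
by rewrite -cat_cons zip_cat //= !size_takel // ltnW.
Qed.

(** At the two extreme positions, gaps are only lost and the remaining ones are uniformly arranged.
    At the others, three gaps [a], [b], [d] become [a + c b + d]; for fixed values of these, the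
    merged gap is inserted at every position among the other gaps, which again yields a uniform
    arrangement. *)
Lemma sum_contract (c : G -> G) (F : seq G -> R) gs p :
  size gs = p.+1 ->
  (forall gs', size gs' = p.-1 -> \sum_(t <- permutations gs') F t = 0) ->
  \sum_(i <- iota 0 p.+1) \sum_(t <- permutations gs) F (contract c i t) = 0.
Proof.
move=> sg H0; have [p0|p_gt0] := posnP p.
  rewrite p0 big_seq1 big1_seq // => t /andP[_].
  rewrite mem_permutations => /perm_size; rewrite sg p0; case: t => [|? []] //= _.
  have := H0 [::]; rewrite p0 => /(_ erefl); by rewrite big_seq1.
have [p' ep] : exists p', p = p'.+1 by exists p.-1; rewrite prednK.
rewrite {p p_gt0}ep in sg H0 *; rewrite /= in H0.
have iE : iota 0 p'.+2 = 0%N :: iota 1 p' ++ [:: p'.+1].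
  by have := iotaD 1 p' 1; rewrite addn1 /= => ->.
rewrite iE {iE}.
have at2 j (F' : seq G -> R) : (j <= p')%N ->
    \sum_(t <- permutations gs) F' t = \sum_(a <- undup gs) \sum_(b <- undup (rem a gs))
      \sum_(t <- permutations (rem b (rem a gs))) F' (insert_at j a (insert_at j b t)).
  move=> jp; rewrite (sum_perm_at (j := j)) ?sg ?ltnS 1?ltnW //.
  apply: eq_big_seq => a; rewrite mem_undup => ain.
  by rewrite (sum_perm_at (j := j)) // size_rem // sg.
have sz2 (a b : G) : a \in gs -> b \in rem a gs -> size (rem b (rem a gs)) = p'.
  by move=> ain bin; rewrite !size_rem ?sg.
rewrite big_cons (at2 0) // big1_seq ?add0r; last first.
  move=> a /andP[_]; rewrite mem_undup => ain; rewrite big1_seq // => b /andP[_].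
  rewrite mem_undup => bin; rewrite -[RHS](H0 (rem b (rem a gs))) ?sz2 //.
  by apply: eq_bigr => t _; rewrite /contract /insert_at /= !take0 !drop0 /= drop0.
rewrite big_cat big_seq1 (at2 p') //=.
rewrite [X in _ + X]big1_seq ?addr0; last first.
  move=> a /andP[_]; rewrite mem_undup => ain; rewrite big1_seq // => b /andP[_].
  rewrite mem_undup => bin; rewrite -[RHS](H0 (rem b (rem a gs))) ?sz2 //.
  apply: eq_big_seq => t; rewrite mem_permutations => /perm_size; rewrite sz2 // => st.
  rewrite /contract !drop_insert ?size_insert_at ?st //.
  by rewrite drop_oversize ?st // !take_insert ?size_insert_at ?st // take_oversize ?st.
have [->|p_gt0] := posnP p'; first by rewrite big_nil.
have [p ep] : exists p, p' = p.+1 by exists p'.-1; rewrite prednK.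
rewrite {p' p_gt0}ep in sg H0 at2 sz2 *.
rewrite -[1%N]addn0 iotaDl big_map.
transitivity (\sum_(j <- iota 0 p.+1) \sum_(a <- undup gs) \sum_(b <- undup (rem a gs))
    \sum_(d <- undup (rem b (rem a gs)))
    \sum_(t <- permutations (rem d (rem b (rem a gs)))) F (insert_at j (a + c b + d) t)).
  apply: eq_big_seq => j; rewrite mem_iota => /andP[_ jp].
  rewrite (at2 j) ?(ltnW jp) //.
  apply: eq_big_seq => a; rewrite mem_undup => ain.
  apply: eq_big_seq => b; rewrite mem_undup => bin.
  rewrite (sum_perm_at (j := j)) ?sz2 //.
  apply: eq_big_seq => d; rewrite mem_undup => din.
  apply: eq_big_seq => t; rewrite mem_permutations => /perm_size.
  rewrite size_rem // sz2 //= => st.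
  have jt : (j <= size t)%N by rewrite st.
  have jt1 x : (j <= size (insert_at j x t))%N by rewrite size_insert_at leqW.
  have jt2 x y : (j <= size (insert_at j x (insert_at j y t)))%N.
    by rewrite size_insert_at leqW.
  by rewrite /contract !drop_insert // !take_insert.
rewrite exchange_big; apply: big1_seq => a /andP[_]; rewrite mem_undup => ain.
rewrite exchange_big; apply: big1_seq => b /andP[_]; rewrite mem_undup => bin.
rewrite exchange_big; apply: big1_seq => d /andP[_]; rewrite mem_undup => din.
have so : size (rem d (rem b (rem a gs))) = p by rewrite size_rem // sz2.
rewrite exchange_big -{1}so.
have := sum_perm_insert (a + c b + d) (rem d (rem b (rem a gs))) F.
rewrite H0 ?mul0rn; last by rewrite /= so.
by move=> E; exact: E.
Qed.

Lemma exists_max rank ps : ps != [::] -> {in ps &, injective rank} ->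
  exists2 m, m \in ps & {in ps, forall x, x != m -> rank x < rank m}.
Proof.
move=> ps0 inj; suff [m mps H] : exists2 m, m \in ps & {in ps, forall x, rank x <= rank m}.
  exists m => // x xps xm; rewrite lt_neqAle H // andbT.
  by apply: contra xm => /eqP /inj -> //.
elim: ps ps0 {inj} => // x [|y ps] IH _.
  by exists x; rewrite ?mem_head // => z; rewrite inE => /eqP ->.
have [//|m mps H] := IH; case: (leP (rank m) (rank x)) => xm.
  exists x; rewrite ?mem_head // => z; rewrite inE => /orP[/eqP -> //|/H h].
  exact: le_trans xm.
exists m; first by rewrite inE mps orbT.
by move=> z; rewrite inE => /orP[/eqP -> |/H //]; exact: ltW.
Qed.

(** An instruction of a particle outside [ps], of larger rank than [m], may hit [m]. Such a particle
    does not occur in the words considered, and muting it makes [m] safe from every instruction. *)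
Definition restrict_instr ps i := if who i \in ps then i else mute G (who i).

Lemma run_restrict ps L w : {subset unzip2 w <= ps} ->
  run (map (restrict_instr ps) L) w = run L w.
Proof.
elim: L w => //= i L IH w sub.
have -> : step (restrict_instr ps i) w = step i w.
  rewrite /restrict_instr; case: ifP => // nps; rewrite step_mute step_notin //.
  by apply/negP => /sub; rewrite nps.
by apply: IH => x /step_mem/sub.
Qed.

(* Once the killer of the particle [m] of maximal rank comes first, [m] either is the
   last particle and survives, or disappears at once with its right neighbour. *)
Theorem universality n : universal P G q n.
Proof.
elim/ltn_ind: n => n Un rank ps gs L k Ups inj szps szgs sL tL.
case: n => [|[|n]] in Un szps szgs *.
- case: ps gs szps szgs {Ups inj tL} => // -[] // _ _; rewrite big_seq1 q0.
  suff -> : run L [::] = [::] by rewrite /chi eq_sym subrr.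
  by elim: L {sL}.
- case: ps gs szps szgs {Ups inj tL} => // x [] // -[] // _ _; rewrite big_seq1 q1.
  suff -> : run L [:: (0, x)] = [:: (0, x)] by rewrite /chi eq_sym subrr.
  by elim: L {sL}.
have szp : size ps = (size gs).+1 by rewrite szps szgs.
have ps0 : ps != [::] by rewrite -size_eq0 szps.
have [m mps mmax] := exists_max ps0 inj.
pose L1 := map (restrict_instr ps) L.
have sL1 : sound rank L1.
  by apply: Forall_map sL => i hi x g; rewrite /restrict_instr; case: ifP => _ //= /hi.
have mL1 : shuns m L1.
  apply: Forall_map sL => i hi g; rewrite /restrict_instr; case: ifP => // wps.
  apply/negbTE/negP => /hi; apply/negP; rewrite -leNgt.
  by have [->//|wm] := eqVneq (who i) m; apply/ltW/mmax.
have tL1 : settling rank ps L1 by move=> w U sub; rewrite run_restrict //; exact: tL.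
have mk mu : sound rank [:: killer rank m mu] by [].
(* The program is taken twice: the first copy leaves a settled word, on which the killer and the
   second copy do nothing; the second copy makes the part behind the killer settling. *)
have [mu [Y [sY mY tY E]]] :=
  @advance_killer n.+2 rank ps gs k m Un Ups inj szps szgs mps mmax L1
    (fun _ g => g) L1 sL1 sL1 mL1 mL1 tL1.
have {}E : \sum_(w <- arr ps gs) chi R k (run L w) =
    \sum_(w <- arr ps gs) chi R k (run Y (step (killer rank m mu) w)).
  apply: etrans E; apply: eq_big_seq => w win.
  have pw := arr_labels szp win; have Uw : uniq (unzip2 w) by rewrite (perm_uniq pw).
  have sw : {subset unzip2 w <= ps} by move=> x; rewrite (perm_mem pw).
  rewrite run_cat [RHS](_ : _ = chi R k (run L1 w)) ?run_restrict //.
  rewrite (@run_settled rank) //; first exact: tL.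
set e := killer rank m mu in E.
rewrite sumrB E -sumrB sum_arr.
pose os := rem m ps.
have pos : perm_eq ps (m :: os) by exact: perm_to_rem.
have Um : uniq (m :: os) by rewrite -(perm_uniq pos).
have /andP[mos Uos] := Um.
have szos : size os = n.+1 by rewrite size_rem // szps.
have subos : {subset os <= ps} by move=> x; exact: mem_rem.
rewrite (perm_big _ (perm_permutations pos)) /=.
have := sum_perm_insert m os (fun s => \sum_(t <- permutations gs)
   (chi R k (run Y (step e (zip (0 :: t) s))) - q n.+2 k)).
have -> : count_mem m (m :: os) = 1%N.
  by rewrite count_uniq_mem // mem_head.
rewrite mulr1n => <-.
pose ql := if k is j.+1 then q n.+1 j else 0.
pose X j s t : R := chi R k (run Y (step e (zip (0 :: t) (insert_at j m s)))).
(* Positions of [m] other than the last: [m] vanishes with its right neighbour [r]. For each [r],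
   summing over the positions of [m] makes the contracted gaps uniformly arranged among the other
   particles. *)
have part1 : \sum_(s <- permutations os) \sum_(j <- iota 0 n.+1)
    \sum_(t <- permutations gs) (X j s t - q n k) = 0.
  pose F r t := \sum_(s <- permutations (rem r os)) (chi R k (run Y (zip (0 :: t) s)) - q n k).
  transitivity (\sum_(r <- undup os) \sum_(j <- iota 0 n.+1)
      \sum_(t <- permutations gs) F r (contract (mu r) j t)); last first.
    apply: big1_seq => r /andP[_]; rewrite mem_undup => ros.
    apply: sum_contract; first by rewrite szgs.
    move=> gs' szgs'; rewrite exchange_big.
    rewrite -[LHS](sum_arr (fun w => chi R k (run Y w) - q n k)).
    have szr : size (rem r os) = n by rewrite size_rem // szos.
    have subr : {subset rem r os <= ps} by move=> x /mem_rem/subos.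
    apply: (Un n _ rank) => //; first exact: rem_uniq.
      by move=> x y /subr xs /subr ys; exact: inj.
    exact: settling_sub tY.
  rewrite exchange_big [RHS]exchange_big; apply: eq_big_seq => j.
  rewrite mem_iota add0n => /andP[_ jn].
  rewrite (sum_perm_at (j := j)) ?szos //; apply: eq_big_seq => r.
  rewrite mem_undup => ros; rewrite exchange_big; apply: eq_big_seq => t.
  rewrite mem_permutations => /perm_size st; apply: eq_big_seq => s.
  rewrite mem_permutations => ps'; have ss : size s = n.
    by rewrite (perm_size ps') size_rem // szos.
  congr (_ - _); rewrite /X /chi; congr ((_ == _)%:R).
  rewrite {1}/insert_at take_insert ?drop_insert ?ss // size_step_killer ?ss //.
  - by apply: contra mos; rewrite (perm_mem ps') => /mem_rem.
  - by apply: mmax; [exact: subos|apply: contraNneq mos => <-].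
  by rewrite st szgs.
(* [m] in last position, where it adds one survivor. Once the value [a] of the gap in front of it is
   fixed, the rest is uniformly arranged. *)
have part2 : \sum_(s <- permutations os) \sum_(t <- permutations gs)
    (X n.+1 s t - ql) = 0.
  transitivity (\sum_(s <- permutations os) \sum_(a <- undup gs)
      \sum_(t <- permutations (rem a gs))
         (if k is j.+1 then chi R j (run Y (zip (0 :: t) s)) - q n.+1 j else 0)).
    apply: eq_big_seq => s; rewrite mem_permutations => ps'.
    rewrite (sum_perm_at (j := n)) ?szgs //; apply: eq_big_seq => a.
    rewrite mem_undup => ain; apply: eq_big_seq => t.
    rewrite mem_permutations => /perm_size; rewrite size_rem // szgs /= => st.
    have ss : size s = n.+1 by rewrite (perm_size ps').
    have ms : m \notin s by rewrite (perm_mem ps').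
    have mz : m \notin unzip2 (zip (0 :: t) s) by rewrite unzip2_zip //= st ss.
    rewrite /X /insert_at !take_oversize ?drop_oversize ?ss ?st //.
    rewrite -[0 :: t ++ _]/((0 :: t) ++ [:: a]) zip_cat /= ?st ?ss //.
    rewrite step_cat // step1; have [g' ->] := run_last a mY mz.
    rewrite /chi /ql size_cat addn1; case: (k) => [|j]; first by rewrite subr0.
    by rewrite eqSS.
  rewrite exchange_big; apply: big1_seq => a /andP[_]; rewrite mem_undup => ain.
  case: (k) => [|j]; first by rewrite big1 // => s _; rewrite big1.
  rewrite -[LHS](sum_arr (fun w => chi R j (run Y w) - q n.+1 j)).
  apply: (Un n.+1 _ rank) => //.
  - by move=> x y /subos xs /subos ys; exact: inj.
  - by rewrite size_rem // szgs.
  exact: settling_sub tY.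
transitivity (\sum_(s <- permutations os) (\sum_(j <- iota 0 n.+1)
    \sum_(t <- permutations gs) (X j s t - q n k) +
    \sum_(t <- permutations gs) (X n.+1 s t - ql))); last first.
  by rewrite big_split /= part1 part2 addr0.
apply: eq_bigr => s _; rewrite szos.
have -> : iota 0 n.+2 = iota 0 n.+1 ++ [:: n.+1].
  by have := iotaD 0 n.+1 1; rewrite addn1.
rewrite big_cat big_seq1; pose N : R := (size (permutations gs))%:R.
have sumX (x : seq G -> R) c : \sum_(t <- permutations gs) (x t - c) =
    \sum_(t <- permutations gs) x t - c * N.
  by rewrite sumrB big_const_seq count_predT iter_addr_0 mulr_natr.
have sumj c : \sum_(j <- iota 0 n.+1) \sum_(t <- permutations gs) (X j s t - c) =
    \sum_(j <- iota 0 n.+1) \sum_(t <- permutations gs) X j s t - c * N * n.+1%:R.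
  under eq_bigr do rewrite sumX.
  by rewrite sumrB big_const_seq count_predT size_iota iter_addr_0 mulr_natr.
rewrite -/(X _ _ _) [LHS](_ : _ = \sum_(j <- iota 0 n.+1)
   \sum_(t <- permutations gs) (X j s t - q n.+2 k) +
   \sum_(t <- permutations gs) (X n.+1 s t - q n.+2 k)) // !sumj !sumX.
(* The recursion multiplied by the number [n.+2] of positions of [m]: [n.+1] of them lead to
   [q n k], the last one to [ql]. *)
have hq : q n.+2 k * (n.+1%:R + 1) = q n k * n.+1%:R + ql.
  have n2 : n.+1%:R + 1 != 0 :> R by rewrite natr1 pnatr_eq0.
  have e2 : n.+2%:R = n.+1%:R + 1 :> R by rewrite natr1.
  rewrite qS -/ql e2; move: (n.+1%:R) n2 => z n2; by field.
apply/eqP; rewrite -subr_eq0.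
set a := \sum_(j <- _) _; set b := \sum_(t <- _) _.
have -> : a - q n.+2 k * N * n.+1%:R + (b - q n.+2 k * N) -
   (a - q n k * N * n.+1%:R + (b - ql * N)) =
   N * ((q n k * n.+1%:R + ql) - q n.+2 k * (n.+1%:R + 1)) by ring.
by rewrite hq subrr mulr0.
Qed.

End Universality.

Local Open Scope classical_set_scope.
Local Open Scope ring_scope.

(** * Greedy removal of colliding pairs *)

Section Greedy.
Variables (R : realType) (n : nat) (CT : 'I_n -> 'I_n -> \bar R).
Implicit Types (S : {set 'I_n}) (i j k : 'I_n).
Hypothesis CTC : forall i j, i != j -> CT i j = CT j i.
Hypothesis CTN : forall i j, CT i j != -oo%E.
Hypothesis CTgen : forall i j k, i != j -> i != k -> j != k ->
  CT i j \is a fin_num -> CT i j != CT i k.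

Lemma first_collision_le S i j : i \in S -> j \in S -> i != j ->
  (first_collision CT S <= CT i j)%E.
Proof.
move=> iS jS ij; apply: le_trans (bigmin_le_cond _ _ iS) _.
by apply: bigmin_le_cond; rewrite jS ij.
Qed.

Lemma bigmin_attained (I : finType) (Q : pred I) (F : I -> \bar R) :
  \big[Order.min/+oo%E]_(i | Q i) F i = +oo%E \/
  exists2 i, Q i & \big[Order.min/+oo%E]_(i | Q i) F i = F i.
Proof.
elim/big_rec: _ => [|i x Qi [->|[j Qj ->]]]; first by left.
  by right; exists i => //; rewrite miney.
by right; case: (leP (F i) (F j)) => _; [exists i|exists j].
Qed.

Lemma first_collision_attained S : (first_collision CT S < +oo)%E ->
  exists i j, [/\ i \in S, j \in S, i != j & CT i j = first_collision CT S].
Proof.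
rewrite /first_collision.
set F := fun i => \big[Order.min/+oo%E]_(j in S | i != j) CT i j.
case: (bigmin_attained (mem S) F) => [->//|[i iS ->]]; rewrite /F.
case: (bigmin_attained (fun j => (j \in S) && (i != j)) (CT i)) => [->//|].
move=> [j /andP[jS ij] ->] _.
by exists i, j.
Qed.

Lemma first_collision_mono S S' : S' \subset S ->
  (first_collision CT S <= first_collision CT S')%E.
Proof.
move=> /fintype.subsetP sub.
have [->|] := eqVneq (first_collision CT S') +oo%E; first exact: leey.
rewrite -ltey => /first_collision_attained[a [b [/sub aS /sub bS ab <-]]].
exact: first_collision_le.
Qed.

Lemma collision_step_sub S : collision_step CT S \subset S.
Proof. by rewrite /collision_step; case: ifP => // _; exact: subsetDl. Qed.

Lemma iter_collision_fixed m S : (#|S| <= m)%N ->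
  collision_step CT (iter m (collision_step CT) S) = iter m (collision_step CT) S.
Proof.
elim: m S => [|m IH] S.
  rewrite leqn0 cards_eq0 => /eqP -> /=; apply/eqP; rewrite -finset.subset0.
  exact: collision_step_sub.
move=> Sm; rewrite iterSr; have [e|ne] := eqVneq (collision_step CT S) S.
  by rewrite e !iter_fix.
apply: IH; rewrite -ltnS; apply: leq_trans Sm; apply: proper_card.
by rewrite finset.properEneq ne collision_step_sub.
Qed.

Definition remaining S := iter n (collision_step CT) S.

Lemma remaining_step S : remaining (collision_step CT S) = remaining S.
Proof.
rewrite /remaining -iterSr /= iter_collision_fixed //.
by rewrite -[X in (_ <= X)%N]card_ord max_card.
Qed.

Lemma remaining_stable S : (forall i j, i \in S -> j \in S -> i != j -> CT i j = +oo%E) ->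
  remaining S = S.
Proof.
move=> H; suff E : collision_step CT S = S by rewrite /remaining iter_fix.
rewrite /collision_step; case: ifP => // fS.
have [|i [j [iS jS ij E]]] := @first_collision_attained S.
  by move: fS; rewrite fin_numE => /andP[_]; rewrite lt_neqAle leey andbT.
by rewrite -E H in fS.
Qed.

Lemma fin_first_collision S : (first_collision CT S < +oo)%E ->
  first_collision CT S \is a fin_num.
Proof.
move=> h; have [i [j [_ _ _ E]]] := first_collision_attained h.
by rewrite fin_numE -{1}E CTN /= -ltey.
Qed.

(** A step removes all pairs of minimal time together. By genericity they are disjoint, so one of
    them may be removed beforehand: either others share its time and the next step removes them, or
    the step removes this pair only. *)
Lemma remaining_min S i j : i \in S -> j \in S -> i != j ->
  CT i j = first_collision CT S -> CT i j \is a fin_num ->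
  remaining S = remaining (S :\: [set i; j]%SET)%SET.
Proof.
move=> iS jS ij E f; set S' := (_ :\: _)%SET.
have inS' k : (k \in S') = [&& k != i, k != j & k \in S].
  by rewrite !inE negb_or andbA.
have fS : first_collision CT S \is a fin_num by rewrite -E.
have nij k l : k != i -> k != j -> CT k l = first_collision CT S -> k != l ->
    (l != i) && (l != j).
  move=> ki kj e kl; apply/andP; split; apply: contra_eq_neq e => ->; rewrite -E.
    by rewrite CTC // eq_sym; apply: CTgen => //; rewrite eq_sym.
  rewrite (CTC kj) (CTC ij) eq_sym; apply: CTgen; rewrite 1?eq_sym //.
  by rewrite -CTC.
have [e|ne] := eqVneq (first_collision CT S') (first_collision CT S).
  rewrite -(remaining_step S) -(remaining_step S'); congr remaining.
  rewrite /collision_step e fS; apply/setP => k; rewrite !inE.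
  have [->|ki] := eqVneq k i.
    rewrite iS /= andbT; apply/negbTE; rewrite negbK.
    by apply/exists_inP; exists j; rewrite // ij E eqxx.
  have [->|kj] := eqVneq k j.
    rewrite jS orbT /= andbT; apply/negbTE; rewrite negbK.
    by apply/exists_inP; exists i; rewrite // eq_sym ij -CTC // E eqxx.
  rewrite /=; case kS : (k \in S) => //=; rewrite !andbT; congr (~~ _).
  apply/exists_inP/exists_inP => -[l lS /andP[kl /eqP c]]; exists l.
  - by have := nij k l ki kj c kl; rewrite inS' lS andbT.
  - by rewrite kl c eqxx.
  - by move: lS; rewrite inS' => /and3P[].
  - by rewrite kl c eqxx.
rewrite -(remaining_step S); congr remaining; rewrite /collision_step fS.
apply/setP => k; rewrite inS' !inE; case kS : (k \in S) => /=; last by rewrite !andbF.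
rewrite !andbT; apply/idP/andP => [nk|[ki kj]].
  split; apply: contraNneq nk => ->; apply/exists_inP.
    by exists j; rewrite // ij E eqxx.
  by exists i; rewrite // eq_sym ij -CTC // E eqxx.
apply/negP => /exists_inP[l lS /andP[kl /eqP c]]; case/negP: ne.
have := nij k l ki kj c kl => /andP[li lj].
rewrite eq_le; apply/andP; split; last exact: first_collision_mono (subsetDl _ _).
by rewrite -c; apply: first_collision_le; rewrite ?inS' ?ki ?kj ?li ?lj.
Qed.

Definition first_pair S i j := [/\ i \in S, j \in S, i != j, CT i j \is a fin_num &
  forall k, k \in S -> k != i -> k != j -> (CT i j <= CT i k)%E /\ (CT i j <= CT j k)%E].

Lemma first_pair_sub S S' i j : S' \subset S -> i \in S' -> j \in S' ->
  first_pair S i j -> first_pair S' i j.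
Proof.
move=> /fintype.subsetP sub iS' jS' [iS jS ij f H]; split=> // k /sub kS ki kj.
exact: H.
Qed.

(** By induction on the number of bullets. A pair of globally minimal time is either [{a, b}] or
    disjoint from it, since a shared bullet would collide with two others at the same instant; in
    the latter case it is removed on both sides. *)
Lemma remaining_first_pair S a b : first_pair S a b ->
  remaining S = remaining (S :\: [set a; b]%SET)%SET.
Proof.
have [N] := ubnP #|S|; elim: N S => // N IH S; rewrite ltnS => SN.
move=> [aS bS ab f H].
have lt : (first_collision CT S < +oo)%E.
  apply: le_lt_trans (first_collision_le aS bS ab) _.
  by rewrite ltey; move: (f); rewrite fin_numE => /andP[].
have [i [j [iS jS ij E]]] := first_collision_attained lt.
have fij : CT i j \is a fin_num by rewrite E fin_first_collision.
have lea k l : k \in S -> l \in S -> k != l -> (CT i j <= CT k l)%E.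
  by move=> kS lS kl; rewrite E first_collision_le.
have ba : b != a by rewrite eq_sym.
have far k : k \in S -> k != a -> k != b -> CT a k != CT i j /\ CT b k != CT i j.
  move=> kS ka kb; have [Ha Hb] := H k kS ka kb; split; apply/eqP => e.
    suff : CT a b != CT a k by rewrite eq_le Ha e lea.
    by apply: CTgen => //; rewrite eq_sym.
  suff : CT b a != CT b k by rewrite (CTC ba) eq_le Hb e lea.
  by apply: CTgen; rewrite 1?eq_sym // (CTC ba).
have disj : [set i; j]%SET = [set a; b]%SET \/ [&& i != a, i != b, j != a & j != b].
  have [ia|nia] := eqVneq i a.
    left; have [->|njb] := eqVneq j b; first by rewrite ia.
    have ja : j != a by rewrite -ia eq_sym.
    by have [+ _] := far j jS ja njb; rewrite -ia eqxx.
  have [ib|nib] := eqVneq i b.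
    left; have [->|nja] := eqVneq j a; first by rewrite ib finset.setUC.
    have jb : j != b by rewrite -ib eq_sym.
    by have [_ +] := far j jS nja jb; rewrite -ib eqxx.
  right; have [Ha Hb] := far i iS nia nib; rewrite /=; apply/andP; split.
    by apply: contraNneq Ha => ja; rewrite -ja CTC // eq_sym.
  by apply: contraNneq Hb => jb; rewrite -jb CTC // eq_sym.
rewrite (remaining_min iS jS ij E fij); case: disj => [->//|/and4P[ia ib ja jb]].
have sub1 := subsetDl S [set i; j]%SET; have sub2 := subsetDl S [set a; b]%SET.
rewrite IH; first last.
- apply: (first_pair_sub sub1) => //.
    by rewrite !inE negb_or aS !(eq_sym a) ia ja.
  by rewrite !inE negb_or bS !(eq_sym b) ib jb.
- apply: leq_trans SN; apply: proper_card; apply/properP; split=> //.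
  by exists i => //; rewrite !inE eqxx.
rewrite [RHS](@remaining_min _ i j) //; first last.
- apply/eqP; rewrite eq_le {1}E first_collision_mono //=.
  by apply: first_collision_le => //; rewrite !inE negb_or ?ia ?ib ?ja ?jb.
- by rewrite !inE negb_or ja jb.
- by rewrite !inE negb_or ia ib.
by congr remaining; rewrite !finset.setDDl finset.setUC.
Qed.

End Greedy.

(** * Sorting every word by repeated sweeps *)

Section Sweep.
Variables (P : eqType) (G : nmodType) (R : realFieldType) (rank : P -> R).
Implicit Types (w : seq (G * P)) (ps : seq P).

(* Repeated sweeps turn any program into a settling one; they do nothing after a
   program that has already run through all the collisions. *)
Definition sweep ps : seq (instr P G) := [seq killer rank p (fun _ g => g) | p <- ps].

Lemma step_size (i : instr P G) w : step i w = w \/ (size (step i w) < size w)%N.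
Proof.
elim: w => [|a [|b w] IH]; try by left.
have [e|ne] := eqVneq a.2 (who i); last first.
  by rewrite step_neq //; case: IH => [->|?]; [left|right].
rewrite step_eq //; case: ifP => _; last by left.
by right; rewrite size_addhead /= ltnW.
Qed.

Lemma run_size (L : seq (instr P G)) w : (size (run L w) <= size w)%N.
Proof.
elim: L w => //= i L IH w; apply: leq_trans (IH _) _.
by case: (step_size i w) => [->|/ltnW].
Qed.

Lemma sweep_fixed ps w : size (run (sweep ps) w) = size w ->
  {in ps, forall p, step (killer rank p (fun _ g => g)) w = w}.
Proof.
elim: ps w => //= p ps IH w; case: (step_size (killer rank p (fun _ g => g)) w) => [E|lt] sz.
  by rewrite E in sz => x; rewrite inE => /predU1P[->//|]; apply: IH.
by move: (run_size (sweep ps) (step (killer rank p (fun _ g => g)) w)); rewrite sz leqNgt lt.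
Qed.

Lemma fixed_settled w : uniq (unzip2 w) ->
  {in unzip2 w, forall p, step (killer rank p (fun _ g => g)) w = w} -> settled rank w.
Proof.
rewrite /settled; elim: w => // a [//|b w] IH /= /andP[nin U] H.
apply/andP; split.
  have := H a.2 (mem_head _ _); rewrite step_eq //=; case: ltP => // _ /(congr1 size).
  by rewrite size_addhead => /eqP; rewrite ltn_eqF //= ltnW.
apply: IH => // p pin; have := H p; rewrite inE pin orbT => /(_ isT).
by rewrite step_neq => [[]//|]; apply: contraNneq nin => /= ->.
Qed.

Lemma sound_sweep ps : sound rank (sweep ps).
Proof. by elim: ps => //= p ps IH; split. Qed.

Lemma sound_cat (L1 L2 : seq (instr P G)) :
  sound rank L1 -> sound rank L2 -> sound rank (L1 ++ L2).
Proof. by move=> s1 s2; apply/Forall_cat. Qed.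

Lemma sound_sweeps ps m : sound rank (flatten (nseq m (sweep ps))).
Proof. by elim: m => //= m IH; apply: sound_cat => //; apply: sound_sweep. Qed.

(** A sweep either shortens the word or leaves it fixed by every killer, hence settled; [size ps]
    sweeps are thus enough. *)
Lemma settling_sweeps ps : settling rank ps (flatten (nseq (size ps) (sweep ps))).
Proof.
move=> w U sub; have sz : (size w <= size ps)%N.
  by rewrite -(size_map snd); apply: uniq_leq_size.
elim: (size ps) w U sub sz => [|m IH] w U sub /=.
  by rewrite leqn0 => /nilP ->.
move=> sz; rewrite run_cat; have [e|ne] := eqVneq (size (run (sweep ps) w)) (size w).
  have st : settled rank w.
    by apply: fixed_settled => // p /sub; apply: sweep_fixed.
  by rewrite !(run_settled st) //; [exact: sound_sweeps|exact: sound_sweep].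
apply: IH; [exact: run_uniq|by move=> x /run_mem/sub|].
by rewrite -ltnS; apply: leq_trans sz; rewrite ltn_neqAle ne run_size.
Qed.

End Sweep.

(** * From bullets to words *)

Section Bridge.
Variables (R : realType) (n : nat) (v t : 'I_n -> R).
Hypothesis v0 : forall i, 0 <= v i.
Hypothesis vI : injective v.
Hypothesis tS : forall i j : 'I_n, (i < j)%N -> t i < t j.
Implicit Types (i j k a b : 'I_n) (s : seq 'I_n) (T x c : R).

Definition meets i j T := [/\ t i <= T, t j <= T & v i * (T - t i) = v j * (T - t j)].

Hypothesis noTriple : forall i j k T, (i < j)%N -> (j < k)%N ->
  meets i j T -> meets j k T -> False.

Local Notation CT := (virtual_CT v t).

Lemma meetsC i j T : meets i j T -> meets j i T. Proof. by case. Qed.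

Lemma virtual_CTP i j T : i != j -> (CT i j = T%:E <-> meets i j T).
Proof.
move=> ij; have vij : v i - v j != 0.
  by rewrite subr_eq0; apply: contra_neq ij => /vI.
have cE : v i * (T - t i) = v j * (T - t j) <-> crossing_time v t i j = T.
  rewrite /crossing_time; split=> [e|<-]; last by field.
  by apply: (mulIf vij); rewrite divfK //; lra.
rewrite /virtual_CT ge_max; split.
  case: ifP => // /andP[ti tj] [e]; rewrite e in ti tj; split=> //.
  exact/cE.
by case=> ti tj /cE ->; rewrite ti tj.
Qed.

Lemma virtual_CTC i j : i != j -> CT i j = CT j i.
Proof.
move=> ij; rewrite /virtual_CT maxC.
suff -> : crossing_time v t i j = crossing_time v t j i by [].
by rewrite /crossing_time -opprB -(opprB (v j)) invrN mulrNN.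
Qed.

Lemma virtual_CT_Ny i j : CT i j != -oo%E.
Proof. by rewrite /virtual_CT; case: ifP. Qed.

Lemma meets_trans i j k T : meets i j T -> meets i k T -> meets j k T.
Proof. by case=> ? ? e [? ? e']; split=> //; rewrite -e -e'. Qed.

Lemma no_triple i j k T : i != j -> i != k -> j != k ->
  meets i j T -> meets i k T -> False.
Proof.
move=> ij ik jk mij mik; have mjk := meets_trans mij mik.
have lt (a b : 'I_n) : a != b -> (a < b)%N \/ (b < a)%N.
  by rewrite -val_eqE /= neq_ltn => /orP.
case: (lt _ _ ij) (lt _ _ ik) (lt _ _ jk) => l1 [] l2 [] l3.
- exact: noTriple l1 l3 mij mjk.
- exact: noTriple l2 l3 mik (meetsC mjk).
- by move: (ltn_trans l2 (ltn_trans l1 l3)); rewrite ltnn.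
- exact: noTriple l2 l1 (meetsC mik) mij.
- exact: noTriple l1 l2 (meetsC mij) mik.
- by move: (ltn_trans l2 (ltn_trans l3 l1)); rewrite ltnn.
- exact: noTriple l3 l2 mjk (meetsC mik).
- exact: noTriple l3 l1 (meetsC mjk) (meetsC mij).
Qed.

Lemma virtual_CT_gen i j k : i != j -> i != k -> j != k ->
  CT i j \is a fin_num -> CT i j != CT i k.
Proof.
move=> ij ik jk /fineK E; apply/eqP => e; apply: (no_triple ij ik jk).
  by apply/(virtual_CTP _ ij); rewrite -E.
by apply/(virtual_CTP _ ik); rewrite -e -E.
Qed.

Lemma meets_faster i j T : (i < j)%N -> meets i j T -> v i < v j.
Proof.
move=> ij [ti tj e]; have tij := tS ij; rewrite lt_neqAle; apply/andP; split.
  by apply/eqP => /vI E; rewrite E ltnn in ij.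
rewrite leNgt; apply/negP => vij; have := v0 j.
nra.
Qed.

Lemma faster_meets i j : (i < j)%N -> v i < v j ->
  meets i j (t j + v i * (t j - t i) / (v j - v i)).
Proof.
move=> ij vij; have tij := tS ij.
have d0 : 0 <= v i * (t j - t i) / (v j - v i).
  by rewrite divr_ge0 ?mulr_ge0 ?v0 // subr_ge0 ltW.
split; [lra|lra|].
by field; rewrite subr_eq0 gt_eqF.
Qed.

(* A bullet of speed [p] is caught by one of speed [r] shot a time [g] later at
   distance [p * r * g / (r - p)] from the origin. *)
Definition overtake (x p : R) : instr R R :=
  Instr p (fun r g => (p < r) && (p * r * g == x * (r - p))) (fun _ g => g).

Lemma overtakeP x i j : (i < j)%N -> reflect
  (exists2 T, meets i j T & v i * (T - t i) = x)
  (hits (overtake x (v i)) (v j) (t j - t i)).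
Proof.
move=> ij; apply: (iffP andP) => [[vij /eqP e]|[T m Tx]].
  exists (t j + v i * (t j - t i) / (v j - v i)); first exact: faster_meets.
  have d : v j - v i != 0 by rewrite subr_eq0 gt_eqF.
  apply: (mulIf d); rewrite -e; field; exact: d.
split; first exact: meets_faster m.
case: m => _ _; rewrite Tx => e; apply/eqP.
have e1 : x * v j = v i * (T - t i) * v j by rewrite Tx.
have e2 : x * v i = v j * (T - t j) * v i by rewrite -e.
by rewrite (mulrBr x) e1 e2; ring.
Qed.

(** The gaps are the delays between successive shots. The origin [c] of the first one is a parameter
    so that a tail of such a word has again this form. *)
Definition wordof c s : seq (R * R) :=
  zip (pairmap (fun p r : R => r - p) c (map t s)) (map v s).

Lemma size_wordof c s : size (wordof c s) = size s.
Proof. by rewrite size_zip size_pairmap !size_map minnn. Qed.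

Lemma addhead_wordof c d s : addhead (d - c) (wordof d s) = wordof c s.
Proof. by case: s => //= i s; rewrite /wordof /= addrC addrA subrK. Qed.

Lemma labels_wordof c s : unzip2 (wordof c s) = map v s.
Proof. by apply: unzip2_zip; rewrite size_pairmap !size_map. Qed.

(** When [fuse] is the identity, the three gaps around a removed pair add up to the delay between
    its two neighbours, so the word stays that of the remaining bullets. *)
Lemma step_wordof (e : instr R R) c s : uniq s -> (forall r g, fuse e r g = g) ->
  (step e (wordof c s) = wordof c s /\ forall l i j r, s = l ++ [:: i, j & r] ->
     v i = who e -> hits e (v j) (t j - t i) = false) \/
  (exists l i j r, [/\ s = l ++ [:: i, j & r], v i = who e,
     hits e (v j) (t j - t i) & step e (wordof c s) = wordof c (l ++ r)]).
Proof.
move=> + fe; elim: s c => [|a [|b s] IH] c.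
- by left; split=> // -[].
- by left; split=> // -[|? []].
move=> /andP[nin U].
have -> : wordof c [:: a, b & s] = (t a - c, v a) :: wordof (t a) (b :: s) by [].
have [e1|ne] := eqVneq (v a) (who e).
  rewrite {1 2}/wordof /= -/(wordof _ _) step_eq //= fe; case: ifP => h.
    right; exists [::], a, b, s; split=> //.
    have -> : t a - c + (t b - t a) = t b - c by ring.
    exact: addhead_wordof.
  left; split=> // -[|a' l] i j r /= [].
    by move=> <- <-.
  move=> _ es; rewrite -e1 => /vI ia; move: nin.
  by rewrite es ia mem_cat inE eqxx orbT.
rewrite step_neq //; case: (IH (t a) U) => [[-> H]|[l [i [j [r [es vi h E]]]]]].
  left; split=> // -[|a' l] i j r /= [].
    by move=> <- _ _ e1; rewrite e1 eqxx in ne.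
  by move=> _; apply: H.
right; exists (a :: l), i, j, r; split=> //; first by rewrite es.
by rewrite E.
Qed.

Definition above x s := forall i j T, i \in s -> j \in s -> i != j -> meets i j T ->
  x <= v i * (T - t i).

(* At the lowest height of a crossing, the pair that crosses there is first, and
   its members are adjacent in the order of the shots. *)
Lemma meets_first s i j T : above (v i * (T - t i)) s -> (i < j)%N ->
  i \in s -> j \in s -> (forall k, k \in s -> (k <= i)%N \/ (j <= k)%N) ->
  meets i j T -> first_pair CT [set k in s]%SET i j.
Proof.
move=> ab ij iS jS adj m; have nij : i != j by rewrite -val_eqE /= ltn_eqF.
have E : CT i j = T%:E by apply/virtual_CTP.
have vij := meets_faster ij m; have [ti tj e] := m.
rewrite /first_pair !inE E; split=> // k; rewrite inE => kS ki kj.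
have fin a : a != k -> (CT a k = +oo)%E \/ exists2 T', CT a k = T'%:E & meets a k T'.
  move=> ak; case E' : (CT a k) => [T'| |]; [right|by left|].
    by exists T' => //; apply/virtual_CTP.
  by have := virtual_CT_Ny a k; rewrite E'.
have vj0 : 0 < v j by apply: le_lt_trans vij.
split.
  case: (fin i) => [|->|[T' -> m']]; [by rewrite eq_sym|exact: leey|].
  have := ab _ _ _ iS kS _ m'; rewrite eq_sym => /(_ ki).
  (* A bullet at rest meets others only at height 0, which says nothing of the instants. But it
     meets [j] when [j] is shot, bullets shot after [j] come later, and those shot before [i] would
     have to be slower. *)
  have [vi0|vi0] := eqVneq (v i) 0.
    have Tj : T = t j.
      by apply/eqP; rewrite -subr_eq0 -(mulrI_eq0 _ (lregP (lt0r_neq0 vj0))) -e vi0 mul0r.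
    case: (adj k kS) => [ki'|jk].
      have lt : (k < i)%N by rewrite ltn_neqAle ki' -val_eqE andbT in ki *.
      move=> _; have := meets_faster lt (meetsC m').
      by rewrite vi0 ltNge v0.
    have lt : (j < k)%N by rewrite ltn_neqAle jk -val_eqE eq_sym andbT in kj *.
    move=> _; rewrite lee_fin Tj; case: m' => _ tk _; apply: le_trans tk.
    exact/ltW/tS.
  have vip : 0 < v i by rewrite lt_neqAle eq_sym vi0 v0.
  by rewrite ler_pM2l // lerBlDr subrK lee_fin.
case: (fin j) => [|->|[T' -> m']]; [by rewrite eq_sym|exact: leey|].
have := ab _ _ _ jS kS _ m'; rewrite eq_sym => /(_ kj).
by rewrite e ler_pM2l // lerBlDr subrK lee_fin.
Qed.

(* A bullet k shot between i and j would be crossed by one of them at a lower height;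
   the only exception is a bullet i that stays at the origin, which k hits at once. *)
Lemma meets_between s i j k T : above (v i * (T - t i)) s ->
  i \in s -> j \in s -> k \in s -> (i < k)%N -> (k < j)%N -> meets i j T ->
  exists2 T', meets i k T' & v i * (T' - t i) = v i * (T - t i).
Proof.
move=> ab iS jS kS ik kj m; have [ti tj e] := m.
have ij := ltn_trans ik kj; have tik := tS ik; have tkj := tS kj.
have vij := meets_faster ij m; have vi0 := v0 i.
have nik : i != k by rewrite -val_eqE /= ltn_eqF.
have njk : j != k by rewrite -val_eqE /= gtn_eqF.
have nij : i != j by rewrite -val_eqE /= ltn_eqF.
(* Virtual position of [k] at time [T]: below the meeting point, [j] has overtaken it at a smaller
   height; above it, [k] has overtaken [i] no higher than there; at the same place, there is a
   triple point. *)
have [e'|lt|gt] := ltgtP (v k * (T - t k)) (v i * (T - t i)).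
- exfalso; have vkj : v k < v j by nra.
  have m' := faster_meets kj vkj; have := ab _ _ _ kS jS _ m'.
  rewrite eq_sym => /(_ njk); move: m' => [_ _ e2].
  rewrite e2 e ler_pM2l ?(le_lt_trans _ vij) //; move: e2.
  move: (t j + _) => T' e2; nra.
- have vik : v i < v k by nra.
  have m' := faster_meets ik vik; have := ab _ _ _ iS kS nik m'.
  move: (t k + _) m' => T' m' le; exists T' => //; have [_ _ e2] := m'.
  apply/eqP; rewrite eq_le le andbT; nra.
- exfalso; apply: (no_triple nij nik njk m); split=> //; lra.
Qed.

Local Notation shot_before := (fun i j : 'I_n => (i < j)%N).

(** When the instruction removes a pair, [meets_first] shows that the true dynamics may remove it as
    well. When it does nothing, the bullet of speed [p] meets no later bullet at height [x]:
    otherwise [meets_between] would make it meet its right neighbour at that height. *)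
Lemma overtake_step x p c s : sorted shot_before s -> above x s ->
  exists s', [/\ step (overtake x p) (wordof c s) = wordof c s', subseq s' s,
    remaining CT [set k in s]%SET = remaining CT [set k in s']%SET &
    forall i j T, i \in s' -> j \in s' -> (i < j)%N -> v i = p -> meets i j T ->
      v i * (T - t i) <> x].
Proof.
move=> so ab; have tr : transitive shot_before by move=> ? ? ?; exact: ltn_trans.
have U : uniq s by apply: sorted_uniq so => // i; exact: ltnn.
case: (@step_wordof (overtake x p) c s U _) => // [[E H]|[l [i [j [r [es vi h E]]]]]].
  exists s; split=> // i j T iS jS ij vi m Tx.
  case/splitPr: iS so U ab H E jS => l r so U ab H E jS.
  have jr : j \in r.
    move: jS; rewrite mem_cat inE => /or3P[jl|/eqP e|//].
      move: so; rewrite sorted_pairwise // pairwise_cat.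
      move=> /and3P[/allrelP/(_ _ _ jl (mem_head _ _))].
      by rewrite ltnNge ltnW.
    by rewrite e ltnn in ij.
  case: r jr so U ab H E jS => // k r jr so U ab H E jS.
  have ik : (i < k)%N.
    by move: so; rewrite sorted_pairwise // pairwise_cat /= => /and5P[_ _ /andP[]].
  suff [T' m' T'x] : exists2 T', meets i k T' & v i * (T' - t i) = x.
    have := H l i k r (erefl _) vi; rewrite -vi.
    by move/negbT => /overtakeP-/(_ ik)[]; exists T'.
  have [kj|jk] := eqVneq j k; first by exists T; rewrite -?kj.
  have kj : (k < j)%N.
    move: so jr; rewrite sorted_pairwise // pairwise_cat /= inE (negPf jk) /=.
    by move=> /and5P[_ _ _ /allP H' _] /H'.
  rewrite -Tx; apply: (@meets_between (l ++ [:: i, k & r]) i j k T _ _ _ _ ik kj m); rewrite ?Tx //.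
  - by rewrite mem_cat mem_head orbT.
  - by rewrite mem_cat !inE eqxx !orbT.
have lt_adj : (i < j)%N.
  by move: so; rewrite es sorted_pairwise // pairwise_cat /= => /and5P[_ _ /andP[]].
move: U; rewrite es cat_uniq => /and3P[_ /hasPn nl /and3P[ir jr _]].
have inil : i \notin l ++ r.
  rewrite mem_cat negb_or (nl i (mem_head _ _)) /=.
  by move: ir; rewrite inE negb_or => /andP[].
have injl : j \notin l ++ r.
  by rewrite mem_cat negb_or jr andbT; apply: nl; rewrite !inE eqxx orbT.
exists (l ++ r); split=> //.
- by rewrite -es.
- by apply: cat_subseq => //; exact: (suffix_subseq [:: i; j]).
- move: vi h => /= <- h; have [T m Tx] := overtakeP _ lt_adj h.
  rewrite (@remaining_first_pair _ _ CT virtual_CTC virtual_CT_Ny virtual_CT_gen _ i j).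
    congr remaining; apply/setP => k; rewrite !inE !mem_cat !inE negb_or.
    have [->|] := eqVneq k i; first by move: inil; rewrite mem_cat => /negPf ->.
    by have [->|] := eqVneq k j; first by move: injl; rewrite mem_cat => /negPf ->.
  apply: (@meets_first _ i j T) => //; rewrite ?Tx -?es // ?es ?mem_cat ?inE ?eqxx ?orbT //.
  move=> k; rewrite mem_cat !inE => /or4P[kl|/eqP->|/eqP->|kr]; [left|by left|by right|right].
    move: so; rewrite es sorted_pairwise // pairwise_cat.
    move=> /and3P[/allrelP/(_ _ _ kl (mem_head _ _))].
    by move/ltnW.
  move: so; rewrite es sorted_pairwise // pairwise_cat /= => /and5P[_ _ _ /allP/(_ _ kr)].
  by move/ltnW.
- move=> a b T ain _ _ va; move: inil; have -> : i = a by apply: vI; rewrite vi va.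
  by rewrite ain.
Qed.

Lemma subset_above x s s' : {subset s' <= s} -> above x s -> above x s'.
Proof. by move=> sub ab i j T /sub iS /sub jS; apply: ab. Qed.

Lemma sorted_sub s s' : subseq s' s -> sorted shot_before s -> sorted shot_before s'.
Proof. by apply: subseq_sorted => ? ? ?; exact: ltn_trans. Qed.

Lemma overtake_steps x ps c s : sorted shot_before s -> above x s ->
  exists s', [/\ run (map (overtake x) ps) (wordof c s) = wordof c s', subseq s' s,
    remaining CT [set k in s]%SET = remaining CT [set k in s']%SET &
    forall i j T, i \in s' -> j \in s' -> (i < j)%N -> v i \in ps -> meets i j T ->
      v i * (T - t i) <> x].
Proof.
elim: ps s => [|p ps IH] s so ab; first by exists s.
have [s1 [E1 sub1 r1 H1]] := overtake_step p c so ab.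
have [s2 [E2 sub2 r2 H2]] :=
  IH s1 (sorted_sub sub1 so) (subset_above (mem_subseq sub1) ab).
exists s2; split; [by rewrite /= E1|exact: subseq_trans sub1|by rewrite r1|].
move=> i j T i2 j2 ij; rewrite inE => /predU1P[vi|]; last exact: H2.
by apply: H1; rewrite ?(mem_subseq sub2).
Qed.

Lemma overtake_all ps xs c s : sorted shot_before s -> sorted <%R xs ->
  (forall i, i \in s -> v i \in ps) ->
  (forall i j T, i \in s -> j \in s -> (i < j)%N -> meets i j T ->
     v i * (T - t i) \in xs) ->
  exists s', [/\ run (flatten [seq map (overtake x) ps | x <- xs]) (wordof c s) = wordof c s',
    subseq s' s, remaining CT [set k in s]%SET = [set k in s']%SET &
    forall i j T, i \in s' -> j \in s' -> (i < j)%N -> ~ meets i j T].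
Proof.
elim: xs s => [|x xs IH] s so xso sps mem.
  exists s; split=> // [|i j T iS jS ij m]; last by have := mem i j T iS jS ij m.
  apply: remaining_stable => i j; rewrite !inE => iS jS ij.
  case E : (CT i j) => [T| |] //; last by have := virtual_CT_Ny i j; rewrite E.
  have /(virtual_CTP _ ij) m := E; move: ij; rewrite -val_eqE /= neq_ltn => /orP[] lt.
    by have := mem i j T iS jS lt m.
  by have := mem j i T jS iS lt (meetsC m).
have ab : above x s.
  have H i j T : i \in s -> j \in s -> (i < j)%N -> meets i j T -> x <= v i * (T - t i).
    move=> iS jS ij m; have := mem i j T iS jS ij m; rewrite inE => /predU1P[->//|].
    by move: xso => /= /(order_path_min lt_trans)/allP H /H/ltW.
  move=> i j T iS jS; rewrite -val_eqE /= neq_ltn => /orP[] lt m; first exact: H m.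
  by have [_ _ ->] := m; apply: H (meetsC m).
have [s1 [E1 sub1 r1 H1]] := overtake_steps ps c so ab.
have sS := mem_subseq sub1.
have [||i j T i1 j1 ij m|s2 [E2 sub2 r2 H2]] := IH s1 (sorted_sub sub1 so).
- exact: path_sorted xso.
- by move=> i i1; apply/sps/sS.
- have := mem i j T (sS i i1) (sS j j1) ij m; rewrite inE => /predU1P[e|//].
  by case: (H1 i j T i1 j1 ij _ m e); apply/sps/sS.
exists s2; split=> //; [by rewrite /= run_cat E1|exact: subseq_trans sub1|by rewrite r1].
Qed.

(* The collisions are run through by increasing distance to the origin rather than
   by increasing time: unlike the instants, the distances at which bullets may meet
   do not depend on the bullets that were shot before. *)
Definition flight ps xs : seq (instr R R) :=
  flatten [seq map (overtake x) ps | x <- xs] ++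
  flatten (nseq (size ps) (sweep R (fun p : R => - p) ps)).

Lemma nb_survivors_run ps xs : sorted <%R xs -> (forall i, v i \in ps) ->
  (forall i j T, (i < j)%N -> meets i j T -> v i * (T - t i) \in xs) ->
  nb_survivors CT = size (run (flight ps xs) (wordof 0 (enum 'I_n))).
Proof.
move=> xso vps inxs.
have so : sorted shot_before (enum 'I_n).
  by rewrite -(@sorted_map _ _ (@nat_of_ord n) ltn) val_enum_ord iota_ltn_sorted.
have [|i j T _ _|s [E sub r H]] := @overtake_all ps xs 0 _ so xso.
- by move=> i _; apply: vps.
- exact: inxs.
rewrite run_cat E; have so' := sorted_sub sub so.
(* No crossing is left among the remaining bullets. A later, faster bullet would cross an earlier
   one, so the speeds decrease and the final sweeps are idle. *)
have st : settled (fun p => - p) (wordof 0 s).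
  rewrite /settled labels_wordof sorted_map.
  apply: pairwise_sorted; move: so'; rewrite sorted_pairwise; last first.
    by move=> ? ? ?; exact: ltn_trans.
  apply: (@sub_in_pairwise _ (fun i => i \in s)); last by apply/allP.
  move=> i j iS jS /= ij; rewrite lerN2 leNgt; apply/negP => vij.
  exact: H iS jS ij (faster_meets ij vij).
rewrite (run_settled st); last exact: sound_sweeps.
rewrite size_wordof /nb_survivors /survivors.
have -> : [set: 'I_n]%SET = [set k in enum 'I_n]%SET.
  by apply/setP => k; rewrite !inE mem_enum.
rewrite -/(remaining CT _) r cardsE; apply/card_uniqP.
by apply: subseq_uniq sub _; exact: enum_uniq.
Qed.

End Bridge.

Section Shooting.
Variables (R : realType) (n : nat) (D : 'I_n.-1 -> R).
Hypothesis D0 : forall k, 0 < D k.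

Lemma shooting_time_lt (i j : 'I_n) : (i < j)%N -> shooting_time D i < shooting_time D j.
Proof.
move=> ij; have lt : (i < n.-1)%N by have := ltn_ord j; lia.
have -> : shooting_time D j = shooting_time D i +
    \sum_(k < n.-1 | (k < j)%N && ~~ (k < i)%N) D k.
  rewrite {1}/shooting_time (bigID (fun k : 'I_n.-1 => (k < i)%N)); congr (_ + _).
  by apply: eq_bigl => k; rewrite andb_idl // => /ltn_trans; apply.
rewrite ltrDl (bigD1 (Ordinal lt)) /= ?ij ?ltnn //.
by apply: ltr_wpDr; rewrite ?D0 ?sumr_ge0 // => k _; exact: ltW.
Qed.

Lemma nth_map_enum (X : Type) (x0 : X) m (f : 'I_m -> X) j (lt : (j < m)%N) :
  nth x0 [seq f i | i <- enum 'I_m] j = f (Ordinal lt).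
Proof.
rewrite (nth_map (Ordinal lt)) ?size_enum_ord //; congr f.
by apply: val_inj; rewrite /= nth_enum_ord.
Qed.

End Shooting.

Lemma wordof_enum (R : realType) n (D : 'I_n.-1 -> R) (v : 'I_n -> R) :
  wordof v (shooting_time D) 0 (enum 'I_n) =
  zip (0 :: [seq D k | k <- enum 'I_n.-1]) [seq v i | i <- enum 'I_n].
Proof.
rewrite /wordof; case: n D v => [|m] D v.
  by rewrite (size0nil (size_enum_ord 0)).
congr zip; apply: (@eq_from_nth _ 0).
  rewrite size_pairmap size_map size_enum_ord; congr _.+1.
  exact: (esym (etrans (size_map D (enum 'I_m)) (size_enum_ord m))).
rewrite size_pairmap size_map size_enum_ord => i lt.
rewrite (nth_pairmap 0); last by rewrite size_map size_enum_ord.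
rewrite nth_map_enum; case: i lt => [|i] lt /=.
  by rewrite subr0 /shooting_time big1.
have lt' : (i < m)%N by [].
rewrite (nth_map_enum _ _ (ltnW lt)) (nth_map_enum _ _ lt') /shooting_time /=.
rewrite (bigD1 (Ordinal lt')) //= (eq_bigl (fun k : 'I_m => (k < i)%N)) ?addrK // => k.
by rewrite -val_eqE /= ltnS ltn_neqAle andbC.
Qed.

(** * Random permutations *)

(** If [g] takes equal values, every rearrangement comes from the same number [c] of permutations,
    the order of the stabiliser of the word. *)
Lemma sum_perm_arrangements (X : eqType) (Z : zmodType) m (g : 'I_m -> X) :
  exists c : nat, forall F : seq X -> Z,
  \sum_(u : 'S_m) F [seq g (u i) | i <- enum 'I_m] =
  (\sum_(t <- permutations [seq g i | i <- enum 'I_m]) F t) *+ c.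
Proof.
pose h (u : 'S_m) := [seq g (u i) | i <- enum 'I_m].
set gs := [seq g i | i <- enum 'I_m].
exists #|[pred u | h u == gs]| => F; rewrite -sumrMnl.
have hP s : s \in permutations gs -> exists w, s = h w.
  rewrite mem_permutations => p; have /tuple_permP[w ->] : perm_eq s [tuple g i | i < m] by [].
  by exists w; rewrite /h /=; apply: eq_map => i; rewrite tnth_mktuple.
have hin u : h u \in permutations gs.
  rewrite mem_permutations; apply/(@tuple_permP _ _ _ [tuple g i | i < m]); exists u.
  by rewrite /h /=; apply: eq_map => i; rewrite tnth_mktuple.
transitivity (\sum_(u : 'S_m) \sum_(t <- permutations gs | t == h u) F t).
  by apply: eq_bigr => u _; rewrite -big_filter filter_pred1_uniq ?permutations_uniq // big_seq1.
rewrite (exchange_big_dep xpredT) //= big_seq [RHS]big_seq; apply: eq_bigr => s /hP[w ->].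
rewrite -sumr_const (reindex_inj (mulgI w)) /=; apply: eq_bigl => u.
rewrite inE [RHS]eq_sym; apply/eqP/eqP => /eq_in_map H; apply/eq_in_map => i _.
  by have := H ((w^-1)%g i) (mem_enum _ _); rewrite !permM !permKV.
by rewrite permM; apply: H (mem_enum _ _).
Qed.

Section FF.
Variables (R : realType) (n : nat) (V : 'I_n -> R) (D : 'I_n.-1 -> R).
Hypothesis V0 : forall i, 0 <= V i.
Hypothesis VI : injective V.
Hypothesis D0 : forall k, 0 < D k.
Hypothesis gen : generic (@half_line R) V D.

Let ps := [seq V i | i <- enum 'I_n].
Let gs := [seq D i | i <- enum 'I_n.-1].
(** A single program must serve all arrangements, so it goes through the crossing heights of every
    pair under every choice of the permutations. Values produced by pairs that do not meet do no
    harm. *)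
Let heights := sort <=%R (undup (codom (fun z : 'S_n * 'S_n.-1 * ('I_n * 'I_n) =>
  let v := V \o z.1.1 in let t := shooting_time (D \o z.1.2) in
  v z.2.1 * (crossing_time v t z.2.1 z.2.2 - t z.2.1)))).

Lemma FF_survivors_run st : FF_survivors V D st =
  size (run (flight ps heights) (zip (0 :: [seq D (st.2 i) | i <- enum 'I_n.-1])
                                     [seq V (st.1 i) | i <- enum 'I_n])).
Proof.
case: st => s u /=; rewrite -(wordof_enum (D \o u) (V \o s)); apply: nb_survivors_run.
- by move=> i; exact: V0.
- exact: inj_comp VI perm_inj.
- by apply: shooting_time_lt => k; exact: D0.
- move=> i j k T ij jk [ti tj e] [_ tk e']; have := gen s u ij jk.
  rewrite -subset0 => /(_ (T, V (s i) * (T - shooting_time (D \o u) i))); apply.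
  by split; [split|]; split=> //; exact: etrans e e'.
- by rewrite sort_lt_sorted undup_uniq.
- by move=> i; apply: map_f; rewrite mem_enum.
- move=> i j T ij m; rewrite mem_sort mem_undup.
  have nij : i != j by rewrite -val_eqE /= ltn_eqF.
  have /(virtual_CTP _ (inj_comp VI perm_inj) _ nij) := m.
  rewrite /virtual_CT; case: ifP => // _ [<-].
  exact: (codom_f _ (s, u, (i, j))).
Qed.

Lemma sound_flight : sound (fun p => - p) (flight ps heights).
Proof.
apply: sound_cat; last exact: sound_sweeps.
elim: heights => //= x xs IH; apply: sound_cat => //.
elim: {IH}ps => //= p qs IH; split=> // r g /andP[pr _].
by rewrite ltrN2.
Qed.

Lemma uniform_lawE (W : finType) (N : W -> nat) k p : (0 < #|W|)%N ->
  \sum_(w : W) ((N w == k)%:R - p) = 0 -> uniform_law R N k = p.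
Proof.
move=> W0 /eqP; rewrite sumrB sumr_const (eq_card (B := W)) // subr_eq0 => /eqP e.
rewrite /uniform_law; have -> : #|[pred w | N w == k]|%:R = \sum_(w : W) (N w == k)%:R :> R.
  by rewrite -natr_sum -sum1_card big_mkcond.
by rewrite e -[p *+ _]mulr_natr mulfK // pnatr_eq0 -lt0n.
Qed.

Lemma FF_law k : uniform_law R (FF_survivors V D) k = q R n k.
Proof.
apply: uniform_lawE; first by apply/card_gt0P; exists (1%g, 1%g).
pose F s t := chi R k (run (flight ps heights) (zip (0 :: t) s)) - q R n k.
have [c cE] := sum_perm_arrangements R D; have [c' cE'] := sum_perm_arrangements R V.
transitivity (\sum_(s : 'S_n) \sum_(u : 'S_n.-1)
    F [seq V (s i) | i <- enum 'I_n] [seq D (u i) | i <- enum 'I_n.-1]).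
  rewrite pair_big; apply: eq_bigr => st _.
  by rewrite FF_survivors_run /F /chi.
under eq_bigr do rewrite (cE (F _)).
rewrite sumrMnl (cE' (fun s => \sum_(t <- permutations gs) F s t)).
suff -> : \sum_(s <- permutations ps) \sum_(t <- permutations gs) F s t = 0 by rewrite !mul0rn.
rewrite -(sum_arr (fun w => chi R k (run (flight ps heights) w) - q R n k)).
apply: (@universality _ _ _ (q R) _ _ _ n (fun p => - p)) => //.
- by rewrite map_inj_uniq ?enum_uniq.
- by move=> x y _ _ /oppr_inj.
- by rewrite size_map size_enum_ord.
- by rewrite size_map size_enum_ord.
- exact: sound_flight.
- by apply: settling_cat; apply: settling_sweeps.
Qed.

End FF.

(** * Distances distorted by an increasing function *)

Section FAF.
Variables (R : realType) (n : nat) (f : R -> R) (V : 'I_n -> R) (D : 'I_n.-1 -> R).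
Hypothesis fS : {in `[0, +oo[ &, {homo f : x y / x < y}}.
Hypothesis V0 : forall i, 0 <= V i.
Hypothesis VI : injective V.

Lemma curve_inj (x y : R) : 0 <= x -> 0 <= y -> f x = f y -> x = y.
Proof.
move=> x0 y0 e; have H (a b : R) : 0 <= a -> 0 <= b -> a < b -> f a < f b.
  by move=> a0 b0; apply: fS; rewrite in_itv /= andbT.
by have [/H-/(_ x0 y0)|/H-/(_ y0 x0)|//] := ltgtP x y; rewrite e ltxx.
Qed.

(** [f] is injective on distances, so bullets meet at the same instants as along half-lines. There
    is at most one such instant, which the infimum picks; the infimum of the empty set is [+oo]. *)
Lemma virtual_CT_alongE (v t : 'I_n -> R) i j : (forall i, 0 <= v i) -> injective v ->
  i != j -> virtual_CT_along f v t i j = virtual_CT v t i j.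
Proof.
move=> v0 vI ij; have mE T : [/\ t i <= T, t j <= T & f (v i * (T - t i)) = f (v j * (T - t j))] <->
    virtual_CT v t i j = T%:E.
  rewrite (virtual_CTP t vI _ ij); split=> [[ti tj e]|[ti tj ->]]; last by [].
  by split=> //; apply: curve_inj => //; rewrite mulr_ge0 ?v0 // subr_ge0.
rewrite /virtual_CT_along; case E : (virtual_CT v t i j) => [T| |].
- suff -> : [set s | [/\ t i <= s, t j <= s & f (v i * (s - t i)) = f (v j * (s - t j))]] = [set T].
    by rewrite image_set1 ereal_inf1.
  by apply/seteqP; split=> s /=; [move/mE; rewrite E => -[]|move=> ->; exact/mE].
- suff -> : [set s | [/\ t i <= s, t j <= s & f (v i * (s - t i)) = f (v j * (s - t j))]] = set0.
    by rewrite image_set0 ereal_inf0.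
  by apply/seteqP; split=> s //= /mE; rewrite E.
- by have := virtual_CT_Ny v t i j; rewrite E.
Qed.

Lemma eq_nb_survivors (CT CT' : 'I_n -> 'I_n -> \bar R) :
  (forall i j, i != j -> CT i j = CT' i j) -> nb_survivors CT = nb_survivors CT'.
Proof.
move=> H; rewrite /nb_survivors /survivors; congr #|pred_of_set _|; apply: eq_iter => S.
have fE : first_collision CT S = first_collision CT' S.
  by apply: eq_bigr => i _; apply: eq_bigr => j /andP[_ ij]; apply: H.
rewrite /collision_step fE; case: ifP => // _; congr (_ :\: _)%SET.
apply/setP => i; rewrite !inE; congr (_ && _); apply: eq_existsb => j.
by have [->|ij] := eqVneq i j; rewrite ?eqxx // H.
Qed.

Lemma FAF_survivorsE st : FAF_survivors f V D st = FF_survivors V D st.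
Proof.
apply: eq_nb_survivors => i j ij; apply: virtual_CT_alongE => //.
  by move=> k; exact: V0.
exact: inj_comp VI perm_inj.
Qed.

Lemma generic_half_line : generic (curve_along f) V D -> generic (@half_line R) V D.
Proof.
move=> gen s u i j k ij jk; rewrite -subset0 => p [[[ti ei] [tj ej]] [tk ek]].
have := gen s u i j k ij jk.
rewrite -subset0 => /(_ (p.1, f p.2)); apply; rewrite /curve_along /=.
by split; [split|]; split=> //; rewrite -?ei -?ej -?ek.
Qed.

End FAF.

(** * Measurability of the dynamics *)

Section FiniteValued.
Context d (T : measurableType d).

(** For values in a finite type, such as sets of bullets, fibres over points suffice;
    [measurable_fin_bind] lets each step of the dynamics depend on the previous one. *)
Definition measurable_fin (F : finType) (f : T -> F) :=
  forall y, measurable [set w | f w = y].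

Lemma measurable_fin_bool (b : T -> bool) : measurable_fun setT b -> measurable_fin b.
Proof. by move=> mb y; rewrite -[X in measurable X]setTI; apply: (mb _ [set y]). Qed.

Lemma measurable_fin_cst (F : finType) (x : F) : measurable_fin (fun _ => x).
Proof.
move=> y; have [->|xy] := eqVneq x y.
  by rewrite (_ : [set _ | _] = setT) //; apply/seteqP; split.
by rewrite (_ : [set _ | _] = set0) //; apply/seteqP; split=> // w /= e; rewrite e eqxx in xy.
Qed.

Lemma measurable_fin_bind (F F' : finType) (f : T -> F) (g : F -> T -> F') :
  measurable_fin f -> (forall x, measurable_fin (g x)) -> measurable_fin (fun w => g (f w) w).
Proof.
move=> mf mg y.
rewrite (_ : [set _ | _] = \bigcup_(x in [set: F]) ([set w | f w = x] `&` [set w | g x w = y])).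
  apply: fin_bigcup_measurable => [|x _]; first exact: finite_finset.
  by apply: measurableI; [exact: mf|exact: mg].
by apply/seteqP; split=> [w e|w [x _ [/= <-]]] //; exists (f w).
Qed.

Lemma measurable_fin_comp (F F' : finType) (f : T -> F) (g : F -> F') :
  measurable_fin f -> measurable_fin (fun w => g (f w)).
Proof.
move=> mf; apply: (@measurable_fin_bind _ _ f (fun x _ => g x)) => // x.
exact: measurable_fin_cst.
Qed.

Lemma measurable_fin_set (I : finType) (Q : I -> T -> bool) :
  (forall i, measurable_fin (Q i)) -> measurable_fin (fun w => [set i | Q i w]%SET).
Proof.
move=> mQ S.
rewrite (_ : [set _ | _] = \bigcap_(i in [set: I]) [set w | Q i w = (i \in S)]).
  by apply: fin_bigcap_measurable => [|i _]; [exact: finite_finset|apply: mQ].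
apply/seteqP; split=> w /=; first by move=> <- i _ /=; rewrite inE.
by move=> H; apply/setP => i; rewrite inE; apply: H.
Qed.

Lemma measurable_fin_exists (I : finType) (Q : I -> T -> bool) :
  (forall i, measurable_fin (Q i)) -> measurable_fin (fun w => [exists i, Q i w]).
Proof.
move=> mQ; rewrite (_ : (fun w => _) = fun w => [exists i, i \in [set i | Q i w]%SET]).
  exact: (measurable_fin_comp (fun S : {set I} => [exists i, i \in S])) (measurable_fin_set mQ).
by apply/funext => w; apply: eq_existsb => i; rewrite inE.
Qed.

Lemma measurable_fin_card (I : finType) (f : T -> {set I}) k :
  measurable_fin f -> measurable [set w | #|f w| = k].
Proof.
move=> mf; have := measurable_fin_comp (fun S : {set I} => #|S| == k) mf.
move=> /(_ true); rewrite (_ : [set w | (#|f w| == k) = true] = [set w | #|f w| = k]) //.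
by apply/seteqP; split=> w /= /eqP.
Qed.

End FiniteValued.

Lemma measurable_inv (R : realType) : measurable_fun setT (@GRing.inv R).
Proof.
rewrite (_ : [set: R] = [set~ 0] `|` [set 0]); last by rewrite setUC setUv.
have m0 : measurable [set (0 : R)] by exact: measurable_set1.
apply/measurable_funU => //; first exact: measurableC.
split; last exact: measurable_fun_set1.
apply: open_continuous_measurable_fun; first by apply: closed_openC; exact: closed_eq.
by move=> x; rewrite inE => /eqP x0; apply: inv_continuous.
Qed.

Section DynamicsMeasurable.
Context d (T : measurableType d) (R : realType) (n : nat).

Lemma measurable_bigmin (I : finType) (Q : pred I) (F : I -> T -> \bar R) :
  (forall i, measurable_fun setT (F i : T -> \bar R)) ->
  measurable_fun setT (fun w => \big[Order.min/+oo%E]_(i | Q i) F i w).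
Proof.
move=> mF; elim: (index_enum I) => [|i s IH].
  by under eq_fun do rewrite big_nil; exact: measurable_cst.
under eq_fun do rewrite big_cons; case: (Q i) => //.
exact: measurable_mine.
Qed.

Variable CT : T -> 'I_n -> 'I_n -> \bar R.
Hypothesis mCT : forall i j, measurable_fun setT (fun w => CT w i j).

Lemma measurable_first_collision S : measurable_fun setT (fun w => first_collision (CT w) S).
Proof. by do 2![apply: measurable_bigmin => ?]; exact: mCT. Qed.

Lemma measurable_collision_step S : measurable_fin (fun w => collision_step (CT w) S).
Proof.
rewrite /collision_step.
apply: (@measurable_fin_bind _ _ _ _ (fun w => first_collision (CT w) S \is a fin_num)
  (fun (b : bool) w => if b then (S :\: [set i in S | [exists j in S,
              (i != j) && (CT w i j == first_collision (CT w) S)]])%SET else S)).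
  apply: measurable_fin_bool; under eq_fun do rewrite fin_numE.
  apply: measurable_and; apply: measurable_neg; apply: measurable_fun_eqe => //;
    exact: measurable_first_collision.
case; last exact: measurable_fin_cst.
apply: (measurable_fin_comp (fun X => (S :\: X)%SET)); apply: measurable_fin_set => i.
apply: (measurable_fin_comp (andb (i \in S))); apply: measurable_fin_exists => j.
apply: (measurable_fin_comp (andb (j \in S))); apply: (measurable_fin_comp (andb (i != j))).
by apply: measurable_fin_bool; apply: measurable_fun_eqe => //; exact: measurable_first_collision.
Qed.

Lemma measurable_nb_survivors k : measurable [set w | nb_survivors (CT w) = k].
Proof.
apply: measurable_fin_card; rewrite /survivors.
suff H m S : measurable_fin (fun w => iter m (collision_step (CT w)) S) by exact: H.
elim: m => [|m IH]; first exact: measurable_fin_cst.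
rewrite /=; apply: (@measurable_fin_bind _ _ _ _ (fun w => iter m (collision_step (CT w)) S)
  (fun X w => collision_step (CT w) X)) => // X; exact: measurable_collision_step.
Qed.

End DynamicsMeasurable.

Lemma measurable_crossing_time d (T : measurableType d) (R : realType) n
    (v t : T -> 'I_n -> R) i j :
  (forall i, measurable_fun setT (fun w => v w i)) ->
  (forall i, measurable_fun setT (fun w => t w i)) ->
  measurable_fun setT (fun w => crossing_time (v w) (t w) i j).
Proof.
move=> mv mt.
apply: measurable_funM; first by apply: measurable_funB; apply: measurable_funM.
by apply: (measurableT_comp (@measurable_inv R)); apply: measurable_funB.
Qed.

Lemma measurable_virtual_CT d (T : measurableType d) (R : realType) n
    (v t : T -> 'I_n -> R) i j :
  (forall i, measurable_fun setT (fun w => v w i)) ->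
  (forall i, measurable_fun setT (fun w => t w i)) ->
  measurable_fun setT (fun w => virtual_CT (v w) (t w) i j).
Proof.
move=> mv mt; have mc := measurable_crossing_time i j mv mt.
apply: measurable_fun_ifT => //.
  by apply: measurable_fun_ler => //; apply: measurable_maxr.
exact/measurable_EFinP.
Qed.

(** * Independent families *)

Section Families.
Variables (R : realType) (I : finType).

Definition box (B : I -> set R) : set (I -> R) := [set x | forall i, B i (x i)].

Definition boxes : set (set (I -> R)) :=
  [set A | exists2 B : I -> set R, (forall i, measurable (B i)) & A = box B].

(* [I -> R] with its product sigma-algebra. *)
Definition vec := g_sigma_algebraType boxes.

Lemma boxes_setI : setI_closed boxes.
Proof.
move=> _ _ [B mB ->] [C mC ->]; exists (fun i => B i `&` C i).
  by move=> i; apply: measurableI.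
apply/seteqP; split=> [x [Bx Cx] i|x H]; first by split.
by split=> i; have [] := H i.
Qed.

Lemma box_setT : box (fun=> setT) = setT.
Proof. by apply/seteqP; split. Qed.

Lemma measurable_box B : (forall i, measurable (B i)) -> measurable (box B : set vec).
Proof. by move=> mB; apply: sub_sigma_algebra; exists B. Qed.

Lemma measurable_coord i : measurable_fun setT (fun x : vec => x i).
Proof.
move=> _ B mB; rewrite setTI.
rewrite (_ : _ @^-1` B = box (fun j => if j == i then B else setT)); last first.
  apply/seteqP; split=> [x Bx j|x /(_ i)]; last by rewrite eqxx.
  by case: eqP => // ->.
by apply: measurable_box => j; case: ifP.
Qed.

Lemma vec_measure_unique (m1 m2 : {measure set vec -> \bar R}) :
  (m1 setT < +oo)%E -> (forall B, (forall i, measurable (B i)) -> m1 (box B) = m2 (box B)) ->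
  forall A, measurable A -> m1 A = m2 A.
Proof.
move=> fin H; apply: (@measure_unique _ R vec boxes (fun=> setT)) => //.
- exact: boxes_setI.
- by move=> _; exists (fun=> setT); rewrite ?box_setT.
- by rewrite bigcup_const.
- by move=> _ [B mB ->]; exact: H.
Qed.

Section RV.
Context d (T : measurableType d) (P : probability T R).

Definition joint (X : I -> {RV P >-> R}) (w : T) : vec := fun i => X i w.

Lemma joint_box X B : joint X @^-1` box B = \bigcap_(i in [set: I]) (X i @^-1` B i).
Proof. by apply/seteqP; split=> w H i; [move=> _; apply: H|apply: H]. Qed.

Lemma measurable_joint X : measurable_fun setT (joint X).
Proof.
apply: (@measurability _ _ T vec setT (joint X) boxes) => // _ [_ [B mB ->] <-].
rewrite setTI joint_box; apply: fin_bigcap_measurable; first exact: finite_finset.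
by move=> i _; rewrite -[X in measurable X]setTI; apply: measurable_funP.
Qed.

Definition independent (X : I -> {RV P >-> R}) := forall B, (forall i, measurable (B i)) ->
  P (joint X @^-1` box B) = (\prod_i P (X i @^-1` B i))%E.

Lemma joint_law X Y : independent X -> independent Y ->
  (forall i B, measurable B -> P (X i @^-1` B) = P (Y i @^-1` B)) ->
  forall A, measurable A -> P (joint X @^-1` A) = P (joint Y @^-1` A).
Proof.
move=> iX iY E A mA.
pose m Z : {measure set vec -> \bar R} := distribution P (mfun_Sub (mem_set (measurable_joint Z))).
apply: (@vec_measure_unique (m X) (m Y)) => // [|B mB].
  by rewrite -ge0_fin_numE // fin_num_measure.
rewrite [LHS]iX // [RHS]iY //; apply: eq_bigr => i _; exact: E.
Qed.

Lemma independent_perm X (s : {perm I}) : independent X -> independent (X \o s).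
Proof.
move=> iX B mB; have := iX (fun i => B ((s^-1)%g i)) (fun i => mB _).
rewrite (reindex_inj (@perm_inj _ s)) /=; under eq_bigr do rewrite permK.
move=> <-; congr (P _); apply/seteqP; split=> w H i.
  by have := H ((s^-1)%g i); rewrite /joint /= permKV.
by have := H (s i); rewrite /joint permK.
Qed.

(** By independence the law of the pair is a product measure, and the sections of the diagonal are
    single points, which are null for the law of [X]. *)
Lemma eq_independent_null (X Y : {RV P >-> R}) :
  (forall A B, measurable A -> measurable B ->
     P (Y @^-1` A `&` X @^-1` B) = P (Y @^-1` A) * P (X @^-1` B))%E ->
  (forall c, P (X @^-1` [set c]) = 0%E) -> P [set w | X w = Y w] = 0%E.
Proof.
move=> ind atom; have mYX : measurable_fun setT (fun w => (Y w, X w)).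
  exact: measurable_fun_pair.
have mdiag : measurable [set z : R * R | z.2 = z.1].
  have : measurable_fun setT (fun z : R * R => z.2 == z.1) by exact: measurable_fun_eqr.
  move=> /(_ measurableT [set true] _); rewrite setTI.
  rewrite (_ : _ @^-1` _ = [set z : R * R | z.2 = z.1]); first exact.
  by apply/seteqP; split=> z /= /eqP.
pose m : {measure set (R * R) -> \bar R} := distribution P (mfun_Sub (mem_set mYX)).
rewrite (_ : [set w | _] = (fun w => (Y w, X w)) @^-1` [set z | z.2 = z.1]) //.
rewrite -[LHS]/(m _) -(@product_measure_unique _ _ _ _ _ (distribution P Y) (distribution P X)) //.
rewrite /product_measure1; apply: integral0_eq => y _ /=.
rewrite (_ : xsection _ _ = [set y]); first exact: atom.
by apply/seteqP; split=> x; rewrite /xsection /= inE.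
Qed.

(* Overwriting coordinate [k] gives a vector that is independent of [X k]. *)
Definition others (k : I) (x : vec) : vec := fun i => if i == k then 0 else x i.

Lemma eq_others_null X k (h : vec -> R) : independent X -> measurable_fun setT h ->
  (forall c, P (X k @^-1` [set c]) = 0%E) ->
  P [set w | X k w = h (others k (joint X w))] = 0%E.
Proof.
move=> iX mh atom.
pose Z := fun i => if i == k then [the {RV P >-> R} of cst 0] else X i.
have ZE w : others k (joint X w) = joint Z w.
  by apply/funext => i; rewrite /others /joint /Z; case: ifP.
have mY : measurable_fun setT (fun w => h (joint Z w)).
  by apply: (measurableT_comp mh); exact: measurable_joint.
pose Y : {RV P >-> R} := mfun_Sub (mem_set mY).
rewrite (_ : [set w | _] = [set w | X k w = Y w]); last first.
  by apply/seteqP; split=> w /=; rewrite ZE.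
apply: eq_independent_null => // A B mA mB.
have mXB : measurable (X k @^-1` B) by rewrite -[X in measurable X]setTI; apply: measurable_funP.
have mhA : measurable (h @^-1` A) by rewrite -[X in measurable X]setTI; apply: mh.
(* For fixed [B], both sides of the independence of [joint Z] and [X k] are finite measures in the
   event on [joint Z]; comparing them on boxes is enough. *)
pose m0 : {measure set vec -> \bar R} := pushforward (mrestr P mXB) (joint Z).
pose m1 := m0 (measurable_joint Z).
have r0 : (0 <= fine (P (X k @^-1` B)))%R by rewrite fine_ge0.
pose m2 : {measure set vec -> \bar R} := mscale (NngNum r0)
   (distribution P (mfun_Sub (mem_set (measurable_joint Z)))).
have rE : (fine (P (X k @^-1` B)))%:E = P (X k @^-1` B) by rewrite fineK // fin_num_measure.
have m1E C : m1 C = P (joint Z @^-1` C `&` X k @^-1` B) by [].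
have m2E C : m2 C = (P (X k @^-1` B) * P (joint Z @^-1` C))%E by rewrite -rE.
suff : m1 (h @^-1` A) = m2 (h @^-1` A) by rewrite m1E m2E muleC.
apply: vec_measure_unique => // [|C mC].
  by rewrite m1E preimage_setT setTI -ge0_fin_numE // fin_num_measure.
rewrite m1E m2E.
(* Coordinate [k] of [Z] is the constant 0: it either makes the event empty or puts no constraint on
   it. *)
have [C0|nC0] := pselect (C k 0); last first.
  rewrite (_ : _ @^-1` _ = set0); first by rewrite set0I !measure0 mule0.
  by apply/seteqP; split=> // w /(_ k); rewrite /joint /Z eqxx.
pose C' A' i := if i == k then A' else C i.
have mC' A' i : measurable A' -> measurable (C' A' i) by rewrite /C'; case: ifP.
rewrite (_ : _ `&` _ = joint X @^-1` box (C' B)); last first.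
  apply/seteqP; split=> w.
    move=> [H HB] i; have := H i; rewrite /C' /joint /Z; case: eqVneq => [->|] //.
  move=> H; split=> [i|]; last by have := H k; rewrite /C' eqxx.
  by have := H i; rewrite /C' /joint /Z; case: eqVneq => [->|].
rewrite (_ : joint Z @^-1` _ = joint X @^-1` box (C' setT)); last first.
  apply/seteqP; split=> w H i; have := H i; rewrite /C' /joint /Z; by case: eqVneq => [->|].
rewrite !iX; do ?by move=> i; apply: mC'.
rewrite (bigD1 k) //= [in RHS](bigD1 k) //= /C' eqxx preimage_setT probability_setT mul1e.
by congr (_ * _)%E; apply: eq_bigr => i /negPf ->.
Qed.

End RV.
End Families.

(** * Random speeds and delays *)

Section Shift.
Variables (R : realType) (n : nat).

(** The dynamics only compares collision times, and a common finite shift preserves their order and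
    the infinite values. *)
Lemma nb_survivors_addr (CT : 'I_n -> 'I_n -> \bar R) (c : R) :
  nb_survivors (fun i j => CT i j + c%:E)%E = nb_survivors CT.
Proof.
rewrite /nb_survivors /survivors; congr #|pred_of_set _|; apply: eq_iter => S.
have minD (x y : \bar R) : (Order.min x y + c%:E = Order.min (x + c%:E) (y + c%:E))%E.
  by rewrite /Order.min lteD2rE //; case: ifP.
have fE : first_collision (fun i j => CT i j + c%:E)%E S = (first_collision CT S + c%:E)%E.
  rewrite /first_collision (big_morph (fun x => x + c%:E)%E minD (addye _)) //.
  by apply: eq_bigr => i _; rewrite (big_morph (fun x => x + c%:E)%E minD (addye _)).
rewrite /collision_step fE fin_numD andbT; case: ifP => // _; congr (_ :\: _)%SET.
apply/setP => i; rewrite !inE; congr (_ && _); apply: eq_existsb => j.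
have -> : ((CT i j + c%:E)%E == (first_collision CT S + c%:E)%E) = (CT i j == first_collision CT S).
  by rewrite !eq_le !leeD2rE.
by [].
Qed.

Lemma virtual_CT_shift (v t : 'I_n -> R) (c : R) : injective v ->
  nb_survivors (virtual_CT v (fun i => t i + c)) = nb_survivors (virtual_CT v t).
Proof.
move=> vI; rewrite -(nb_survivors_addr (virtual_CT v t) c); apply: eq_nb_survivors => i j ij.
have d : v i - v j != 0 by rewrite subr_eq0; apply: contra_neq ij => /vI.
rewrite /virtual_CT; have -> : crossing_time v (fun i => t i + c) i j = crossing_time v t i j + c.
  rewrite /crossing_time; field; exact: d.
by rewrite -addr_maxl lerD2r; case: ifP.
Qed.

End Shift.

Section AlmostEverywhere.
Context d (T : measurableType d) (R : realType) (P : probability T R).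

Lemma ae_null (A : set T) (Q : T -> Prop) : measurable A -> P A = 0%E ->
  (forall w, ~ A w -> Q w) -> \forall w \ae P, Q w.
Proof.
move=> mA A0 H; exists A; split=> // w /= nQ.
by have [//|/H] := pselect (A w).
Qed.

Lemma ae_forall (I : finType) (Q : I -> T -> Prop) :
  (forall i, \forall w \ae P, Q i w) -> \forall w \ae P, forall i, Q i w.
Proof.
move=> H; have F := ae_filter_ringOfSetsType P.
suff : \forall w \ae P, forall i, i \in enum I -> Q i w.
  by apply: filterS => w Hw i; apply: Hw; rewrite mem_enum.
elim: (enum I) => [|i s IH]; first by apply: filterE => w i.
apply: filterS2 (H i) IH => w Hi Hs j; rewrite inE => /predU1P[->//|]; exact: Hs.
Qed.

End AlmostEverywhere.

Section RandomBullets.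
Variables (R : realType) (n : nat).
Let I : finType := ('I_n + 'I_n.-1)%type.
Implicit Types (x : vec R I) (st : 'S_n * 'S_n.-1).

Definition speeds x : 'I_n -> R := fun i => x (inl i).
Definition delays x : 'I_n.-1 -> R := fun k => x (inr k).

(** [c] is the instant of the first shot: 1 for RU, 0 for RR. *)
Definition survivor_count c x :=
  nb_survivors (virtual_CT (speeds x) (fun i => shooting_time (delays x) i + c)).

Definition shuffle st (i : I) : I :=
  match i with inl i => inl (st.1 i) | inr k => inr (st.2 k) end.

Lemma shuffle_inj st : injective (shuffle st).
Proof. by move=> [i|i] [j|j] //= [] /perm_inj ->. Qed.

Definition good x := [/\ forall i, 0 <= speeds x i, injective (speeds x),
  forall k, 0 < delays x k & generic (@half_line R) (speeds x) (delays x)].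

Lemma survivor_count_shuffle c x st : good x ->
  survivor_count c (x \o shuffle st) = FF_survivors (speeds x) (delays x) st.
Proof.
case=> _ xI _ _; rewrite /survivor_count virtual_CT_shift //.
by move=> i j /xI /perm_inj.
Qed.

Lemma good_average c x k : good x ->
  \sum_(st : 'S_n * 'S_n.-1) (survivor_count c (x \o shuffle st) == k)%:R =
  q R n k * #|{: 'S_n * 'S_n.-1}|%:R.
Proof.
move=> gx; have [x0 xI xD xg] := gx.
rewrite -(FF_law x0 xI xD xg k) /uniform_law divfK; last first.
  by rewrite pnatr_eq0 -lt0n; apply/card_gt0P; exists (1%g, 1%g).
have -> : #|[pred st | FF_survivors (speeds x) (delays x) st == k]|%:R =
    \sum_st (FF_survivors (speeds x) (delays x) st == k)%:R :> R.
  by rewrite -natr_sum -sum1_card big_mkcond.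
by apply: eq_bigr => st _; rewrite survivor_count_shuffle.
Qed.

Lemma measurable_shooting d (T : measurableType d) (D : T -> 'I_n.-1 -> R) i :
  (forall k, measurable_fun setT (fun w => D w k)) ->
  measurable_fun setT (fun w => shooting_time (D w) i).
Proof.
move=> mD; rewrite /shooting_time; under eq_fun do rewrite -big_filter.
exact: measurable_sum.
Qed.

Lemma measurable_survivor_count c k : measurable [set x | survivor_count c x = k].
Proof.
apply: measurable_nb_survivors => i j; apply: measurable_virtual_CT => l.
  exact: measurable_coord.
apply: measurable_funD => //; apply: measurable_shooting => a; exact: measurable_coord.
Qed.

(* At a triple point, the speed of the last of the three bullets is this function
   of the other speeds and of the delays. *)
Definition triple_speed st (i j k : 'I_n) x : R :=
  let v := speeds x \o st.1 in let t := shooting_time (delays x \o st.2) in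
  v i * (crossing_time v t i j - t i) / (crossing_time v t i j - t k).

Lemma measurable_triple_speed st i j k : measurable_fun setT (triple_speed st i j k).
Proof.
have mv a : measurable_fun setT (fun x : vec R I => (speeds x \o st.1) a).
  exact: measurable_coord.
have mt a : measurable_fun setT (fun x : vec R I => shooting_time (delays x \o st.2) a).
  by apply: measurable_shooting => b; exact: measurable_coord.
have mc : measurable_fun setT (fun x : vec R I => crossing_time (speeds x \o st.1)
    (shooting_time (delays x \o st.2)) i j).
  exact: measurable_crossing_time.
apply: measurable_funM; first by apply: measurable_funM => //; apply: measurable_funB.
by apply: (measurableT_comp (@measurable_inv R)); apply: measurable_funB.
Qed.

Lemma triple_speed_others st i j k x : i != k -> j != k ->
  triple_speed st i j k (others (inl (st.1 k)) x) = triple_speed st i j k x.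
Proof.
move=> ik jk; have E a : a != k -> speeds (others (inl (st.1 k)) x) (st.1 a) = speeds x (st.1 a).
  by move=> ak; rewrite /speeds /others; case: eqP => // -[/perm_inj] e; rewrite e eqxx in ak.
by rewrite /triple_speed /crossing_time /= !E.
Qed.

Lemma good_of_triple x : (forall i, 0 <= speeds x i) -> (forall k, 0 < delays x k) ->
  (forall i j, i != j -> speeds x i <> speeds x j) ->
  (forall st (ijk : 'I_n * 'I_n * 'I_n), ijk.1.1 != ijk.2 -> ijk.1.2 != ijk.2 ->
     speeds x (st.1 ijk.2) <> triple_speed st ijk.1.1 ijk.1.2 ijk.2 x) -> good x.
Proof.
move=> x0 xD xI H; have inj : injective (speeds x).
  by move=> i j e; apply/eqP/negPn/negP => /xI; apply.
split=> // s u i j k ij jk; rewrite -subset0 => p [[[ti ei] [tj ej]] [tk ek]].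
have ik := ltn_trans ij jk.
have nij : i != j by rewrite -val_eqE /= ltn_eqF.
have nik : i != k by rewrite -val_eqE /= ltn_eqF.
have njk : j != k by rewrite -val_eqE /= ltn_eqF.
have := H (s, u) (i, j, k) nik njk; apply; rewrite /triple_speed.
set v := _ \o _; set t := shooting_time _.
have {}ei : p.2 = v i * (p.1 - t i) by [].
have {}ej : p.2 = v j * (p.1 - t j) by [].
have {}ek : p.2 = v k * (p.1 - t k) by [].
have m : meets v t i j p.1 by split=> //; rewrite -ei -ej.
have := (virtual_CTP _ (inj_comp inj perm_inj) _ nij).2 m.
rewrite /virtual_CT; case: ifP => // _ [->]; rewrite /= -ei ek.
have tS : forall i j : 'I_n, (i < j)%N -> t i < t j.
  by apply: shooting_time_lt => a; apply: xD.
(* If the division is by 0, the common point is the origin at the instant when [k] is shot; the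
   earlier bullets [i] and [j] are then both at rest, against the distinctness of speeds. *)
have [tE|/negPf ne] := eqVneq (p.1 - t k) 0; last by rewrite mulfK ?ne.
exfalso; have y0 : p.2 = 0 by rewrite ek tE mulr0.
have stop (a : 'I_n) : (a < k)%N -> p.2 = v a * (p.1 - t a) -> v a = 0.
  move=> /tS lt; rewrite y0 => /esym/eqP; rewrite mulf_eq0 => /orP[/eqP//|/eqP e].
  by exfalso; lra.
have e : v i = v j by exact: etrans (stop i ik ei) (esym (stop j jk ej)).
by move: nij; rewrite (inj_comp inj (@perm_inj _ s) e) eqxx.
Qed.

Section Law.
Context d (T : measurableType d) (P : probability T R) (X : I -> {RV P >-> R}).
Hypothesis indX : independent X.
Hypothesis lawV : forall i j B, measurable B -> P (X (inl i) @^-1` B) = P (X (inl j) @^-1` B).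
Hypothesis lawD : forall i j B, measurable B -> P (X (inr i) @^-1` B) = P (X (inr j) @^-1` B).
Hypothesis posV : forall i, P (X (inl i) @^-1` `]-oo, 0[) = 0%E.
Hypothesis posD : forall k, P (X (inr k) @^-1` `]-oo, 0]) = 0%E.
Hypothesis atomV : forall i c, P (X (inl i) @^-1` [set c]) = 0%E.

Lemma measurable_RV (Y : {RV P >-> R}) B : measurable B -> measurable (Y @^-1` B).
Proof. by move=> mB; rewrite -[X in measurable X]setTI; apply: measurable_funP. Qed.

Lemma good_ae : \forall w \ae P, good (joint X w).
Proof.
have F := ae_filter_ringOfSetsType P.
(* A speed without atoms almost surely differs from any given measurable function of the other
   variables. Equal speeds and triple points are both excluded in this way. *)
have avoid (k : 'I_n) (h : vec R I -> R) : measurable_fun setT h ->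
    (forall x, h (others (inl k) x) = h x) -> \forall w \ae P, X (inl k) w <> h (joint X w).
  move=> mh hE; have N := eq_others_null indX mh (atomV k).
  apply: (ae_null _ N) => [|w /=]; last by rewrite hE.
  have mhX : measurable_fun setT (fun w => h (others (inl k) (joint X w))).
    under eq_fun do rewrite hE; apply: (measurableT_comp mh); exact: measurable_joint.
  have mf : measurable_fun setT (fun w => X (inl k) w == h (others (inl k) (joint X w))).
    exact: measurable_fun_eqr.
  rewrite (_ : [set w | _] =
      (fun w => X (inl k) w == h (others (inl k) (joint X w))) @^-1` [set true]).
    by rewrite -[X in measurable X]setTI; apply: mf.
  by apply/seteqP; split=> w /= /eqP.
have a1 : \forall w \ae P, forall i, 0 <= X (inl i) w.
  apply: ae_forall => i; apply: (ae_null _ (posV i)) => [|w /=]; first exact: measurable_RV.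
  by rewrite in_itv /= leNgt => /negP.
have a2 : \forall w \ae P, forall k, 0 < X (inr k) w.
  apply: ae_forall => i; apply: (ae_null _ (posD i)) => [|w /=]; first exact: measurable_RV.
  by rewrite in_itv /= ltNge => /negP.
have a3 : \forall w \ae P, forall ij : 'I_n * 'I_n, ij.1 != ij.2 ->
    X (inl ij.1) w <> X (inl ij.2) w.
  apply: ae_forall => -[i j] /=; have [->|ij] := eqVneq i j; first by apply: filterE.
  suff : \forall w \ae P, X (inl i) w <> X (inl j) w by apply: filterS.
  apply: (avoid i (fun x => x (inl j))) => [|x]; first exact: measurable_coord.
  by rewrite /others; case: eqP => // -[e]; rewrite e eqxx in ij.
have a4 : \forall w \ae P, forall (p : ('S_n * 'S_n.-1) * ('I_n * 'I_n * 'I_n)),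
    p.2.1.1 != p.2.2 -> p.2.1.2 != p.2.2 ->
    X (inl (p.1.1 p.2.2)) w <> triple_speed p.1 p.2.1.1 p.2.1.2 p.2.2 (joint X w).
  apply: ae_forall => -[st [[i j] k]] /=.
  have [->|ik] := eqVneq i k; first by apply: filterE.
  have [->|jk] := eqVneq j k; first by apply: filterE.
  suff : \forall w \ae P, X (inl (st.1 k)) w <> triple_speed st i j k (joint X w) by apply: filterS.
  apply: avoid; first exact: measurable_triple_speed.
  by move=> x; apply: triple_speed_others.
apply: filterS2 (filterI a1 a2) (filterI a3 a4) => w [b1 b2] [b3 b4].
apply: good_of_triple => //; first by move=> i j ij; apply: (b3 (i, j)).
by move=> st ijk; apply: (b4 (st, ijk)).
Qed.

Lemma law_shuffle st A : measurable A ->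
  P (joint (X \o shuffle st) @^-1` A) = P (joint X @^-1` A).
Proof.
have -> : X \o shuffle st = X \o perm (@shuffle_inj st).
  by apply/funext => i /=; rewrite permE.
apply: joint_law => //; first exact: independent_perm.
by move=> [i|k] B mB; rewrite /= permE /=; [apply: lawV|apply: lawD].
Qed.

(** The number of shuffles that give [k] survivors is integrated in two ways: by exchangeability
    each shuffle contributes the wanted probability, and almost surely this number is [q R n k]
    times the number of all shuffles. *)
Theorem survivor_count_law c k : measurable [set w | survivor_count c (joint X w) = k] /\
  P [set w | survivor_count c (joint X w) = k] = (q R n k)%:E.
Proof.
set A := [set x | survivor_count c x = k]; have mA : measurable A := measurable_survivor_count c k.
have mAs (Y : I -> {RV P >-> R}) : measurable (joint Y @^-1` A).
  by rewrite -[X in measurable X]setTI; apply: measurable_joint.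
rewrite -[X in measurable X]/(joint X @^-1` A) -[X in P X]/(joint X @^-1` A); split=> //.
set M := #|{: 'S_n * 'S_n.-1}|.
have M0 : (M%:R != 0 :> R) by rewrite pnatr_eq0 -lt0n; apply/card_gt0P; exists (1%g, 1%g).
pose f (st : 'S_n * 'S_n.-1) (w : T) : \bar R := (\1_(joint (X \o shuffle st) @^-1` A) w)%:E.
have mf st : measurable_fun setT (f st) by apply/measurable_EFinP; apply: measurable_indic.
have f0 st w : setT w -> (0 <= f st w)%E by rewrite lee_fin.
set p := P _; have pE : p = (fine p)%:E by rewrite fineK // fin_num_measure.
have E1 : (\int[P]_w \sum_(st <- index_enum {: 'S_n * 'S_n.-1}) f st w =
    (fine p * M%:R)%:E)%E.
  rewrite (ge0_integral_sum P measurableT mf f0).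
  transitivity (\sum_(st : 'S_n * 'S_n.-1) (fine p)%:E)%E.
    apply: eq_bigr => st _; rewrite -pE /f integral_indic // setIT.
    exact: law_shuffle.
  by rewrite sumEFin sumr_const; congr _%:E; rewrite mulr_natr; congr (_ *+ _).
have E2 : (\int[P]_w \sum_(st <- index_enum {: 'S_n * 'S_n.-1}) f st w =
    (q R n k * M%:R)%:E)%E.
  rewrite (ae_eq_integral (cst (q R n k * M%:R)%:E)) //.
  - rewrite [LHS](integral_cst P measurableT).
    exact: etrans (congr1 (mule _) (probability_setT P)) (mule1 _).
  - exact: emeasurable_sum.
  - apply: filterS good_ae => w gw _; rewrite /= sumEFin -(good_average c k gw).
    congr _%:E; apply: eq_bigr => st _; rewrite indicE; congr (nat_of_bool _)%:R.
    by apply/idP/eqP; rewrite inE.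
move: E1; rewrite E2 => -[] /(mulIf M0) ->; exact: pE.
Qed.

End Law.
End RandomBullets.

Section Hypotheses.
Context d (T : measurableType d) (R : realType) (P : probability T R).

Lemma mutually_independent_joint (I : finType) (X : I -> {RV P >-> R}) :
  mutually_independent X -> independent X.
Proof.
move=> iX B mB; rewrite joint_box; have := iX [set: I]%SET B mB.
rewrite (_ : [set` [set: I]%SET] = [set: I]); last first.
  by apply/seteqP; split=> i //=; rewrite finset.in_setT.
by move=> ->; apply: eq_bigl => i; rewrite finset.in_setT.
Qed.

Lemma speed_law_lt0 (mu : probability (measurableTypeR R) R) :
  speed_law mu -> mu `]-oo, 0[%classic = 0%E.
Proof.
case=> mu1 _; rewrite (_ : `]-oo, 0[%classic = ~` `[0, +oo[%classic); last first.
  by rewrite setCitvr.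
have m : measurable (`[0, +oo[%classic : set (measurableTypeR R)) by exact: measurable_itv.
by rewrite probability_setC // mu1 subee.
Qed.

Lemma delay_law_le0 (nu : probability (measurableTypeR R) R) :
  delay_law nu -> nu `]-oo, 0]%classic = 0%E.
Proof.
move=> nu1; rewrite (_ : `]-oo, 0]%classic = ~` `]0, +oo[%classic); last first.
  by rewrite setCitvr.
have m : measurable (`]0, +oo[%classic : set (measurableTypeR R)) by exact: measurable_itv.
by rewrite probability_setC // nu1 subee.
Qed.

(** Constants are independent of everything, which makes RU the case of delays all equal to 1. *)
Lemma join_cst_independent (I J : finType) (X : I -> {RV P >-> R}) (c : R) :
  mutually_independent X ->
  independent (join_families X (fun _ : J => [the {RV P >-> R} of cst c])).
Proof.
move=> iX B mB; rewrite joint_box big_sumType /=.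
have [H|] := pselect (forall j : J, B (inr j) c); last first.
  move/existsNP => [j nj]; rewrite [X in (_ * X)%E](bigD1 j) //=.
  rewrite (_ : cst c @^-1` B (inr j) = set0); last by apply/seteqP; split.
  rewrite measure0 mul0e mule0 -[RHS](measure0 P); congr (P _); apply/seteqP; split=> // w.
  by move=> /(_ (inr j) Logic.I); rewrite /= => /nj.
rewrite [X in (_ * X)%E]big1 ?mule1 => [|j _]; last first.
  rewrite -[RHS](probability_setT P); congr (P _); apply/seteqP; split=> // w _; exact: H.
have := mutually_independent_joint iX (fun i => mB (inl i)); rewrite joint_box => <-.
congr (P _); apply/seteqP; split=> w Hw i _; first exact: (Hw (inl i)).
by case: i => [i|j]; [apply: Hw|apply: H].
Qed.

End Hypotheses.

Lemma shooting_time1 (R : realType) n (i : 'I_n) :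
  shooting_time (fun _ => 1) i + 1 = i.+1%:R :> R.
Proof.
rewrite /shooting_time sumr_const -natr1; congr (_%:R + 1).
rewrite -sum1_card; have -> : \sum_(k < n.-1 | (k < i)%N) 1%N = \sum_(k < i) 1%N.
  rewrite (big_ord_widen_cond n.-1 xpredT (fun _ => 1%N)) //.
  by have := ltn_ord i; lia.
by rewrite sum1_card card_ord.
Qed.

Theorem theorem1 (R : realType) (n : nat) :
  [/\
   (* RU *)
   forall (mu : probability (measurableTypeR R) R), speed_law mu ->
   forall (d : measure_display) (T : measurableType d) (P : probability T R)
     (V : 'I_n -> {RV P >-> R}),
     mutually_independent V -> (forall i, has_law (V i) mu) ->
     nat_has_law P (RU_survivors V) (q R n),
   (* RR *)
   forall (mu nu : probability (measurableTypeR R) R),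
   speed_law mu -> delay_law nu ->
   forall (d : measure_display) (T : measurableType d) (P : probability T R)
     (V : 'I_n -> {RV P >-> R}) (D : 'I_n.-1 -> {RV P >-> R}),
     mutually_independent (join_families V D) ->
     (forall i, has_law (V i) mu) -> (forall k, has_law (D k) nu) ->
     nat_has_law P (RR_survivors V D) (q R n),
   (* FF *)
   forall (V : 'I_n -> R) (D : 'I_n.-1 -> R),
     (forall i, 0 <= V i) -> injective V -> (forall k, 0 < D k) ->
     generic (@half_line R) V D ->
     forall k, uniform_law R (FF_survivors V D) k = q R n k
   & (* FAF *)
   forall f : R -> R,
     {within `[0, +oo[, continuous f} ->
     {in `[0, +oo[ &, {homo f : x y / x < y}} ->
     {homo f : x / 0 <= x} -> f 0 = 0 ->
   forall (I : 'I_n -> R) (D : 'I_n.-1 -> R),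
     (forall i, 0 <= I i) -> injective I -> (forall k, 0 < D k) ->
     generic (curve_along f) I D ->
     forall k, uniform_law R (FAF_survivors f I D) k = q R n k].
Proof.
split.
- move=> mu smu d T P V iV lV k.
  pose X := join_families V (fun _ : 'I_n.-1 => [the {RV P >-> R} of cst 1]).
  have [||||||m pE] := @survivor_count_law R n d T P X _ _ _ _ _ _ 1 k.
  + exact: join_cst_independent.
  + by move=> i j B mB; exact: etrans (lV i B mB) (esym (lV j B mB)).
  + by [].
  + by move=> i; apply: etrans (lV i _ _) (speed_law_lt0 smu).
  + move=> i; rewrite (_ : _ @^-1` _ = set0) ?measure0 //.
    by apply/seteqP; split=> // w /=; rewrite in_itv /= ler10.
  + by move=> i c; apply: etrans (lV i _ _) (smu.2 c).
  suff E : RU_survivors V = (fun w => survivor_count 1 (joint X w)) by rewrite E.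
  apply/funext => w; congr (nb_survivors (virtual_CT _ _)).
  by apply/funext => i; rewrite -shooting_time1.
- move=> mu nu smu dnu d T P V D iX lV lD k.
  pose X := join_families V D.
  have [||||||m pE] := @survivor_count_law R n d T P X _ _ _ _ _ _ 0 k.
  + exact: mutually_independent_joint.
  + by move=> i j B mB; exact: etrans (lV i B mB) (esym (lV j B mB)).
  + by move=> i j B mB; exact: etrans (lD i B mB) (esym (lD j B mB)).
  + by move=> i; apply: etrans (lV i _ _) (speed_law_lt0 smu).
  + by move=> i; apply: etrans (lD i _ _) (delay_law_le0 dnu).
  + by move=> i c; apply: etrans (lV i _ _) (smu.2 c).
  suff E : RR_survivors V D = (fun w => survivor_count 0 (joint X w)) by rewrite E.
  apply/funext => w; congr (nb_survivors (virtual_CT _ _)).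
  by apply/funext => i; rewrite addr0.
- by move=> V D V0 VI D0 gen k; apply: FF_law.
- move=> f _ fS _ _ V D V0 VI D0 gen k.
  rewrite -(FF_law V0 VI D0 (generic_half_line gen)) /uniform_law.
  by congr (_%:R / _); apply: eq_card => st; rewrite !inE FAF_survivorsE.
Qed.
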